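(* Fix $t>0$. Let $\mathfrak{h}:C([0,t];\mathbb{R})\to\mathbb{R}$ be a measurable function such that, for every $\phi\in C([0,t];\mathbb{R})$, the function $\mathfrak{h}_{\phi}:\mathbb{R}\to\mathbb{R}$ defined by $$\mathfrak{h}_{\phi}(\xi):=\mathfrak{h}\bigl(\mathbb{T}_{\phi_t-\xi}(\phi)\bigr),\quad \xi\in\mathbb{R},$$ is of class $C^1$ and strictly monotone. Then, for every nonnegative measurable function $F$ on $C([0,t];\mathbb{R}^2)$, $$\mathbb{E}\left[F\bigl(\mathbb{T}_{B_t-\mathfrak{h}(B)}(B),B\bigr)\exp\left\{-\frac{\cosh\mathfrak{h}(B)}{Z_t}+\frac{\cosh B_t}{Z_t}\right\}\bigl|\mathfrak{h}_B'(B_t)\bigr|\right]=\mathbb{E}\left[F\bigl(B,\mathbb{T}_{B_t-\mathfrak{h}_B^{-1}(B_t)}(B)\bigr);\,B_t\in\mathfrak{h}_B(\mathbb{R})\right],$$ where, for every $\phi\in C([0,t];\mathbb{R})$, $\mathfrak{h}_{\phi}^{-1}$ denotes the inverse function of $\mathfrak{h}_{\phi}$ (defined on $\mathfrak{h}_\phi(\mathbb{R})$) and $\mathfrak{h}_\phi'$ its derivative $d\mathfrak{h}_\phi/d\xi$.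
   Context: $B=\{B_s\}_{s\ge 0}$ is a one-dimensional standard Brownian motion (started at $0$); inside functionals of paths on $[0,t]$, $B$ stands for its restriction $\{B_s\}_{0\le s\le t}$. For a continuous real-valued path $\phi$ set $$A_s(\phi):=\int_0^s e^{2\phi_u}\,du,\qquad Z_s(\phi):=e^{-\phi_s}A_s(\phi),$$ and write $A_s:=A_s(B)$, $Z_s:=Z_s(B)$. For $z\in\mathbb{R}$, the path transformation $\mathbb{T}_z$ on $C([0,t];\mathbb{R})$ is defined by $$\mathbb{T}_z(\phi)(s):=\phi_s-\log\left\{1+\frac{A_s(\phi)}{A_t(\phi)}\left(e^z-1\right)\right\},\quad 0\le s\le t,\ \phi\in C([0,t];\mathbb{R}).$$ $C([0,t];\mathbb{R})$ and $C([0,t];\mathbb{R}^2)$ are the spaces of continuous $\mathbb{R}$- and $\mathbb{R}^2$-valued functions on $[0,t]$ with the topology of uniform convergence; ''measurable'' for real-valued functions on them means Borel-measurable. A pair $(\phi^1,\phi^2)$ of elements of $C([0,t];\mathbb{R})$ is regarded as an element of $C([0,t];\mathbb{R}^2)$. The notation $\mathbb{E}[X;\,E]$ means $\mathbb{E}[X\mathbf{1}_E]$. $\mathbb{T}_{B_t-\mathfrak{h}(B)}(B)$ means $\mathbb{T}_z(\phi)$ evaluated at $\phi=B$, $z=B_t-\mathfrak{h}(B)$, and similarly for the other random parameters; $\mathfrak{h}_B$ means $\mathfrak{h}_\phi$ at $\phi=B$. *)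

(* Defs.v *)
From HB Require Import structures.
From mathcomp Require Import all_boot all_order all_algebra.
From mathcomp Require Import ring.
From mathcomp Require Import all_classical all_reals all_analysis.

Set Implicit Arguments.
Unset Strict Implicit.
Unset Printing Implicit Defensive.

Import Order.TTheory GRing.Theory Num.Theory.
Import numFieldNormedType.Exports.

Local Open Scope classical_set_scope.
Local Open Scope ring_scope.

Definition cosh {R : realType} (x : R) : R := (expR x + expR (- x)) / 2.

Section path_space.
Context {R : realType} (t : R).
Local Notation I := (set_type (`[0, t] : set R)).

(* C([0,t]; V).  Its topology is that of uniform convergence on [0,t], its
   sigma-algebra the Borel one.  R and (R * R)%type are canonically normed
   modules over R, hence can be used for V. *)
Definition cpath (V : normedModType R) : Type := continuousType I V.

Definition cpath_uniform (V : normedModType R) (phi : cpath V) :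
  {uniform I -> V} := phi.

Definition cpath0 (V : normedModType R) : cpath V :=
  mkcts (fun x : I => @cst_continuous I V 0 x).

HB.instance Definition _ (V : normedModType R) :=
  Choice.copy (cpath V) (continuousType I V).

HB.instance Definition _ (V : normedModType R) :=
  isPointed.Build (cpath V) (cpath0 V).

HB.instance Definition _ (V : normedModType R) :=
  Uniform.copy (cpath V) (initial_topology (@cpath_uniform V)).

HB.instance Definition _ (V : normedModType R) :=
  Measurable.copy (cpath V) (g_sigma_algebraType (@open (cpath V))).

Lemma restr_continuous (f : R -> R) :
  {within `[0, t], continuous f} -> continuous (fun s : I => f (set_val s)).
Proof. by move/subspace_sigL_continuousP. Qed.

Definition cpath_restr (f : R -> R) (cf : {within `[0, t], continuous f}) :
  cpath R := mkcts (restr_continuous cf).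

(* Equal to phi on [0,t] (cpath_extE) and to 0 elsewhere. *)
Definition cpath_ext (phi : cpath R) : R -> R := 'valL_(0 : R) phi.

Lemma cpath_extE (phi : cpath R) (s : I) : cpath_ext phi (set_val s) = phi s.
Proof. by rewrite -[RHS](congr1 (@^~ s) (valLK (0 : R) phi)). Qed.

Lemma cpath_ext_continuous (phi : cpath R) :
  {within `[0, t], continuous (cpath_ext phi)}.
Proof. by apply/subspace_valL_continuousP'; exact: cts_fun. Qed.

Lemma cpath_pair_continuous (phi psi : cpath R) :
  continuous (fun s : I => (phi s, psi s)).
Proof.
move=> s; have cphi := @cts_fun _ _ phi s; have cpsi := @cts_fun _ _ psi s.
exact: (cvg_pair cphi cpsi).
Qed.

Definition cpath_pair (phi psi : cpath R) : cpath (R * R)%type :=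
  mkcts (@cpath_pair_continuous phi psi).

End path_space.

Section functionals.
Context {R : realType}.
Implicit Types f : R -> R.

Definition A_ f (s : R) : R :=
  \int[@lebesgue_measure R]_(u in `[0, s]) expR (2 * f u).

Definition Z_ f (s : R) : R := expR (- f s) * A_ f s.

End functionals.

Section transform.
Context {R : realType} (t : R).
Local Notation I := (set_type (`[0, t] : set R)).
Local Notation mu := (@lebesgue_measure R).

Lemma A_integrable (f : R -> R) : {within `[0, t], continuous f} ->
  mu.-integrable `[0, t] (EFin \o (fun u => expR (2 * f u))).
Proof.
move=> cf; apply: continuous_compact_integrable; first exact: segment_compact.
have /subspace_sigL_continuousP cs := cf.
apply/subspace_sigL_continuousP => x.
apply: (@continuous_comp _ _ _ (fun u : I => 2 * f (set_val u)) expR).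
  exact: (cvgM (cvg_cst _) (cs x)).
exact: (@continuous_expR R).
Qed.

Lemma A_continuous (f : R -> R) : 0 <= t -> {within `[0, t], continuous f} ->
  {within `[0, t], continuous (A_ f)}.
Proof.
by move=> t0 /A_integrable; exact: parameterized_integral_continuous.
Qed.

Lemma A_ge0 (f : R -> R) s : 0 <= A_ f s.
Proof. by apply: Rintegral_ge0 => x _; exact: expR_ge0. Qed.

Lemma A_le (f : R -> R) s : {within `[0, t], continuous f} ->
  s <= t -> A_ f s <= A_ f t.
Proof.
move=> /A_integrable intf st; rewrite /A_ /Rintegral fine_le//.
- apply: integrable_fin_num => //; apply: integrableS intf => //.
  by apply: subset_itvl; rewrite bnd_simp.
- exact: integrable_fin_num.
- apply: ge0_subset_integral => //.
  + exact: measurable_int intf.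
  + by apply: subset_itvl; rewrite bnd_simp.
Qed.

Lemma T_continuous (z : R) (phi : cpath t R) :
  continuous (fun s : I => phi s -
    ln (1 + A_ (cpath_ext phi) (set_val s) / A_ (cpath_ext phi) t
            * (expR z - 1))).
Proof.
set f := cpath_ext phi; move=> s.
have cf : {within `[0, t], continuous f} by exact: cpath_ext_continuous.
have := set_valP s; rewrite /= in_itv/= => /andP[s0 st].
have t0 : 0 <= t by exact: le_trans st.
have cA := (subspace_sigL_continuousP _ _).1 (A_continuous t0 cf).
have pos : 0 < 1 + A_ f (set_val s) / A_ f t * (expR z - 1).
  set r := A_ f _ / _.
  have r0 : 0 <= r by rewrite divr_ge0// A_ge0.
  have r1 : r <= 1.
    have [At0|At0] := eqVneq (A_ f t) 0; first by rewrite /r At0 invr0 mulr0.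
    by rewrite /r ler_pdivrMr ?mul1r ?A_le// lt_neqAle eq_sym At0 A_ge0.
  have -> : 1 + r * (expR z - 1) = (1 - r) + r * expR z by ring.
  have [->|rn0] := eqVneq r 0; first by rewrite subr0 mul0r addr0.
  by rewrite ltr_wpDl ?subr_ge0// mulr_gt0 ?expR_gt0// lt_neqAle eq_sym rn0.
have clin : {for s, continuous
    (fun s : I => 1 + A_ f (set_val s) / A_ f t * (expR z - 1))}.
  exact: (cvgD (cvg_cst _)
    (cvgM (cvgM (cA s) (cvg_cst _)) (cvg_cst _))).
exact: (cvgB (@cts_fun _ _ phi s)
  (continuous_comp clin (@continuous_ln R _ pos))).
Qed.

Definition T_ (z : R) (phi : cpath t R) : cpath t R :=
  mkcts (@T_continuous z phi).

(* The function h_phi : xi |-> h (T_(phi_t - xi) (phi)). *)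
Definition profile (h : cpath t R -> R) (phi : cpath t R) (xi : R) : R :=
  h (T_ (cpath_ext phi t - xi) phi).

End transform.

Definition class_C1 {R : realType} (f : R -> R) : Prop :=
  (forall x, derivable f x 1) /\ continuous (derive1 f).

Definition strictly_monotone {R : realType} (f : R -> R) : Prop :=
  {homo f : x y / x < y} \/ {homo f : x y /~ x < y}.

(* For injective f, the inverse of f on range f; the value outside range f is
   irrelevant. *)
Definition inverse {R : realType} (f : R -> R) : R -> R :=
  'pinv_(fun=> 0) [set: R] f.

Section brownian_motion.
Context d {Omega : measurableType d} {R : realType} (P : probability Omega R).

(* For a finite family the product rule over all indices contains the one over
   any subset of indices: take E i = setT for the other indices. *)
Definition mutually_independent n (X : 'I_n -> Omega -> R) : Prop :=
  forall E : 'I_n -> set R, (forall i, measurable (E i)) ->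
    P (\bigcap_i (X i @^-1` E i)) = (\prod_(i < n) P (X i @^-1` E i))%E.

(* B s is unconstrained for s < 0.  The second parameter of normal_prob is the
   standard deviation. *)
Record brownian_motion (B : R -> {RV P >-> R}) : Prop := {
  bm_start : forall w, B 0 w = 0;
  bm_continuous : forall w,
    {within (`[0, +oo[ : set R), continuous (fun s : R => B s w : R)};
  bm_increment : forall r s : R, 0 <= r -> r < s ->
    forall E : set R, measurable E ->
    P ((fun w => B s w - B r w) @^-1` E) = normal_prob 0 (Num.sqrt (s - r)) E;
  bm_independent : forall n (u : nat -> R), 0 <= u 0%N ->
    {homo u : i j / (i < j)%N >-> i < j} ->
    mutually_independent (fun (i : 'I_n) w => B (u i.+1) w - B (u i) w)
}.

Lemma bm_within (B : R -> {RV P >-> R}) (bm : brownian_motion B) (t : R) w :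
  {within `[0, t], continuous (fun s : R => B s w : R)}.
Proof.
have sub : `[0, t] `<=` `[(0 : R), +oo[ by apply: subset_itvl; rewrite bnd_simp.
exact: (continuous_subspaceW sub (@bm_continuous _ bm w)).
Qed.

Definition bm_path (B : R -> {RV P >-> R}) (bm : brownian_motion B) (t : R)
  (w : Omega) : cpath t R := cpath_restr (@bm_within B bm t w).

End brownian_motion.

(* Main.v *)
From HB Require Import structures.
Require Import Defs.
From mathcomp Require Import all_boot all_order all_algebra.
From mathcomp Require Import ring lra.
From mathcomp Require Import all_classical all_reals all_analysis.
From mathcomp Require Import measurable_realfun.
Import Order.TTheory GRing.Theory Num.Theory.
Import numFieldNormedType.Exports.
Local Open Scope classical_set_scope.
Local Open Scope ring_scope.
Set Implicit Arguments.
Unset Strict Implicit.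
Unset Printing Implicit Defensive.

(** Fix a path phi on [0, t], write A for its area functional, and let
    phi^xi = T_(phi_t - xi) (phi).  The T_z form a flow: T_z' after T_z is
    T_(z + z').  Hence phi^xi is the point ending at xi of the orbit of phi, Z_t
    is constant on the orbit, and so is the function profile h; moreover
    h (phi^xi) = profile h phi xi.  The theorem is a change of variables along
    each orbit, once the law of B is disintegrated over the orbits:

      E [K (B)] = E [r (B) int K (B^xi) exp (- cosh xi / Z_t) dxi]

    for all measurable K >= 0, with a factor r that does not depend on K
    (brownian_disintegration).  If K is one of the two sides of the theorem and
    f = profile h phi, then the inner integral is int g (f xi) |f' xi| dxi for the
    left-hand side and the integral of g over the range of f for the right-hand
    side, with the same function g; the two agree (substitution, integral_steer).

    The disintegration comes from a family of quasi-invariances.  Let S_c be the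
    map phi |-> phi - ln (1 + c A), which sends A to A / (1 + c A), that is
    1 / A_t to 1 / A_t + c.  Then (shift_invariance)

      E [H (S_c B) D_c (B); 1 + c A_t > 0] = E [H (B); 1 - c A_t > 0],
      D_c = exp (c / 2 (e^(2 B_t) / (1 + c A_t) - 1)) / (1 + c A_t).

    Choose H = K e^(c - 1 / A_t) and integrate over c: on the right the integral
    of e^(c - 1 / A_t) over c < 1 / A_t is 1, and on the left the substitution
    c = (e^(phi_t - xi) - 1) / A_t turns S_c phi into phi^xi and D_c dc into a
    factor depending on phi alone times exp (- cosh xi / Z_t) dxi.

    The quasi-invariance is obtained by discretisation.  On a grid of mesh delta,
    replace A by the sum of delta e^(x_j + x_(j+1)), where the x_j are the values
    of the path.  With this quadrature rule S_c is exact: it maps the discrete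
    pair (path, area) to a pair of the same kind (twist_advance), and an
    increment u becomes the v with e^(-v) = e^(-u) + k, where k depends on the
    past only.  One Gaussian change of variables per step therefore compares the
    two walks (discrete_twist_le).  The product of the Jacobian factors
    telescopes to D_c up to a remainder of the order of the sum of the |u|^3
    (grid_weight_formula), which tends to 0 almost surely along the meshes t / 4^m.
    Fatou's lemma leaves an inequality for products of functions of finitely many
    pairs (B_s, A_s) (twist_inequality).  Applied to c and to - c, the map S_(- c)
    being inverse to S_c, it yields an equality (twist_equality).  Such
    products determine a finite Borel measure on the path space (cylinder_unique),
    because the Borel sets are generated by the evaluations (measurable_cpath). *)

(** * Measures with a density, image measures and change of variables on the line *)

Section density.
Context d (T : measurableType d) (R : realType).
Variables (mu nu : {measure set T -> \bar R}) (w : T -> R).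
Hypotheses (w0 : forall x, 0 <= w x) (mw : measurable_fun setT w).
Hypothesis nuE : forall A, measurable A -> nu A = (\int[mu]_(x in A) (w x)%:E)%E.

Import HBNNSimple.
Local Open Scope ereal_scope.

(** Both sides are continuous along increasing simple approximations of [f], and
    on simple functions the identity is [nuE]. *)
Lemma ge0_integral_density (f : T -> \bar R) : measurable_fun setT f ->
  (forall x, 0 <= f x) -> \int[nu]_x f x = \int[mu]_x (f x * (w x)%:E).
Proof.
move=> mf f0; pose h := nnsfun_approx measurableT mf.
have mwE : measurable_fun [set: T] (EFin \o w) by exact/measurable_EFinP.
have hf x : (EFin \o h n) x @[n --> \oo] --> f x.
  by apply: cvg_nnsfun_approx.
have ndh x a b : (a <= b)%N -> (h a x <= h b x)%R.
  by move=> ab; exact/lefP/nd_nnsfun_approx.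
have -> : \int[nu]_x f x = lim (\int[nu]_x (EFin \o h n) x @[n --> \oo]).
  rewrite -(@monotone_convergence _ _ _ nu setT measurableT
    (fun n => EFin \o h n)).
  - by apply: eq_integral => x _; apply/esym/cvg_lim => //; exact: hf.
  - by move=> n; exact/measurable_EFinP.
  - by move=> n x _ /=; rewrite lee_fin.
  - by move=> x _ a b ab /=; rewrite lee_fin ndh.
have -> : \int[mu]_x (f x * (w x)%:E) =
    lim (\int[mu]_x ((h n x)%:E * (w x)%:E) @[n --> \oo]).
  rewrite -(@monotone_convergence _ _ _ mu setT measurableT
    (fun n x => ((h n x)%:E * (w x)%:E))).
  - apply: eq_integral => x _; apply/esym/cvg_lim => //.
    by apply: cvgeZr => //; exact: hf.
  - by move=> n; apply: emeasurable_funM => //; exact/measurable_EFinP.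
  - by move=> n x _ /=; rewrite mule_ge0// lee_fin.
  - by move=> x _ a b ab /=; rewrite lee_wpmul2r ?lee_fin// ndh.
suff suf n : \int[nu]_x (h n x)%:E = \int[mu]_x ((h n x)%:E * (w x)%:E).
  by under eq_fun do rewrite /= suf.
transitivity (\int[nu]_x
   (\sum_(y \in range (h n)) (y * \1_(h n @^-1` [set y]) x)%:E)).
  by apply: eq_integral => t tE; rewrite /= fimfunE -fsumEFin.
have indich r : measurable_fun [set: T]
    (fun x => (r * \1_(h n @^-1` [set r]) x)%:E).
  by apply/measurable_EFinP; exact: measurable_funM.
rewrite ge0_integral_fsum//; last by move=> m y Ey; exact: nnfun_muleindic_ge0.
transitivity (\int[mu]_x (\sum_(y \in range (h n))
    (y * \1_(h n @^-1` [set y]) x)%:E * (w x)%:E)); last first.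
  apply: eq_integral => x xE.
  rewrite -ge0_mule_fsuml => [|y]; last exact: nnfun_muleindic_ge0.
  by rewrite fsumEFin // -(fimfunE _ x).
rewrite ge0_integral_fsum//; last 2 first.
  - by move=> y; exact: emeasurable_funM.
  - by move=> m y Ey; rewrite mule_ge0 ?lee_fin// -lee_fin nnfun_muleindic_ge0.
apply: eq_fsbigr => r rhn.
under eq_integral do rewrite EFinM.
rewrite integralZl_indic_nnsfun// integral_indic// setIT nuE//.
under [RHS]eq_integral do rewrite EFinM -muleA.
rewrite ge0_integralZl//.
- congr (_ * _); rewrite integral_mkcond; apply: eq_integral => x _.
  by rewrite patchE indicE; case: ifPn => _; rewrite ?mul1e ?mul0e.
- by apply: emeasurable_funM => //; exact/measurable_EFinP.
- by move=> t _; rewrite mule_ge0 ?lee_fin.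
- by move: rhn; rewrite inE => -[t _ <-]; rewrite lee_fin.
Qed.
End density.

(** The measure comes together with its rule of integration, so that it can be
    compared with an image measure without regard to how either is built. *)
Lemma density_measure d (T : measurableType d) (R : realType)
    (mu : {measure set T -> \bar R}) (w : T -> R) :
  (forall x, 0 <= w x) -> measurable_fun setT w ->
  exists nu : {measure set T -> \bar R},
    (forall A, measurable A -> nu A = \int[mu]_(x in A) (w x)%:E)%E /\
    (forall f : T -> \bar R, measurable_fun setT f -> (forall x, 0 <= f x)%E ->
      \int[nu]_x f x = \int[mu]_x (f x * (w x)%:E))%E.
Proof.
move=> w0 mw; pose m A := (\int[mu]_(x in A) (w x)%:E)%E.
have m0 : m set0 = 0%E by rewrite /m integral_set0.
have mge0 A : (0 <= m A)%E by apply: integral_ge0 => x _; rewrite lee_fin.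
have msa : semi_sigma_additive m.
  move=> F mF tF mUF; rewrite /m ge0_integral_bigcup//=.
  - by apply: is_cvg_ereal_nneg_natsum_cond => n _ _; exact: mge0.
  - by apply/measurable_funTS/measurable_EFinP.
  - by move=> x _; rewrite lee_fin.
pose M := isMeasure.Build _ _ _ m m0 mge0 msa.
pose nu : {measure set T -> \bar R} := HB.pack m M.
exists nu; split=> // f mf f0; exact: ge0_integral_density.
Qed.

Lemma pushforward_measure d d' (T : measurableType d) (T' : measurableType d')
    (R : realType) (mu : {measure set T -> \bar R}) (phi : T -> T') :
  measurable_fun setT phi ->
  exists nu : {measure set T' -> \bar R},
    (forall A, nu A = mu (phi @^-1` A)) /\
    (forall g : T' -> \bar R, measurable_fun setT g -> (forall y, 0 <= g y)%E ->
      \int[nu]_y g y = \int[mu]_x g (phi x))%E.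
Proof.
move=> mphi; pose nu0 : {measure set T' -> \bar R} := pushforward mu phi.
exists (nu0 mphi); split=> // g mg g0.
by rewrite ge0_integral_pushforward// preimage_setT.
Qed.

Section substitution.
Context {R : realType}.
Local Notation mu := (@lebesgue_measure R).
Implicit Types f : R -> R.

Lemma class_C1_continuous f : class_C1 f -> continuous f.
Proof.
by case=> df _ x; apply: differentiable_continuous; exact/derivable1_diffP.
Qed.

Lemma continuous_range_interval f : continuous f -> is_interval (range f).
Proof.
move=> cf _ _ [a _ <-] [b _ <-] z /andP[az zb].
have wcf u v : {within `[u, v], continuous f} by exact: continuous_subspaceT.
have [ab|/ltW ba] := leP a b.
- have /(IVT ab (wcf _ _))[c _ <-] : Num.min (f a) (f b) <= z <= Num.max (f a) (f b).
    by rewrite ge_min az/= le_max zb orbT.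
  by exists c.
- have /(IVT ba (wcf _ _))[c _ <-] : Num.min (f b) (f a) <= z <= Num.max (f b) (f a).
    by rewrite ge_min az orbT/= le_max zb.
  by exists c.
Qed.

Lemma derive1_incr_ge0 f : (forall x, derivable f x 1) ->
  {homo f : x y / x < y} -> forall x, 0 <= derive1 f x.
Proof.
move=> df hf x; apply: (@incr_derive1_ge0 _ _ setT).
- by move=> y _; exact: df.
- by move=> y z _ _; exact: hf.
- by rewrite interiorT.
Qed.

(** The left-hand side integrates [g \o f] against the measure with density f',
    the right-hand side against the image of Lebesgue measure on [range f] under
    the inverse of [f].  Both measures give the interval ]a, b] the mass
    f b - f a, the first one by the fundamental theorem of calculus. *)
Lemma substitution_incr f (g : R -> \bar R) : class_C1 f ->
  {homo f : x y / x < y} -> measurable_fun setT g -> (forall x, 0 <= g x)%E ->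
  (\int[mu]_x (g (f x) * (derive1 f x)%:E) = \int[mu]_(y in range f) g y)%E.
Proof.
move=> C1f hf mg g0; have cf := class_C1_continuous C1f.
have [df cf'] := C1f.
have f'0 := derive1_incr_ge0 df hf.
have mf' : measurable_fun setT (derive1 f) by exact: continuous_measurable_fun.
have mrg : measurable (range f).
  by apply: is_interval_measurable; exact: continuous_range_interval.
have monof : {mono f : x y / x <= y} by apply: le_mono; exact: hf.
have injf : injective f by exact: inc_inj.
have monolf : {mono f : x y / x < y} by exact: leW_mono.
pose inv := inverse f.
have invK x : inv (f x) = x.
  by rewrite /inv /inverse pinvKV ?inE// => a b _ _; exact: injf.
have finv y : range f y -> f (inv y) = y.
  by move=> [x _ <-]; rewrite invK.
(* Cut off outside the range to be measurable on the whole line. *)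
pose inv' := inv \_ (range f).
have minv : measurable_fun setT inv'.
  apply/(measurable_restrictT _ mrg) => _.
  apply: (measurability _ (RGenOInfty.measurableE R)) => // _ [_ [a ->] <-].
  rewrite (_ : _ `&` _ = range f `&` `]f a, +oo[%classic); last first.
    apply/seteqP; split=> y [[x _ <-]] /=; rewrite !in_itv/= !andbT invK monolf//;
    by split => //; exists x.
  exact: measurableI.
have ind0 x : 0 <= \1_(range f) x :> R by [].
have [nu1 [nu1E nu1I]] := density_measure (T := measurableTypeR R) mu f'0 mf'.
have [nur [nurE nurI]] := density_measure (T := measurableTypeR R) mu ind0 (measurable_indic mrg).
have [nu2 [nu2E nu2I]] := pushforward_measure (T := measurableTypeR R) (T' := measurableTypeR R) nur minv.
have e12 : forall A, measurable A -> nu1 A = nu2 A.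
  have e12o a b : a <= b -> nu1 `]a, b]%classic = (f b - f a)%:E /\
      nu2 `]a, b]%classic = (f b - f a)%:E.
    rewrite le_eqVlt => /predU1P[<-|ab].
      by rewrite set_itvoc0 !measure0 subrr.
    split.
    - rewrite nu1E// integral_itv_obnd_cbnd; last first.
        by apply/measurable_EFinP; exact: measurable_funTS.
      rewrite (continuous_FTC2 (F := f) ab).
      + by [].
      + exact: continuous_subspaceT.
      + split; first by move=> x _; exact: df.
        * by apply: cvg_at_right_filter; exact: cf.
        * by apply: cvg_at_left_filter; exact: cf.
      + by [].
    - rewrite nu2E nurE; last first.
        by rewrite -[X in measurable X]setTI; exact: minv.
      rewrite integral_indic//; last first.
        by rewrite -[X in measurable X]setTI; exact: minv.
      transitivity (mu `]f a, f b]%classic); last first.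
        by rewrite lebesgue_measure_itv/= lte_fin monolf ab EFinB.
      congr (mu _).
      apply/seteqP; split=> y /=.
        move=> [[x _ <-]]; rewrite /inv' patchE mem_set; last by exists x.
        by rewrite invK !in_itv/= monolf monof.
      rewrite in_itv/= => /andP[ay yb].
      have ry : range f y.
        have := continuous_range_interval cf; apply.
        - by exists a.
        - by exists b.
        - by rewrite (ltW ay) yb.
      split => //; rewrite /inv' patchE mem_set//.
      by case: ry => x _ xy; move: ay yb; rewrite -xy invK !in_itv/= monolf monof => ->.
  have e12' X : ocitv X -> nu1 X = nu2 X.
    move=> [[a b] _ <-] /=; have [ab|ba] := leP a b.
      by have [-> ->] := e12o _ _ ab.
    by rewrite set_itv_ge ?measure0// bnd_simp -leNgt ltW.
  move=> A mA; refine (@measure_unique _ R (measurableTypeR R) (@ocitv R) (fun n => `](- n%:R), n%:R]%classic) _ _ _ _ nu1 nu2 e12' _ A mA) => //.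
  - exact: ocitvI.
  - by move=> i; exact: is_ocitv.
  - rewrite -subTset => x _ /=.
    exists (Num.truncn `|x|).+1 => //=; rewrite in_itv/= -ltrNl.
    have := truncnS_gt `|x|; rewrite ltr_norml => /andP[h1 /ltW ->].
    by rewrite ltrNl andbT.
  - move=> k; have [|-> _] := e12o (- k%:R) k%:R; last by rewrite ltry.
    by rewrite (@le_trans _ _ 0)// oppr_le0.
have mgf : measurable_fun setT (g \o f).
  by apply: measurableT_comp => //; exact: continuous_measurable_fun.
rewrite -(nu1I (g \o f))//; last by move=> x; exact: g0.
rewrite (eq_measure_integral nu2); last by move=> A mA _; exact: e12.
have mgf' : measurable_fun setT (fun y => g (f (inv' y))).
  exact: (measurableT_comp mgf minv).
rewrite (nu2I (g \o f))//; last by move=> x; exact: g0.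
rewrite (nurI (fun y => g (f (inv' y))))//.
rewrite [RHS]integral_mkcond; apply: eq_integral => y _ /=.
rewrite patchE indicE; case: ifPn => yr; last by rewrite mule0.
by rewrite mule1 /inv' patchE yr finv// -inE.
Qed.

Lemma ge0_integral_oppr (k : R -> \bar R) : measurable_fun setT k ->
  (forall x, 0 <= k x)%E -> (\int[mu]_x k (- x)%R = \int[mu]_x k x)%E.
Proof.
move=> mk k0; have mN : measurable_fun [set: R] (-%R : R -> R).
  exact: oppr_measurable.
have [nu [nuE nuI]] := pushforward_measure (T := measurableTypeR R)
  (T' := measurableTypeR R) mu mN.
rewrite -nuI//; apply: eq_measure_integral => A mA _.
by rewrite nuE; exact: lebesgue_measureN.
Qed.

(** A decreasing [f] is reduced to the increasing [\- f] by the reflection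
    invariance of Lebesgue measure. *)
Lemma substitution f (g : R -> \bar R) : class_C1 f ->
  strictly_monotone f -> measurable_fun setT g -> (forall x, 0 <= g x)%E ->
  (\int[mu]_x (g (f x) * `|derive1 f x|%:E) = \int[mu]_(y in range f) g y)%E.
Proof.
move=> C1f [hf|hf] mg g0.
  rewrite -substitution_incr//; apply: eq_integral => x _.
  by rewrite ger0_norm//; apply: derive1_incr_ge0 => //; exact: C1f.1.
have [df cf'] := C1f; have cf := class_C1_continuous C1f.
have f'N : derive1 (\- f) = \- derive1 f.
  by apply/funext => x; rewrite derive1N.
have C1N : class_C1 (\- f).
  split; first by move=> x; exact: derivableN.
  by rewrite f'N => x; apply: continuousN; exact: cf'.
have hN : {homo (\- f) : x y / x < y} by move=> x y xy /=; rewrite ltrN2 hf.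
have mrg : measurable (range f).
  by apply: is_interval_measurable; exact: continuous_range_interval.
have mgN : measurable_fun setT (fun y : R => g (- y)).
  by apply: measurableT_comp => //; exact: oppr_measurable.
have := substitution_incr C1N hN mgN (fun x => g0 (- x)).
under eq_integral do rewrite [g _]/= opprK.
move=> e.
transitivity (\int[mu]_x (g (f x) * (derive1 (\- f) x)%:E))%E.
  apply: eq_integral => x _; rewrite ler0_norm ?f'N// -oppr_ge0.
  by have := derive1_incr_ge0 C1N.1 hN x; rewrite f'N.
rewrite e integral_mkcond [RHS]integral_mkcond -[RHS]ge0_integral_oppr.
- apply: eq_integral => y _; rewrite !patchE.
  rewrite (_ : (y \in range (\- f)) = (- y \in range f))//.
  apply/idP/idP; rewrite !inE => -[x _ /= xy]; exists x => //=.
    by rewrite -xy opprK.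
  by rewrite xy opprK.
- by apply/(measurable_restrictT _ mrg); exact: measurable_funTS.
- by move=> x; rewrite patchE; case: ifP.
Qed.

End substitution.

(** * One Gaussian increment under the map bend *)

Section gaussian_step.
Context {R : realType}.
Local Notation mu := (@lebesgue_measure R).
Implicit Types (k u v x : R) (f : R -> \bar R).

Definition gauss (delta : R) := @normal_prob R 0 (Num.sqrt delta).
HB.instance Definition _ (delta : R) := Probability.on (gauss delta).

Lemma integral_gauss delta f : measurable_fun setT f -> (forall x, 0 <= f x)%E ->
  (\int[gauss delta]_x f x =
   \int[mu]_x (f x * (normal_pdf 0 (Num.sqrt delta) x)%:E))%E.
Proof.
move=> mf f0; apply: ge0_integral_density => //.
- by move=> x; exact: normal_pdf_ge0.
- exact: measurable_normal_pdf.
Qed.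

(** The [v] with e^(-v) = e^(-u) + k; when the sum is not positive the value is
    a default one, excluded wherever [bend] is used. *)
Definition bend k u := - ln (expR (- u) + k).

Lemma expR_bend k u : 0 < expR (- u) + k -> expR (- bend k u) = expR (- u) + k.
Proof. by move=> h; rewrite opprK lnK// posrE. Qed.

Lemma bendK k u : 0 < expR (- u) + k -> bend (- k) (bend k u) = u.
Proof. by move=> h; rewrite {1}/bend expR_bend// addrK expRK opprK. Qed.

Lemma is_derive_bend k u : 0 <= k ->
  is_derive u 1 (bend k) (expR (bend k u - u)).
Proof.
move=> k0; have h : 0 < expR (- u) + k by rewrite ltr_pwDl// expR_gt0.
have d1 : is_derive u (1 : R) (fun u => expR (- u) + k) (- expR (- u)).
  have d2 := @is_derive1_comp R expR -%R u _ _ (is_derive_expR _) (is_deriveNid u 1).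
  have d3 := is_deriveD d2 (is_derive_cst k u (1 : R)).
  by apply: is_derive_eq d3 _; rewrite addr0 mulrN1.
have d4 := is_deriveN (@is_derive1_comp R (@ln R) (fun u => expR (- u) + k) u _ _ (is_derive1_ln h) d1).
apply: (is_derive_eq d4).
by rewrite mulrN opprK expRD -(expR_bend h) expRN invrK.
Qed.

Lemma bend_C1 k : 0 <= k -> class_C1 (bend k).
Proof.
move=> k0; have db u := is_derive_bend u k0.
have cb : continuous (bend k).
  move=> u; apply: differentiable_continuous; apply/derivable1_diffP; exact: (@ex_derive _ _ _ _ _ _ _ (db u)).
split; first by move=> u; exact: (@ex_derive _ _ _ _ _ _ _ (db u)).
have -> : derive1 (bend k) = fun u => expR (bend k u - u).
  by apply/funext => u; rewrite derive1E; rewrite derive_val.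
move=> u; apply: continuous_comp; last exact: continuous_expR.
by apply: (@continuousB _ R^o) => //; exact: cb.
Qed.

Lemma derive1_bend k u : 0 <= k -> derive1 (bend k) u = expR (bend k u - u).
Proof.
move=> k0; have db := is_derive_bend u k0.
by rewrite derive1E; rewrite derive_val.
Qed.

Lemma bend_incr k : 0 <= k -> {homo bend k : x y / x < y}.
Proof.
move=> k0 x y xy; have h z : 0 < expR (- z) + k by rewrite ltr_pwDl// expR_gt0.
rewrite /bend ltrN2 ltr_ln ?posrE//.
by rewrite ltrD2r ltr_expR ltrN2.
Qed.

Lemma measurable_bend k : measurable_fun setT (bend k).
Proof.
apply: measurable_funN; apply: measurableT_comp; first exact: measurable_ln.
by apply: measurable_funD => //; apply: measurableT_comp => //.
Qed.

(** Change of variables v = bend k u.  It is an inequality because the range of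
    [bend k] is only a half-line when k > 0; when k < 0, the map is the inverse
    of [bend (- k)]. *)
Lemma le_integral_bend k (g : R -> \bar R) : measurable_fun setT g ->
  (forall x, 0 <= g x)%E ->
  (\int[mu]_u (((0 < expR (- u) + k)%R)%:R%:E * (expR (bend k u - u))%:E * g (bend k u))
   <= \int[mu]_v g v)%E.
Proof.
move=> mg g0; have [k0|k0] := leP 0 k.
  apply: (@le_trans _ _ (\int[mu]_(v in range (bend k)) g v)%E); last first.
    apply: ge0_subset_integral => //.
    apply: is_interval_measurable; apply: continuous_range_interval.
    exact/class_C1_continuous/bend_C1.
  rewrite -substitution//; [|exact: bend_C1|by left; exact: bend_incr].
  rewrite le_eqVlt; apply/orP; left; apply/eqP; apply: eq_integral => u _.
  by rewrite derive1_bend// ger0_norm ?expR_ge0// ltr_pwDl ?expR_gt0// mul1e muleC.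
have k0' : 0 <= - k by rewrite oppr_ge0 ltW.
pose G u := (((0 < expR (- u) + k)%R)%:R%:E * (expR (bend k u - u))%:E * g (bend k u))%E.
have mbk := measurable_bend k.
have mG : measurable_fun setT G.
  apply: emeasurable_funM; last exact: measurableT_comp.
  apply: emeasurable_funM; apply/measurable_EFinP.
    rewrite (_ : (fun _ => _) = \1_[set u : R | 0 < expR (- u) + k]); last first.
      by apply/funext => u; rewrite indicE mem_setE.
    apply: measurable_indic.
    rewrite -[X in measurable X]setTI.
    apply: (measurable_fun_ltr _ _ measurableT (Y := [set true])) => //.
    by apply: measurable_funD => //; apply: measurableT_comp.
  by apply: measurableT_comp => //; exact: measurable_funB.
have G0 x : (0 <= G x)%E by rewrite /G !mule_ge0 ?lee_fin ?expR_ge0.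
have := substitution (bend_C1 k0') (or_introl (bend_incr k0')) mG G0.
have kh v : 0 < expR (- v) + - k by rewrite ltr_pwDl// expR_gt0.
have bk v : bend k (bend (- k) v) = v by rewrite -{1}[k]opprK bendK.
have -> : (\int[mu]_x (G (bend (- k) x) * `|derive1 (bend (- k)) x|%:E) =
   \int[mu]_v g v)%E.
  apply: eq_integral => v _; rewrite /G bk derive1_bend// ger0_norm ?expR_ge0//.
  rewrite expR_bend// subrK expR_gt0 mul1e muleAC -EFinM -expRD.
  by rewrite addrA subrK subrr expR0 mul1e.
move=> ->; rewrite [leRHS]integral_mkcond.
rewrite le_eqVlt; apply/orP; left; apply/eqP; apply: eq_integral => u _.
rewrite patchE; case: ifPn => //; rewrite notin_setE => nr; rewrite -/(G u) /G.
case: ltP => h; last by rewrite !mul0e.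
by exfalso; apply: nr; exists (bend k u) => //; rewrite bendK.
Qed.

(** The Jacobian e^(v - u) of v = bend k u, times the ratio at [v] and [u] of the
    centred Gaussian densities of variance [delta]. *)
Definition bend_weight delta k u :=
  expR (bend k u - u - ((bend k u) ^+ 2 - u ^+ 2) / (2 * delta)).

Lemma normal_pdf_sqrt delta x : 0 < delta ->
  normal_pdf 0 (Num.sqrt delta) x =
  normal_peak (Num.sqrt delta) * expR (- (x ^+ 2 / (2 * delta))).
Proof.
move=> d0; rewrite normal_pdfE ?gt_eqF ?sqrtr_gt0//; congr (_ * expR _).
by rewrite subr0 sqr_sqrtr ?ltW// mulNr mulr_natl.
Qed.

Lemma measurable_pos_indic d (T : measurableType d) (f : T -> R) :
  measurable_fun setT f -> measurable_fun setT (fun w => ((0 < f w)%R)%:R : R).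
Proof.
move=> mf; rewrite (_ : (fun _ => _) = \1_[set w | 0 < f w]); last first.
  by apply/funext => w; rewrite indicE mem_setE.
apply: measurable_indic; rewrite -[X in measurable X]setTI.
by apply: (measurable_fun_ltr _ _ measurableT (Y := [set true])).
Qed.

Lemma measurable_invr d (T : measurableType d) (f : T -> R) :
  measurable_fun setT f -> measurable_fun setT (fun w => (f w)^-1).
Proof.
move=> mf; have mN : measurable_fun setT (fun w => - f w) by exact: measurable_funN.
have me (g : T -> R) : measurable_fun setT g ->
    measurable_fun setT (fun w => ((0 < g w)%R)%:R * expR (- ln (g w))).
  move=> mg; apply: measurable_funM; first exact: measurable_pos_indic.
  apply: measurableT_comp => //; apply: measurable_funN.
  by apply: measurableT_comp => //; exact: measurable_ln.
rewrite (_ : (fun _ => _) = fun w => ((0 < f w)%R)%:R * expR (- ln (f w)) -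
    ((0 < - f w)%R)%:R * expR (- ln (- f w))).
  by apply: measurable_funB; exact: me.
apply/funext => w; rewrite oppr_gt0; case: (ltgtP (f w) 0) => h.
- by rewrite mul0r sub0r mul1r expRN lnK ?posrE ?oppr_gt0// invrN opprK.
- by rewrite mul0r subr0 mul1r expRN lnK// posrE.
- by rewrite h invr0 !mul0r subr0.
Qed.

Lemma measurable_bend_weight delta k : measurable_fun setT (bend_weight delta k).
Proof.
have mb := measurable_bend k; apply: measurableT_comp => //.
apply: measurable_funB; first exact: measurable_funB.
by apply: measurable_funM => //; apply: measurable_funB; exact: measurable_funX.
Qed.

Lemma le_integral_gauss_bend delta k f : 0 < delta -> measurable_fun setT f ->
  (forall x, 0 <= f x)%E ->
  (\int[gauss delta]_u
     ((((0 < expR (- u) + k)%R)%:R * bend_weight delta k u)%:E * f (bend k u))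
   <= \int[gauss delta]_v f v)%E.
Proof.
move=> d0 mf f0; have mbk := measurable_bend k.
rewrite !integral_gauss//; last 2 first.
- apply: emeasurable_funM; last exact: measurableT_comp.
  apply/measurable_EFinP; apply: measurable_funM; last exact: measurable_bend_weight.
  by apply: measurable_pos_indic; apply: measurable_funD => //; exact: measurableT_comp.
- by move=> x; rewrite mule_ge0// lee_fin mulr_ge0// expR_ge0.
pose g x := (f x * (normal_pdf 0 (Num.sqrt delta) x)%:E)%E.
have mg : measurable_fun setT g.
  by apply: emeasurable_funM => //; apply/measurable_EFinP; exact: measurable_normal_pdf.
have g0 x : (0 <= g x)%E by rewrite mule_ge0// lee_fin normal_pdf_ge0.
apply: le_trans (le_integral_bend k mg g0); rewrite le_eqVlt; apply/orP; left.
apply/eqP; apply: eq_integral => u _; rewrite /g !normal_pdf_sqrt//.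
case: ltP => h; last by rewrite !mul0r !mul0e.
rewrite mul1r mul1e muleAC -!EFinM [RHS]muleCA muleC; congr (_ * _)%E.
rewrite -EFinM; congr EFin; rewrite mulrCA [RHS]mulrCA; congr (_ * _).
rewrite -!expRD; congr expR; field.
by rewrite gt_eqF.
Qed.

Lemma integral_gauss_expR delta (l : R) : 0 < delta ->
  (\int[gauss delta]_u (expR (l * u))%:E = (expR (l ^+ 2 * delta / 2))%:E)%E.
Proof.
move=> d0; rewrite integral_gauss//; last first.
  by apply/measurable_EFinP; apply: measurableT_comp => //; exact: measurable_funM.
transitivity (\int[mu]_x ((expR (l ^+ 2 * delta / 2))%:E *
    (normal_pdf (l * delta) (Num.sqrt delta) x)%:E))%E; last first.
  rewrite ge0_integralZl//.
  - by rewrite integral_normal_pdf mule1.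
  - by apply/measurable_EFinP; exact: measurable_normal_pdf.
  - by move=> x _; rewrite lee_fin normal_pdf_ge0.
apply: eq_integral => x _; rewrite -!EFinM normal_pdf_sqrt//; congr EFin.
rewrite normal_pdfE ?gt_eqF ?sqrtr_gt0// mulrCA [RHS]mulrCA; congr (_ * _).
rewrite /normal_fun sqr_sqrtr ?ltW// -!expRD; congr expR.
rewrite -[delta *+ 2]mulr_natl; field.
by rewrite gt_eqF.
Qed.

(** From x^3 / 3! <= e^x at x = |u| / sqrt delta, since the exponential moment
    of u / sqrt delta is e^(1/2) on each side: 12 = 3! * 2. *)
Lemma integral_gauss_cube delta : 0 < delta ->
  (\int[gauss delta]_u (`|u| ^+ 3)%:E <=
   (12 * expR 2^-1 * Num.sqrt delta ^+ 3)%:E)%E.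
Proof.
move=> d0; set s := Num.sqrt delta; have s0 : 0 < s by rewrite sqrtr_gt0.
have me (l : R) : measurable_fun setT (fun x : R => (expR (l * x))%:E).
  by apply/measurable_EFinP; apply: measurableT_comp => //; exact: measurable_funM.
apply: (@le_trans _ _ (\int[gauss delta]_u
    ((6 * s ^+ 3)%:E * ((expR (s^-1 * u))%:E + (expR (- s^-1 * u))%:E)))%E).
  apply: ge0_le_integral => //.
  - by apply/measurable_EFinP; apply: measurable_funX; exact: normr_measurable.
  - by apply: emeasurable_funM => //; apply: emeasurable_funD; exact: me.
  - move=> x _; rewrite -EFinD -EFinM lee_fin.
    have := @expR_ge1Dxn R (`|x| / s) 2 (divr_ge0 (normr_ge0 _) (ltW s0)).
    have h : expR (`|x| / s) <= expR (s^-1 * x) + expR (- s^-1 * x).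
      have [x0|x0] := leP 0 x.
        by rewrite ger0_norm// [x / s]mulrC lerDl expR_ge0.
      by rewrite ltr0_norm// mulNr [x / s]mulrC -mulNr lerDr expR_ge0.
    move=> /le_trans/(_ h) {}h.
    have e : `|x| ^+ 3 = (`|x| / s) ^+ 3 * s ^+ 3 by rewrite -exprMn divfK ?gt_eqF.
    rewrite e [leRHS]mulrAC ler_pM2r ?exprn_gt0//.
    move: h; rewrite (_ : 3`!%:R = 6 :> R)//; lra.
rewrite ge0_integralZl; [|by []|by apply: emeasurable_funD; exact: me|by move=> x _; rewrite -EFinD lee_fin addr_ge0 ?expR_ge0|by rewrite lee_fin mulr_ge0 ?exprn_ge0 ?ltW].
rewrite ge0_integralD//; [|exact: me|exact: me].
rewrite !integral_gauss_expR// -EFinD -EFinM lee_fin sqrrN exprVn sqr_sqrtr ?(ltW d0)//.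
rewrite mulVf ?gt_eqF// mul1r le_eqVlt; apply/orP; left; apply/eqP; ring.
Qed.

End gaussian_step.

(** * Chains driven by independent Gaussian increments *)

Lemma finite_measure_unique_prod d1 d2 (T1 : measurableType d1)
    (T2 : measurableType d2) (R : realType)
    (m1 m2 : {measure set (T1 * T2) -> \bar R}) : (m1 setT < +oo)%E ->
  (forall A B, measurable A -> measurable B -> m1 (A `*` B) = m2 (A `*` B)) ->
  forall C, measurable C -> m1 C = m2 C.
Proof.
move=> m1oo m12 C mC.
apply: (measure_unique [set A `*` B | A in measurable & B in measurable]
  (fun=> setT)) => //.
- by rewrite measurable_prod_measurableType.
- move=> _ _ [A1 mA1 [B1 mB1 <-]] [A2 mA2 [B2 mB2 <-]].
  by rewrite -setXI; exists (A1 `&` A2); [exact: measurableI|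
    exists (B1 `&` B2) => //; exact: measurableI].
- by move=> _; exists setT => //; exists setT => //; rewrite setXTT.
- by rewrite -subTset => x _; exists 0%N.
- by move=> _ [A mA [B mB <-]]; exact: m12.
Qed.

Section chain.
Context d (Omega : measurableType d) (R : realType) (P : probability Omega R).
Variables (U : nat -> Omega -> R) (n : nat) (delta : R).
Hypothesis mU : forall i, measurable_fun setT (U i).
Hypothesis lawU : forall i, (i < n)%N -> forall E, measurable E ->
  P (U i @^-1` E) = gauss delta E.
Hypothesis indU : forall E : nat -> set R, (forall i, measurable (E i)) ->
  P (\bigcap_(i in `I_n) (U i @^-1` E i)) = (\prod_(i < n) P (U i @^-1` E i))%E.

Let tail i (E : nat -> set R) :=
  \bigcap_(j in [set j | (i <= j < n)%N]) (U j @^-1` E j).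

Let mUE i E : measurable E -> measurable (U i @^-1` E).
Proof. by move=> mE; rewrite -[X in measurable X]setTI; exact: mU. Qed.

Let mtail i E : (forall i, measurable (E i)) -> measurable (tail i E).
Proof.
move=> mE; rewrite /tail bigcap_mkcond; apply: bigcap_measurable => // j _.
by case: ifP => // _; exact: mUE.
Qed.

Let P_tail i E : (i <= n)%N -> (forall i, measurable (E i)) ->
  P (tail i E) = (\prod_(i <= j < n) P (U j @^-1` E j))%E.
Proof.
move=> i_n mE.
pose E' j := if (j < i)%N then setT else E j.
have -> : tail i E = \bigcap_(j in `I_n) (U j @^-1` E' j).
  rewrite /tail /E'; apply/seteqP; split=> w /= h j /= jn.
    by case: ifPn => //; rewrite -leqNgt => ij; apply: h; rewrite /= ij.
  by move: jn => /andP[ij jn]; move: (h j jn); rewrite /= ltnNge ij.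
rewrite indU; last by move=> j; rewrite /E'; case: ifP.
rewrite -(big_mkord xpredT (fun j => P (U j @^-1` E' j))) (big_cat_nat _ i_n)//=.
rewrite big_nat big1 ?mul1e; last first.
  by move=> j /andP[_ ji]; rewrite /E' ji preimage_setT probability_setT.
by rewrite big_nat [RHS]big_nat; apply: eq_bigr => j /andP[ij _];
  rewrite /E' ltnNge ij.
Qed.

Let P_tailS i E : (i < n)%N -> (forall i, measurable (E i)) ->
  P (tail i E) = (P (U i @^-1` E i) * P (tail i.+1 E))%E.
Proof. by move=> i_n mE; rewrite (P_tail (ltnW i_n) mE) (P_tail i_n mE) big_ltn. Qed.

Let tailS i E : (i < n)%N -> tail i E = U i @^-1` E i `&` tail i.+1 E.
Proof.
move=> i_n; apply/seteqP; split=> [w h|w [h1 h2] j /= /andP[]].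
  split; first by apply: h; rewrite /= leqnn.
  by move=> j /= /andP[ij jn]; apply: h; rewrite /= (ltnW ij).
by rewrite leq_eqVlt => /predU1P[<-//|ij jn]; apply: h2; rewrite /= ij.
Qed.

Variables (dS : measure_display) (S : measurableType dS).
Variables (Y : nat -> Omega -> S) (F : nat -> S * R -> S) (y0 : S).
Hypothesis mF : forall i, measurable_fun setT (F i).
Hypothesis Y0 : forall w, Y 0%N w = y0.
Hypothesis YS : forall i w, Y i.+1 w = F i (Y i w, U i w).

Lemma chain_measurable i : measurable_fun setT (Y i).
Proof.
elim: i => [|i IH].
  by rewrite (_ : Y 0%N = cst y0)//; exact/funext.
rewrite (_ : Y i.+1 = F i \o (fun w => (Y i w, U i w))); last exact/funext.
by apply: measurableT_comp => //; exact: measurable_fun_pair.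
Qed.

Let mYA i A : measurable A -> measurable (Y i @^-1` A).
Proof. by move=> mA; rewrite -[X in measurable X]setTI; exact: chain_measurable. Qed.

(** By induction: the claim for [Y i] and product sets of values of [U i]
    identifies the law of (Y i, U i) restricted to a tail event, and [Y i.+1] is
    a function of this pair. *)
Let chain_indep i : (i <= n)%N -> forall A E, measurable A ->
  (forall i, measurable (E i)) ->
  P (Y i @^-1` A `&` tail i E) = (P (Y i @^-1` A) * P (tail i E))%E.
Proof.
elim: i => [_ A E mA mE|i IH i_n A E mA mE].
  have [Ay|nAy] := pselect (A y0).
    rewrite (_ : Y 0%N @^-1` A = setT) ?setTI ?probability_setT ?mul1e//.
    by rewrite -subTset => w _ /=; rewrite Y0.
  rewrite (_ : Y 0%N @^-1` A = set0) ?set0I ?measure0 ?mul0e//.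
  by rewrite -subset0 => w /=; rewrite Y0.
have {}IH := IH (ltnW i_n).
set T := tail i.+1 E; have mT : measurable T by exact: mtail.
have mYU : measurable_fun setT (fun w => (Y i w, U i w)).
  by apply: measurable_fun_pair => //; exact: chain_measurable.
pose q : {nonneg R} := NngNum (fine_ge0 (measure_ge0 P T)).
have qE : q%:num%:E = P T by rewrite /= fineK// fin_num_measure.
have [nu1 [nu1E _]] := pushforward_measure (mrestr P mT) mYU.
have [nu2 [nu2E _]] := pushforward_measure P mYU.
have key : forall C, measurable C -> nu1 C = (q%:num%:E * nu2 C)%E.
  pose nu3 : {measure set _ -> \bar R} := mscale q nu2.
  apply: (@finite_measure_unique_prod _ _ _ _ _ nu1 nu3).
    rewrite nu1E /mrestr preimage_setT.
    by rewrite -[ltLHS]/(P (setT `&` T)) setTI -ge0_fin_numE ?fin_num_measure.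
  move=> A' C mA' mC; rewrite /nu3 /= /mscale qE nu2E nu1E /mrestr.
  rewrite (_ : (fun _ => _) @^-1` _ = Y i @^-1` A' `&` U i @^-1` C)//.
  rewrite -[LHS]/(P (Y i @^-1` A' `&` U i @^-1` C `&` T)).
  (* [E1] inserts the constraint on [U i] in front of the tail event; [E2] keeps
     this constraint alone. *)
  pose E1 j := if j == i then C else E j.
  pose E2 j := if j == i then C else setT.
  have mE1 j : measurable (E1 j) by rewrite /E1; case: ifP.
  have mE2 j : measurable (E2 j) by rewrite /E2; case: ifP.
  have T1 : tail i.+1 E1 = T.
    by apply: eq_bigcapr => j /= /andP[ij _]; rewrite /E1 gtn_eqF.
  have T2 : tail i.+1 E2 = setT.
    rewrite -subTset => w _ j /= /andP[ij _]; by rewrite /E2 gtn_eqF.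
  have := IH _ _ mA' mE1; rewrite (P_tailS i_n mE1) (tailS _ i_n) T1 /E1 eqxx setIA => ->.
  have := IH _ _ mA' mE2; rewrite (P_tailS i_n mE2) (tailS _ i_n) T2 /E2 eqxx setIT => h.
  transitivity (P T * P (Y i @^-1` A' `&` U i @^-1` C))%E => //.
  by rewrite h probability_setT mule1 [RHS]muleC muleA.
have mFA : measurable (F i @^-1` A).
  by rewrite -[X in measurable X]setTI; exact: mF.
have e : (fun w => (Y i w, U i w)) @^-1` (F i @^-1` A) = Y i.+1 @^-1` A.
  by apply/seteqP; split=> w /=; rewrite YS.
by have := key _ mFA; rewrite nu1E nu2E qE muleC e.
Qed.

(** [Y i] is a function of the increments before [i], hence independent of [U i]. *)
Lemma integral_chain i (f : S * R -> \bar R) : (i < n)%N ->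
  measurable_fun setT f -> (forall x, 0 <= f x)%E ->
  (\int[P]_w f (Y i w, U i w) = \int[P]_w \int[gauss delta]_u f (Y i w, u))%E.
Proof.
move=> i_n mf f0.
have mYU : measurable_fun setT (fun w => (Y i w, U i w)).
  by apply: measurable_fun_pair => //; exact: chain_measurable.
have mYu : measurable_fun setT (fun w : Omega * R => (Y i w.1, w.2)).
  apply: measurable_fun_pair; last exact: measurable_snd.
  by apply: measurableT_comp; [exact: chain_measurable|exact: measurable_fst].
have [nu1 [nu1E nu1I]] := pushforward_measure P mYU.
have [nu2 [nu2E nu2I]] := pushforward_measure (P \x gauss delta)%E mYu.
rewrite -(nu1I f)// (eq_measure_integral nu2).
  rewrite nu2I// fubini_tonelli1//.
    exact: (measurableT_comp mf mYu).
move=> C mC _; apply: finite_measure_unique_prod mC.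
  rewrite nu1E preimage_setT; apply: (le_lt_trans (probability_le1 P measurableT)).
    exact: ltry.
move=> A B mA mB; rewrite nu1E nu2E.
rewrite (_ : _ @^-1` _ = Y i @^-1` A `&` U i @^-1` B)//.
transitivity ((P \x gauss delta) ((Y i @^-1` A) `*` B))%E => //.
rewrite product_measure1E//; last exact: mYA.
pose E j := if j == i then B else setT.
have mE j : measurable (E j) by rewrite /E; case: ifP.
have T2 : tail i.+1 E = setT.
  rewrite -subTset => w _ j /= /andP[ij _]; by rewrite /E gtn_eqF.
have := chain_indep (ltnW i_n) mA mE.
rewrite (P_tailS i_n mE) (tailS _ i_n) T2 /E eqxx setIT => h.
transitivity (P (Y i @^-1` A `&` U i @^-1` B)) => //.
by rewrite h probability_setT mule1 lawU.
Qed.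

End chain.

(** * The discretised pair of a path and its area, and the exact discrete transformation *)

(** Measurability of algebraic expressions in measurable functions. *)
Ltac meas := repeat first
  [ assumption | exact: measurable_cst | exact: measurable_id
  | exact: measurable_fst | exact: measurable_snd
  | apply: measurable_funD | apply: measurable_funB | apply: measurable_funN
  | apply: measurable_funM | apply: measurable_funX | apply: measurable_invr
  | apply: measurable_pos_indic
  | apply: measurable_fun_pair
  | apply: (measurableT_comp (@measurable_expR _))
  | apply: (measurableT_comp (@measurable_ln _))
  | apply: (measurableT_comp measurable_fst)
  | apply: (measurableT_comp measurable_snd) ].

Section recursion.
Context {R : realType} (delta : R).
Implicit Types (z : R * R) (u : R).

(** One step of the pair (path, area).  Since 2 x + u is the sum of the values of
    the path at both ends of the step, the area grows by the geometric mean of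
    the two end values of e^(2 x), times [delta]. *)
Definition advance z u : R * R := (z.1 + u, z.2 + delta * expR (2 * z.1 + u)).

Section value.
Variable q : nat -> (R * R) * R -> R.
Hypothesis mq : forall k, measurable_fun setT (q k).
Hypothesis q0 : forall k zu, 0 <= q k zu.

(** Backward recursion for the expected product of the weights [q k], ..., from
    step [k] on, over [m] steps started at [z]. *)
Fixpoint value m k z : \bar R :=
  if m is m'.+1 then
    (\int[gauss delta]_u ((q k (z, u))%:E * value m' k.+1 (advance z u)))%E
  else 1%E.

Lemma value_ge0 m k z : (0 <= value m k z)%E.
Proof.
elim: m k z => [|m IH] k z; first exact: lee01.
by apply: integral_ge0 => u _; rewrite mule_ge0// lee_fin.
Qed.

Lemma measurable_advance :
  measurable_fun setT (fun zu : (R * R) * R => advance zu.1 zu.2).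
Proof. by rewrite /advance; meas. Qed.

Lemma measurable_value m k : measurable_fun setT (value m k).
Proof.
elim: m k => [|m IH] k /=; first exact: measurable_cst.
apply: (measurable_fun_fubini_tonelli_F (m2 := gauss delta)
  (fun zu : (R * R) * R => ((q k zu)%:E * value m k.+1 (advance zu.1 zu.2))%E)).
  apply: emeasurable_funM; first by apply/measurable_EFinP; exact: mq.
  exact: (measurableT_comp (IH _) measurable_advance).
by move=> zu; rewrite mule_ge0 ?lee_fin ?value_ge0.
Qed.

End value.

Section markov.
Context d (Omega : measurableType d) (P : probability Omega R).
Variables (U : nat -> Omega -> R) (n : nat).
Hypothesis mU : forall i, measurable_fun setT (U i).
Hypothesis lawU : forall i, (i < n)%N -> forall E, measurable E ->
  P (U i @^-1` E) = gauss delta E.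
Hypothesis indU : forall E : nat -> set R, (forall i, measurable (E i)) ->
  P (\bigcap_(i in `I_n) (U i @^-1` E i)) = (\prod_(i < n) P (U i @^-1` E i))%E.
Variable Z : nat -> Omega -> R * R.
Hypothesis Z0 : forall w, Z 0%N w = (0, 0).
Hypothesis ZS : forall i w, Z i.+1 w = advance (Z i w) (U i w).

(** The running product [p i] is carried along with the state: then the pair is a
    chain, and one increment can be integrated out at a time, from the last one
    backwards. *)
Lemma expectation_value (q : nat -> (R * R) * R -> R) :
  (forall k, measurable_fun setT (q k)) -> (forall k zu, 0 <= q k zu) ->
  (\int[P]_w (\prod_(k < n) q k (Z k w, U k w))%:E = value q n 0 (0%R, 0%R))%E.
Proof.
move=> mq q0.
pose p i w := \prod_(k < i) q k (Z k w, U k w).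
have p0 i w : 0 <= p i w by apply: prodr_ge0.
pose Y i w : R * (R * R) := (p i w, Z i w).
pose F i (su : (R * (R * R)) * R) : R * (R * R) :=
  (su.1.1 * q i (su.1.2, su.2), advance su.1.2 su.2).
have mF i : measurable_fun setT (F i).
  apply: measurable_fun_pair.
    apply: measurable_funM; first by meas.
    by apply: (measurableT_comp (mq i)); meas.
  by rewrite /advance; meas.
have Y0 w : Y 0%N w = (1, (0, 0)) by rewrite /Y /p big_ord0 Z0.
have YS i w : Y i.+1 w = F i (Y i w, U i w).
  by rewrite /Y /F /p big_ord_recr /= ZS.
have mY := chain_measurable mU mF Y0 YS.
have mp i : measurable_fun setT (p i).
  exact: (measurableT_comp measurable_fst (mY i)).
have mZ i : measurable_fun setT (Z i).
  exact: (measurableT_comp measurable_snd (mY i)).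
suff key m i : (i + m = n)%N ->
    (\int[P]_w (p n w)%:E = \int[P]_w ((p i w)%:E * value q m i (Z i w)))%E.
  rewrite -/(p n _) (key n 0%N)//.
  under eq_integral do rewrite /p big_ord0 mul1e Z0.
  by rewrite -[RHS]mule1 -(probability_setT P); exact: (integral_cst P measurableT).
elim: m i => [|m IH] i.
  by rewrite addn0 => ->; apply: eq_integral => w _; rewrite mule1.
move=> imn; rewrite (IH i.+1); last by rewrite addSnnS.
(* The absolute value makes [f] nonnegative at every argument; the running
   products themselves are nonnegative. *)
pose f (su : (R * (R * R)) * R) : \bar R :=
  ((`|su.1.1| * q i (su.1.2, su.2))%:E *
    value q m i.+1 (advance su.1.2 su.2))%E.
have mf : measurable_fun setT f.
  apply: emeasurable_funM.
    apply/measurable_EFinP; apply: measurable_funM.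
      by apply: (measurableT_comp (@normr_measurable R setT)); meas.
    by apply: (measurableT_comp (mq i)); meas.
  apply: (measurableT_comp (measurable_value mq q0 m i.+1)).
  by rewrite /advance; meas.
have f0 su : (0 <= f su)%E by rewrite mule_ge0 ?lee_fin ?mulr_ge0 ?value_ge0.
transitivity (\int[P]_w f (Y i w, U i w))%E.
  apply: eq_integral => w _; rewrite /f /= ger0_norm// ZS.
  by rewrite /p big_ord_recr.
rewrite (integral_chain mU lawU indU mF Y0 YS)//; last by rewrite -imn addnS ltnS leq_addr.
apply: eq_integral => w _; rewrite /f /= ger0_norm//.
rewrite -ge0_integralZl//.
- by apply: eq_integral => u _; rewrite EFinM muleA.
- apply: emeasurable_funM.
    apply/measurable_EFinP; apply: (measurableT_comp (mq i)); meas.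
  apply: (measurableT_comp (measurable_value mq q0 m i.+1)).
  by rewrite /advance; meas.
- by move=> u _; rewrite mule_ge0 ?lee_fin ?value_ge0.
- by rewrite lee_fin.
Qed.

End markov.

Section twist.
Variable c : R.
Hypothesis delta_gt0 : 0 < delta.

(** [twist] is the map S_c of the introduction on the level of pairs (path, area),
    and [slope] the factor 1 + c A.  One step from [z] transforms the increment
    by [bend (curvature z)]. *)
Definition slope z := 1 + c * z.2.
Definition twist z : R * R := (z.1 - ln (slope z), z.2 / slope z).
Definition curvature z := c * delta * expR (2 * z.1) / slope z.

Lemma slope_advance z u : 0 < slope z ->
  slope (advance z u) = slope z * expR u * (expR (- u) + curvature z).
Proof.
move=> s0.
have -> : slope (advance z u) = slope z + c * delta * (expR (2 * z.1) * expR u).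
  by rewrite /slope /advance /= expRD; ring.
by rewrite expRN /curvature; field; rewrite !gt_eqF ?expR_gt0.
Qed.

(** The commutation is exact because the area increment is computed with the
    geometric mean: the endpoint values x and x + u become x - ln D and
    x + u - ln D', and e^(2 x + u) / (D D') is the increment of A / (1 + c A). *)
Lemma twist_advance z u : 0 < slope z -> 0 < expR (- u) + curvature z ->
  twist (advance z u) = advance (twist z) (bend (curvature z) u).
Proof.
move=> s0 h0; have sa := slope_advance u s0.
have su : 0 < slope (advance z u) by rewrite sa !mulr_gt0// expR_gt0.
have l : ln (slope (advance z u)) = ln (slope z) + u - bend (curvature z) u.
  by rewrite sa !lnM ?posrE ?mulr_gt0 ?expR_gt0// expRK /bend opprK.
have eb : expR (bend (curvature z) u) = slope z * expR u / slope (advance z u).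
  rewrite -[bend _ _]opprK expRN expR_bend// sa.
  by field; rewrite !gt_eqF ?expR_gt0.
rewrite /twist l /advance /=; congr (_, _); first by ring.
have el : expR (2 * (z.1 - ln (slope z))) = expR (2 * z.1) / slope z ^+ 2.
  by rewrite mulrBr expRB -[2]/(2%:R) [2%:R * ln _]mulrC expRM_natr lnK ?posrE.
rewrite [expR (2 * (_ - _) + _)]expRD el eb expRD.
have sz : slope (advance z u) = 1 + c * (z.2 + delta * (expR (2 * z.1) * expR u)).
  by rewrite /slope /advance /= expRD.
move: su s0; rewrite sz /slope /= => su s0.
by field; rewrite !gt_eqF.
Qed.

Variable g : nat -> R * R -> R.
Hypothesis mg : forall k, measurable_fun setT (g k).
Hypothesis g0 : forall k z, 0 <= g k z.

(** The weights whose recursions compute the two sides of the comparison: [g]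
    along the walk itself, and [g] along the twisted walk with its change of
    measure. *)
Definition plain_weight k (zu : (R * R) * R) := g k.+1 (advance zu.1 zu.2).
Definition twisted_weight k (zu : (R * R) * R) :=
  ((0 < slope (advance zu.1 zu.2))%R)%:R * bend_weight delta (curvature zu.1) zu.2 *
  g k.+1 (twist (advance zu.1 zu.2)).

Lemma measurable_plain_weight k : measurable_fun setT (plain_weight k).
Proof. exact: (measurableT_comp (mg k.+1) measurable_advance). Qed.

Lemma measurable_twisted_weight k : measurable_fun setT (twisted_weight k).
Proof.
apply: measurable_funM.
  rewrite /bend_weight /bend /curvature /slope /advance /=; meas.
apply: (measurableT_comp (mg k.+1)).
by rewrite /twist /slope /advance /=; meas.
Qed.

Lemma plain_weight_ge0 k zu : 0 <= plain_weight k zu. Proof. exact: g0. Qed.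

Lemma twisted_weight_ge0 k zu : 0 <= twisted_weight k zu.
Proof. by rewrite !mulr_ge0// expR_ge0. Qed.

(** At each step [le_integral_gauss_bend] is applied conditionally on the past,
    which is what [curvature] depends on. *)
Lemma value_twist_le m k z : 0 < slope z ->
  (value twisted_weight m k z <= value plain_weight m k (twist z))%E.
Proof.
elim: m k z => [//|m IH] k z s0 /=.
pose f v : \bar R := ((plain_weight k (twist z, v))%:E *
  value plain_weight m k.+1 (advance (twist z) v))%E.
have mf : measurable_fun setT f.
  apply: emeasurable_funM.
    apply/measurable_EFinP; apply: (measurableT_comp (measurable_plain_weight k)); meas.
  apply: (measurableT_comp (measurable_value measurable_plain_weight plain_weight_ge0 m k.+1)).
  by rewrite /advance; meas.
have f0 v : (0 <= f v)%E by rewrite mule_ge0 ?lee_fin ?g0// value_ge0//; exact: plain_weight_ge0.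
apply: le_trans (le_integral_gauss_bend (curvature z) delta_gt0 mf f0).
have mbw := measurable_bend_weight delta (curvature z).
apply: ge0_le_integral => //.
- by move=> u _; rewrite mule_ge0 ?lee_fin ?twisted_weight_ge0// value_ge0//; exact: twisted_weight_ge0.
- apply: emeasurable_funM.
    apply/measurable_EFinP; apply: (measurableT_comp (measurable_twisted_weight k)); meas.
  apply: (measurableT_comp (measurable_value measurable_twisted_weight twisted_weight_ge0 m k.+1)).
  by rewrite /advance; meas.
- apply: emeasurable_funM; last exact: (measurableT_comp mf (measurable_bend _)).
  by apply/measurable_EFinP; meas.
move=> u _; rewrite /f /twisted_weight /= slope_advance//.
rewrite pmulr_rgt0 ?mulr_gt0 ?expR_gt0//.
case: ltP => h; last by rewrite !mul0r !mul0e.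
have sa : 0 < slope (advance z u) by rewrite slope_advance ?mulr_gt0 ?expR_gt0.
rewrite !mul1r EFinM -muleA lee_wpmul2l ?lee_fin ?expR_ge0//.
rewrite /plain_weight /= twist_advance// lee_wpmul2l ?lee_fin//.
by rewrite -twist_advance//; exact: IH.
Qed.

End twist.

End recursion.

Section grid.
Context {R : realType} (t : R).
Implicit Types f : R -> R.

Definition mesh (N : nat) : R := t / N%:R.
Definition node N k : R := k%:R * mesh N.
Definition grid_incr f N k : R := f (node N k.+1) - f (node N k).
Definition grid_state f N k : R * R :=
  (f (node N k),
   \sum_(j < k) mesh N * expR (f (node N j) + f (node N j.+1))).

Lemma grid_state0 f N : f 0 = 0 -> grid_state f N 0 = (0, 0).
Proof. by move=> f0; rewrite /grid_state /node mul0r f0 big_ord0. Qed.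

Lemma grid_stateS f N k :
  grid_state f N k.+1 = advance (mesh N) (grid_state f N k) (grid_incr f N k).
Proof.
rewrite /advance /grid_state /grid_incr /=; congr (_, _); first by ring.
by rewrite big_ord_recr /=; congr (_ + _ * expR _); ring.
Qed.

Lemma mesh_gt0 N : 0 < t -> (0 < N)%N -> 0 < mesh N.
Proof. by move=> t0 N0; rewrite divr_gt0// ltr0n. Qed.

Context d (Omega : measurableType d) (P : probability Omega R)
  (B : R -> {RV P >-> R}) (bm : brownian_motion B).
Hypothesis t_gt0 : 0 < t.
Local Notation path w := (fun s => B s w).

Lemma measurable_grid_incr N k : measurable_fun setT (fun w => grid_incr (path w) N k).
Proof. by rewrite /grid_incr; apply: measurable_funB. Qed.

Lemma grid_incr_law N k : (0 < N)%N -> forall E, measurable E ->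
  P ((fun w => grid_incr (path w) N k) @^-1` E) = gauss (mesh N) E.
Proof.
move=> N0 E mE; have m0 := mesh_gt0 t_gt0 N0.
have h0 : 0 <= node N k by rewrite mulr_ge0// ltW.
have h1 : node N k < node N k.+1 by rewrite ltr_pM2r// ltr_nat.
have -> : mesh N = node N k.+1 - node N k.
  by rewrite /node -mulrBl -natrB// subSnn mul1r.
exact: (bm_increment bm h0 h1 mE).
Qed.

Lemma grid_incr_indep N : (0 < N)%N ->
  forall E : nat -> set R, (forall i, measurable (E i)) ->
  P (\bigcap_(i in `I_N) ((fun w => grid_incr (path w) N i) @^-1` E i)) =
  (\prod_(i < N) P ((fun w => grid_incr (path w) N i) @^-1` E i))%E.
Proof.
move=> N0 E mE; have m0 := mesh_gt0 t_gt0 N0.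
have := @bm_independent _ _ _ _ _ bm N (node N).
rewrite {1}/node mul0r => /(_ (lexx _)) h.
have {}h := h _ (fun i : 'I_N => E i) (fun i => mE i).
rewrite -h.
  congr (P _); apply/seteqP; split=> w /=.
    by move=> H i _; apply: H => /=.
  by move=> H i /= iN; exact: (H (Ordinal iN)).
by move=> i j ij; rewrite /node ltr_pM2r// ltr_nat.
Qed.

Lemma discrete_twist_le c N (g : nat -> R * R -> R) : (0 < N)%N ->
  (forall k, measurable_fun setT (g k)) -> (forall k z, 0 <= g k z) ->
  (\int[P]_w (\prod_(k < N) twisted_weight (mesh N) c g k
     (grid_state (path w) N k, grid_incr (path w) N k))%:E <=
   \int[P]_w (\prod_(k < N) g k.+1 (grid_state (path w) N k.+1))%:E)%E.
Proof.
move=> N0 mg g0; have m0 := mesh_gt0 t_gt0 N0.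
have H := expectation_value (@measurable_grid_incr N)
  (fun i (_ : (i < N)%N) => grid_incr_law i N0)
  (grid_incr_indep N0) (Z := fun k w => grid_state (path w) N k)
  (fun w => grid_state0 N (bm_start bm w)) (fun i w => grid_stateS (path w) N i).
rewrite H; [|exact: measurable_twisted_weight|exact: twisted_weight_ge0].
have -> : (\int[P]_w (\prod_(k < N) g k.+1 (grid_state (path w) N k.+1))%:E =
   \int[P]_w (\prod_(k < N) plain_weight (mesh N) g k
     (grid_state (path w) N k, grid_incr (path w) N k))%:E)%E.
  apply: eq_integral => w _; congr EFin; apply: eq_bigr => k _.
  by rewrite /plain_weight /= -grid_stateS.
rewrite H; [|exact: measurable_plain_weight|exact: plain_weight_ge0].
have s0 : slope c (0, 0) = 1 by rewrite /slope mulr0 addr0.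
have t0 : twist c (0, 0) = (0, 0) by rewrite /twist s0 ln1 subr0 mul0r.
by rewrite -[X in (_ <= value _ _ _ _ X)%E]t0 value_twist_le// s0.
Qed.

End grid.

(** * Calculus of the area functional *)

Section path_calculus.
Context {R : realType} (t : R).
Hypothesis t_gt0 : 0 < t.
Implicit Types f F : R -> R.

(** Heine's theorem for a segment. *)
Lemma within_itv_unif (V : normedModType R) (F : R -> V) : {within `[0, t], continuous F} ->
  forall e, 0 < e -> exists2 r, 0 < r &
    forall x y, x \in `[0, t] -> y \in `[0, t] -> `|x - y| < r -> `|F x - F y| < e.
Proof.
move=> cF e e0; have c : compact `[(0 : R), t] by exact: segment_compact.
have := (compact_near_coveringP `[(0 : R), t]).1 c R (0^'+)
  (fun r x => x \in `[0, t] -> forall y, y \in `[0, t] -> `|x - y| < r -> `|F x - F y| < e) _.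
case.
  move=> x x0t; have /subspace_continuousP/(_ x x0t)/cvgrPdist_lt := cF.
  have e2 : 0 < e / 2 by rewrite divr_gt0.
  move=> /(_ _ e2); rewrite /prop_near1 /within/= => /nbhs_ballP[r /= r0 hr].
  exists (ball x (r / 2), [set s : R | s < r / 2]).
    split; first by apply: nbhsx_ballx; rewrite divr_gt0.
    by apply: nbhs_right_lt; rewrite divr_gt0.
  move=> [x' s] [] /= bx' sr x'0t; rewrite /ball/= in bx' sr *.
  move=> y y0t ys.
  have h1 : `|F x - F x'| < e / 2.
    by apply: hr => //=; apply: lt_trans bx' _; rewrite ltr_pdivrMr// ltr_pMr// ltr1n.
  have h2 : `|F x - F y| < e / 2.
    apply: hr => //=; rewrite /ball/= -(subrKA x') (le_lt_trans (ler_normD _ _))//.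
    by rewrite [ltRHS]splitr ltrD// (lt_trans ys).
  rewrite -(subrKA (F x)) (le_lt_trans (ler_normD _ _))//.
  by rewrite [ltRHS]splitr ltrD// distrC.
move=> r /= r0 hr; exists (r / 2); first by rewrite divr_gt0.
move=> x y x0 y0 xy; apply: (hr (r / 2)) => //=.
  by rewrite sub0r normrN gtr0_norm ?divr_gt0// ltr_pdivrMr// ltr_pMr// ltr1n.
by rewrite divr_gt0.
Qed.

Lemma within_itv_bounded F : {within `[0, t], continuous F} ->
  exists2 M, 0 < M & forall x, x \in `[0, t] -> F x <= M.
Proof.
move=> cF; have [c _ hc] := EVT_max (ltW t_gt0) cF.
exists (Num.max 1 (F c)); first by rewrite lt_max ltr01.
by move=> x /hc; rewrite le_max orbC => ->.
Qed.

Lemma within_itv_interior f s : {within `[0, t], continuous f} ->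
  s \in `]0, t[ -> {for s, continuous f}.
Proof. by move=> /(continuous_within_itvP _ t_gt0)[+ _ _] st; apply. Qed.

Lemma is_derive_A f s : {within `[0, t], continuous f} -> s \in `]0, t[ ->
  is_derive s 1 (A_ f) (expR (2 * f s)).
Proof.
move=> cf /[dup] st; rewrite in_itv/= => /andP[s0 slt].
have cs := within_itv_interior cf st.
have [] := @continuous_FTC1_closed R (fun u => expR (2 * f u)) 0 s t slt
  (A_integrable cf) s0.
  apply: (@continuous_comp _ _ _ (fun u => 2 * f u) expR).
    by apply: cvgM; [exact: cvg_cst|exact: cs].
  exact: continuous_expR.
move=> dA; rewrite derive1E => <-; exact: DeriveDef.
Qed.

Lemma A0 f : A_ f 0 = 0.
Proof. by rewrite /A_ set_itv1 Rintegral_set1. Qed.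

Lemma A_MVT f a b : {within `[0, t], continuous f} -> 0 <= a -> a <= b -> b <= t ->
  exists2 r, a <= r <= b & A_ f b - A_ f a = expR (2 * f r) * (b - a).
Proof.
move=> cf a0 ab bt.
have sub : `[a, b] `<=` `[(0 : R), t] by apply: subset_itvScc.
have [|||r rab e] := @MVT_segment R (A_ f) (fun r => expR (2 * f r)) a b.
- exact: ab.
- move=> r; rewrite in_itv/= => /andP[ar rb]; apply: is_derive_A => //.
  by rewrite in_itv/= (le_lt_trans a0 ar) (lt_le_trans rb bt).
- by apply: (continuous_subspaceW sub); exact: (A_continuous (ltW t_gt0) cf).
- by exists r; rewrite // -in_itv/=.
Qed.

Lemma A_gt0 f s : {within `[0, t], continuous f} -> 0 < s -> s <= t -> 0 < A_ f s.
Proof.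
move=> cf s0 st; have [r _ e] := A_MVT cf (lexx 0) (ltW s0) st.
by move: e; rewrite A0 !subr0 => ->; rewrite mulr_gt0 ?expR_gt0.
Qed.

Lemma A_homo f a b : {within `[0, t], continuous f} -> 0 <= a -> a <= b -> b <= t ->
  A_ f a <= A_ f b.
Proof.
move=> cf a0 ab bt; have [r _ e] := A_MVT cf a0 ab bt.
by rewrite -subr_ge0 e mulr_ge0 ?expR_ge0 ?subr_ge0.
Qed.

Lemma node_itv N k : (0 < N)%N -> (k <= N)%N -> node t N k \in `[0, t].
Proof.
move=> N0 kN; have m0 := mesh_gt0 t_gt0 N0.
rewrite in_itv/= /node mulr_ge0 ?(ltW m0)//= /mesh mulrCA ger_pMr//.
by rewrite ler_pdivrMr ?ltr0n// mul1r ler_nat.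
Qed.

Lemma nodeS N k : node t N k.+1 - node t N k = mesh t N.
Proof. by rewrite /node -mulrBl -natrB// subSnn mul1r. Qed.

Lemma node_last N : (0 < N)%N -> node t N N = t.
Proof. by move=> N0; rewrite /node /mesh mulrCA divff ?mulr1// pnatr_eq0 -lt0n. Qed.

(** On a step, both the integral and its approximation are [mesh] times a value
    of the form e^(f r) e^(f s) with [r] and [s] in the step; uniform continuity
    of e^f makes the sum of the errors uniformly small in the number of steps. *)
Lemma riemann_A f : {within `[0, t], continuous f} ->
  forall e, 0 < e -> exists2 r, 0 < r & forall N, (0 < N)%N -> mesh t N < r ->
    forall k, (k <= N)%N ->
      `|(grid_state t f N k).2 - A_ f (node t N k)| <= e.
Proof.
move=> cf e e0; pose E := expR \o f.
have cE : {within `[0, t], continuous E}.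
  by apply: within_continuous_comp => // x _; exact: continuous_expR.
have [M M0 hM] := within_itv_bounded cE.
have e'0 : 0 < e / (t * (2 * M)) by rewrite divr_gt0 ?mulr_gt0.
have [r r0 hr] := within_itv_unif cE e'0.
exists r => // N N0 mr; have m0 := mesh_gt0 t_gt0 N0.
suff key k : (k <= N)%N -> `|(grid_state t f N k).2 - A_ f (node t N k)| <=
    node t N k * (e / t).
  move=> k kN; apply: le_trans (key k kN) _.
  have := node_itv N0 kN; rewrite in_itv/= => /andP[_ kt].
  by rewrite mulrCA ger_pMr// ler_pdivrMr// mul1r.
elim: k => [_|k IH kN].
  by rewrite /grid_state big_ord0 /node mul0r A0 subr0 normr0 mul0r.
have kN' := ltnW kN.
rewrite /grid_state /= big_ord_recr /=.
have nk := node_itv N0 kN'; have nk1 := node_itv N0 kN.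
have le1 : node t N k <= node t N k.+1 by rewrite -subr_ge0 nodeS ltW.
move: (nk) (nk1); rewrite !in_itv/= => /andP[k0 kt] /andP[k10 k1t].
have [s /andP[ks sk] es] := A_MVT cf k0 le1 k1t.
have s0t : s \in `[0, t] by rewrite in_itv/= (le_trans k0 ks) (le_trans sk k1t).
rewrite nodeS in es.
have -> : forall S D : R, S + D - A_ f (node t N k.+1) =
    (S - A_ f (node t N k)) + (D - (A_ f (node t N k.+1) - A_ f (node t N k))).
  by move=> S D; ring.
apply: le_trans (ler_normD _ _) _.
have eqn : node t N k.+1 = node t N k + mesh t N by rewrite -(nodeS N k) addrC subrK.
rewrite es.
apply: (@le_trans _ _ (node t N k * (e / t) + mesh t N * (e / t))); last first.
  by rewrite eqn mulrDl.
rewrite lerD ?(IH kN')// mulrC -mulrBl normrM (gtr0_norm m0) mulrC.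
rewrite ler_pM2l// expRD.
have -> : expR (2 * f s) = expR (f s) * expR (f s) by rewrite -expRD; congr expR; ring.
have -> : forall a b c : R, a * b - c * c = (a - c) * b + c * (b - c).
  by move=> a b c; ring.
apply: le_trans (ler_normD _ _) _.
have d1 : `|node t N k - s| < r.
  by rewrite distrC ger0_norm ?subr_ge0// (le_lt_trans _ mr)// -(nodeS N k) lerD2r.
have d2 : `|node t N k.+1 - s| < r.
  by rewrite ger0_norm ?subr_ge0// (le_lt_trans _ mr)// -(nodeS N k) lerD2l lerN2.
have h1 := ltW (hr _ _ nk s0t d1); have h2 := ltW (hr _ _ nk1 s0t d2).
have hk := hM _ nk1; have hs := hM _ s0t.
have -> : e / t = e / (t * (2 * M)) * M + M * (e / (t * (2 * M))).
  by field; rewrite !gt_eqF.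
rewrite lerD// normrM ler_pM//.
- by rewrite ger0_norm ?expR_ge0.
- by rewrite ger0_norm ?expR_ge0.
Qed.

End path_calculus.

(** * The remainder of the hyperbolic cosine *)

Section cosh_remainder.
Context {R : realType}.
Implicit Types F : R -> R.

Lemma MVT_le F (F' : R -> R) (M K : R) : (forall r : R, is_derive r (1 : R) F (F' r)) ->
  (forall r : R, `|r| <= M -> `|F' r| <= K) ->
  forall u v, `|u| <= M -> `|v| <= M -> `|F v - F u| <= K * `|v - u|.
Proof.
move=> dF hF'.
have key u v : u <= v -> `|u| <= M -> `|v| <= M -> `|F v - F u| <= K * `|v - u|.
  move=> uv uM vM.
  have cF : {within `[u, v], continuous F}.
    apply: continuous_subspaceT => x; apply: differentiable_continuous.
    by apply/derivable1_diffP; exact: (@ex_derive _ _ _ _ _ _ _ (dF x)).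
  have [r] := MVT_segment uv (fun r _ => dF r) cF.
  rewrite in_itv/= => /andP[ur rv] ->.
  rewrite normrM ler_wpM2r// hF'//.
  by move: uM vM; rewrite !ler_norml => /andP[h1 h2] /andP[h3 h4];
    rewrite (le_trans h1 ur) (le_trans rv h4).
move=> u v uM vM; have [uv|/ltW vu] := leP u v; first exact: key.
by rewrite distrC (distrC v); exact: key.
Qed.

Definition sinh (r : R) := (expR r - expR (- r)) / 2.
(** The exponents of the Gaussian densities involve v^2 - u^2, whereas it is
    cosh v - cosh u that telescopes along the walk.  This is the difference. *)
Definition cosh_rem (r : R) := cosh r - 1 - r ^+ 2 / 2.

Let is_derive_expN (r : R) : is_derive r (1 : R) (fun r => expR (- r)) (- expR (- r)).
Proof.
have d := @is_derive1_comp R expR -%R r _ _ (is_derive_expR _) (is_deriveNid r 1).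
by apply: is_derive_eq d _; rewrite mulrN1.
Qed.

Let is_derive_sinh (r : R) : is_derive r (1 : R) sinh (cosh r).
Proof.
have d := is_deriveZ 2^-1 (is_deriveB (is_derive_expR r) (is_derive_expN r)).
have -> : sinh = 2^-1 \*: ((expR : R -> R) - (fun r => expR (- r))).
  by apply/funext => x; rewrite /sinh /= mulrC.
by apply: is_derive_eq d _; rewrite opprK /cosh mulrC.
Qed.

Let is_derive_cosh (r : R) : is_derive r (1 : R) (@cosh R) (sinh r).
Proof.
have d := is_deriveZ 2^-1 (is_deriveD (is_derive_expR r) (is_derive_expN r)).
have -> : @cosh R = 2^-1 \*: ((expR : R -> R) + (fun r => expR (- r))).
  by apply/funext => x; rewrite /cosh /= mulrC.
by apply: is_derive_eq d _; rewrite /sinh mulrC.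
Qed.

Let is_derive_sinh_id (r : R) : is_derive r (1 : R) (sinh - id) (cosh r - 1).
Proof. exact: is_deriveB. Qed.

Let is_derive_rem (r : R) : is_derive r (1 : R) cosh_rem ((sinh - id) r).
Proof.
have dsq : is_derive r (1 : R) (fun x : R => x * x) (r + r).
  have d := @is_deriveM R R id id r 1 _ _ (is_derive_id r (1 : R)) (is_derive_id r (1 : R)).
  by apply: is_derive_eq d _; rewrite -![_ *: _]/(_ * _) mulr1.
have d := is_deriveB (is_deriveB (is_derive_cosh r) (is_derive_cst (1 : R) r (1 : R)))
   (is_deriveZ 2^-1 dsq).
have -> : cosh_rem = (@cosh R - cst 1) - 2^-1 \*: (fun x : R => x * x).
  by apply/funext => x; rewrite /cosh_rem /= expr2 mulrC.
apply: is_derive_eq d _; rewrite subr0; congr (_ - _).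
rewrite -[_ *: _]/(_ * _) /=; lra.
Qed.

Let cosh_le4 (r : R) : `|r| <= 1 -> `|cosh r| <= 4.
Proof.
have e4 : expR 1 <= 4 :> R.
  have h : expR (2^-1) <= 2 :> R.
    rewrite -[expR _]invrK -expRN -[leRHS]invrK lef_pV2 ?posrE ?expR_gt0 ?invr_gt0//.
    by apply: le_trans (expR_ge1Dx _); lra.
  have -> : expR 1 = expR 2^-1 * expR 2^-1 :> R by rewrite -expRD; congr expR; lra.
  have := expR_ge0 (2^-1 : R); nra.
rewrite ler_norml => /andP[r1 r2].
rewrite /cosh ger0_norm ?divr_ge0 ?addr_ge0 ?expR_ge0// ler_pdivrMr//.
have h1 : expR r <= expR 1 by rewrite ler_expR.
have h2 : expR (- r) <= expR 1 by rewrite ler_expR; lra.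
by lra.
Qed.

(** Three integrations of the bound [cosh r <= 4] on [-1, 1]. *)
Lemma cosh_rem_lip (M u v : R) : M <= 1 -> `|u| <= M -> `|v| <= M ->
  `|cosh_rem v - cosh_rem u| <= 4 * M ^+ 3 * `|v - u|.
Proof.
move=> M1 uM vM; have M0 : 0 <= M by apply: le_trans uM.
have n0 (r : R) : `|(0 : R)| <= M by rewrite normr0.
have s0 : sinh 0 = 0 by rewrite /sinh oppr0 subrr mul0r.
have c0 : cosh 0 = 1 :> R by rewrite /cosh oppr0 expR0 -[1 + 1]/(2%:R) divff// pnatr_eq0.
have b1 r : `|r| <= M -> `|sinh r| <= 4 * M.
  move=> rM; have := @MVT_le sinh (@cosh R) M 4 is_derive_sinh
    (fun r rM => cosh_le4 (le_trans rM M1)) 0 r (n0 0) rM.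
  by rewrite s0 !subr0 => /le_trans; apply; rewrite ler_wpM2l.
have b2 r : `|r| <= M -> `|cosh r - 1| <= 4 * M ^+ 2.
  move=> rM; have := @MVT_le (@cosh R) sinh M (4 * M) is_derive_cosh b1 0 r (n0 0) rM.
  by rewrite c0 subr0 => /le_trans; apply; rewrite expr2 mulrA ler_wpM2l// mulr_ge0.
have b3 r : `|r| <= M -> `|(sinh - id) r| <= 4 * M ^+ 3.
  move=> rM; have := @MVT_le (sinh - id) (fun r => cosh r - 1) M (4 * M ^+ 2)
    is_derive_sinh_id b2 0 r (n0 0) rM.
  have -> : (sinh - id) 0 = 0 by rewrite -[LHS]/(sinh 0 - 0) s0 subr0.
  rewrite !subr0 => /le_trans; apply.
  by rewrite (exprSr M 2) mulrA ler_wpM2l// mulr_ge0// exprn_ge0.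
exact: (@MVT_le cosh_rem (sinh - id) M (4 * M ^+ 3) is_derive_rem b3).
Qed.

End cosh_remainder.

(** * The limit of the discrete weights *)

Section grid_weight.
Context {R : realType} (t : R).
Hypothesis t_gt0 : 0 < t.
Implicit Types f : R -> R.

(** With w = exp (cosh B_t / Z_t) / A_t, this is the ratio of the values of [w] at
    the path and at its image under S_c. *)
Definition girsanov (c : R) (z : R * R) : R :=
  expR (c / 2 * (expR (2 * z.1) / slope c z - 1)) / slope c z.

Definition grid_weight f c N : R := \prod_(k < N)
  (((0 < slope c (advance (mesh t N) (grid_state t f N k) (grid_incr t f N k)))%R)%:R *
   bend_weight (mesh t N) (curvature (mesh t N) c (grid_state t f N k)) (grid_incr t f N k)).

Section formula.
Variables (f : R -> R) (c : R) (N : nat).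
Hypotheses (N_gt0 : (0 < N)%N) (f0 : f 0 = 0).
Local Notation z := (grid_state t f N).
Local Notation u := (grid_incr t f N).
Local Notation delta := (mesh t N).
Local Notation v := (fun k => bend (curvature delta c (z k)) (u k)).

Lemma grid_area_homo j k : (j <= k)%N -> (z j).2 <= (z k).2.
Proof.
elim: k => [|k IH]; first by rewrite leqn0 => /eqP ->.
rewrite leq_eqVlt => /predU1P[->//|jk]; apply: le_trans (IH jk) _.
rewrite /= big_ord_recr /= lerDl mulr_ge0 ?expR_ge0//.
by rewrite ltW// mesh_gt0.
Qed.

(** The area increases from 0, so the factor 1 + c A is monotone along the walk,
    started from 1. *)
Lemma slope_grid_ge k : (k <= N)%N ->
  Num.min 1 (slope c (z N)) <= slope c (z k).
Proof.
move=> kN; have ak := grid_area_homo kN; have a0 := grid_area_homo (leq0n k).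
rewrite grid_state0//= in a0; rewrite /slope ge_min.
have [c0|/ltW c0] := leP 0 c; first by rewrite lerDl mulr_ge0.
by rewrite [X in _ || X]lerD2l ler_wnM2l// orbT.
Qed.

Hypothesis slope_gt0 : forall k, (k <= N)%N -> 0 < slope c (z k).

(** Both ln (1 + c A) and e^(2 x) / (1 + c A) telescope along the walk; the
    second one through cosh v - cosh u. *)
Lemma bend_grid k : (k < N)%N ->
  v k - u k = ln (slope c (z k)) - ln (slope c (z k.+1)) /\
  (cosh (v k) - cosh (u k)) / delta =
  c / 2 * (expR (2 * (z k).1) / slope c (z k) - expR (2 * (z k.+1).1) / slope c (z k.+1)).
Proof.
move=> kN; have s0 := slope_gt0 (ltnW kN); have s1 := slope_gt0 kN.
have m0 := mesh_gt0 t_gt0 N_gt0.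
have e1 := slope_advance delta (u k) s0.
rewrite -grid_stateS in e1.
have h : 0 < expR (- u k) + curvature delta c (z k).
  by move: s1; rewrite e1 pmulr_rgt0// mulr_gt0 ?expR_gt0.
have eb : expR (v k) = slope c (z k) * expR (u k) / slope c (z k.+1).
  rewrite -[bend _ _]opprK expRN expR_bend// e1.
  by field; rewrite !gt_eqF ?expR_gt0.
split.
  rewrite e1 !lnM ?posrE ?mulr_gt0 ?expR_gt0// expRK /bend; ring.
have en : expR (- v k) = expR (- u k) + curvature delta c (z k) by exact: expR_bend.
have ex : expR (2 * (z k.+1).1) = expR (2 * (z k).1) * expR (u k) ^+ 2.
  rewrite -expRM_natl -expRD; congr expR; rewrite grid_stateS /=; ring.
rewrite /cosh eb en ex /curvature.
have e2 : slope c (z k.+1) = slope c (z k) + c * delta * expR (2 * (z k).1) * expR (u k).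
  by rewrite e1 expRN /curvature; field; rewrite !gt_eqF ?expR_gt0.
rewrite expRN.
have es : expR (u k) * (c * delta * expR (2 * (z k).1)) = slope c (z k.+1) - slope c (z k).
  by rewrite e2; ring.
move: s1; rewrite e2 => s1.
by field; rewrite !gt_eqF ?expR_gt0.
Qed.

Lemma grid_weight_formula :
  grid_weight f c N = girsanov c (f t, (z N).2) *
    expR (\sum_(k < N) (cosh_rem (v k) - cosh_rem (u k)) / delta).
Proof.
have m0 := mesh_gt0 t_gt0 N_gt0.
pose Phi k := - ln (slope c (z k)) + c / 2 * (expR (2 * (z k).1) / slope c (z k)).
transitivity (\prod_(k < N) expR ((Phi k.+1 - Phi k) +
    (cosh_rem (v k) - cosh_rem (u k)) / delta)).
  apply: eq_bigr => k _; rewrite -grid_stateS slope_gt0// mul1r /bend_weight.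
  congr expR; have [e1 e2] := bend_grid (ltn_ord k).
  rewrite /Phi.
  have -> : (cosh_rem (v k) - cosh_rem (u k)) / delta =
     (cosh (v k) - cosh (u k)) / delta - ((v k) ^+ 2 - (u k) ^+ 2) / (2 * delta).
    by rewrite /cosh_rem; field; rewrite gt_eqF.
  rewrite e2 e1; ring.
rewrite -expR_sum big_split /= expRD; congr (_ * _).
rewrite -(big_mkord xpredT (fun k => Phi k.+1 - Phi k)) telescope_sumr //.
have -> : (f t, (z N).2) = z N by rewrite /grid_state /= (node_last t N_gt0).
have -> : Phi 0%N = c / 2.
  by rewrite /Phi grid_state0//= /slope /= mulr0 addr0 ln1 mulr0 expR0 divr1 oppr0 add0r mulr1.
have -> : Phi N - c / 2 = c / 2 * (expR (2 * (z N).1) / slope c (z N) - 1) - ln (slope c (z N)).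
  by rewrite /Phi; ring.
by rewrite expRB lnK// posrE; exact: slope_gt0.
Qed.

(** [K * delta] bounds [v - u], so each remainder is of the order of
    (|u| + K delta)^3 (K delta) / delta. *)
Lemma grid_rem_le (E d0 : R) : 0 < d0 -> 0 < E ->
  (forall k, (k <= N)%N -> d0 <= slope c (z k)) ->
  (forall k, (k <= N)%N -> expR (f (node t N k)) <= E) ->
  let K := `|c| * E ^+ 2 / d0 in
  K * delta <= 1 / 2 -> (forall k, (k < N)%N -> `|u k| <= 1 / 2) ->
  `|\sum_(k < N) (cosh_rem (v k) - cosh_rem (u k)) / delta| <=
  16 * K * (\sum_(k < N) `|u k| ^+ 3 + K ^+ 3 * delta ^+ 2 * t).
Proof.
move=> d00 E0 hd hE K Kd hu; have m0 := mesh_gt0 t_gt0 N_gt0.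
have K0 : 0 <= K by rewrite /K divr_ge0 ?mulr_ge0 ?exprn_ge0// ltW.
have main k : (k < N)%N -> `|(cosh_rem (v k) - cosh_rem (u k)) / delta| <=
    16 * K * (`|u k| ^+ 3 + (K * delta) ^+ 3).
  move=> kN; have [e1 _] := bend_grid kN.
  have lnle p q : d0 <= p -> d0 <= q -> ln p - ln q <= `|p - q| / d0.
    move=> hp hq; have p0 := lt_le_trans d00 hp; have q0 := lt_le_trans d00 hq.
    have e : p / q = 1 + (p - q) / q by field; rewrite gt_eqF.
    have pq := divr_gt0 p0 q0; rewrite e in pq.
    rewrite -ln_div ?posrE// e; apply: le_trans (le_ln1Dx _) _; first by lra.
    apply: le_trans (ler_norm _) _; rewrite normrM ler_wpM2l// normfV (gtr0_norm q0).
    by rewrite lef_pV2.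
  have ds : `|slope c (z k.+1) - slope c (z k)| <= `|c| * delta * E ^+ 2.
    have -> : slope c (z k.+1) - slope c (z k) =
        c * (delta * expR (f (node t N k) + f (node t N k.+1))).
      by rewrite /slope /= big_ord_recr /=; ring.
    rewrite normrM -mulrA ler_wpM2l// normrM (gtr0_norm m0) ler_pM2l//.
    rewrite ger0_norm ?expR_ge0// expRD expr2 ler_pM ?expR_ge0 ?hE//.
    exact: ltnW.
  have vu : `|v k - u k| <= K * delta.
    rewrite e1 ler_norml; apply/andP; split.
      rewrite lerNl opprB (le_trans (lnle _ _ (hd _ kN) (hd _ (ltnW kN))))//.
      by rewrite /K mulrAC ler_pM2r ?invr_gt0// mulrAC.
    rewrite (le_trans (lnle _ _ (hd _ (ltnW kN)) (hd _ kN)))// distrC.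
    by rewrite /K mulrAC ler_pM2r ?invr_gt0// mulrAC.
  have vM : `|v k| <= `|u k| + K * delta.
    rewrite -(subrK (u k) (v k)) (le_trans (ler_normD _ _))// addrC lerD2l//.
  have uM : `|u k| <= `|u k| + K * delta by rewrite lerDl mulr_ge0// ltW.
  have M1 : `|u k| + K * delta <= 1 by have := hu _ kN; lra.
  have := cosh_rem_lip M1 uM vM.
  rewrite normrM normfV (gtr0_norm m0) ler_pdivrMr// => /le_trans; apply.
  have cube (a b : R) : 0 <= a -> 0 <= b -> (a + b) ^+ 3 <= 4 * (a ^+ 3 + b ^+ 3).
    move=> a0 b0; rewrite -subr_ge0.
    have -> : 4 * (a ^+ 3 + b ^+ 3) - (a + b) ^+ 3 = 3 * ((a + b) * (a - b) ^+ 2).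
      by ring.
    by rewrite mulr_ge0// mulr_ge0 ?addr_ge0// sqr_ge0.
  have Kd0 : 0 <= K * delta by rewrite mulr_ge0// ltW.
  apply: (@le_trans _ _ (4 * (4 * (`|u k| ^+ 3 + (K * delta) ^+ 3)) * (K * delta))).
    by rewrite ler_pM// ?mulr_ge0 ?exprn_ge0 ?addr_ge0// ler_wpM2l// cube.
  by rewrite le_eqVlt; apply/orP; left; apply/eqP; ring.
apply: le_trans (ler_norm_sum _ _ _) _.
apply: (@le_trans _ _ (\sum_(k < N) 16 * K * (`|u k| ^+ 3 + (K * delta) ^+ 3))).
  by apply: ler_sum => k _; exact: main.
have K16 : 0 <= 16 * K by rewrite mulr_ge0.
rewrite -mulr_sumr; apply: (ler_wpM2l K16); rewrite big_split /= lerD2l.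
rewrite sumr_const card_ord -mulr_natr.
rewrite /mesh; rewrite (_ : _ * N%:R = K ^+ 3 * (t / N%:R) ^+ 2 * t)//.
by field; rewrite pnatr_eq0 -lt0n.
Qed.

End formula.

Section limit.
Variables (f : R -> R) (N : nat -> nat).
Hypotheses (cf : {within `[0, t], continuous f}) (f0 : f 0 = 0).
Hypothesis N_gt0 : forall m, (0 < N m)%N.
Hypothesis mesh0 : mesh t (N m) @[m --> \oo] --> 0.

Lemma mesh_near e : 0 < e -> \forall m \near \oo, mesh t (N m) < e.
Proof.
move=> e0; have /cvgrPdist_lt/(_ _ e0) := mesh0.
apply: filterS => m; rewrite sub0r normrN; apply: le_lt_trans; exact: ler_norm.
Qed.

Lemma within_itv_cvg (F : R -> R) (x : nat -> R) s : {within `[0, t], continuous F} ->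
  s \in `[0, t] -> (forall m, x m \in `[0, t]) -> x m @[m --> \oo] --> s ->
  F (x m) @[m --> \oo] --> F s.
Proof.
move=> cF st xt xs; apply/cvgrPdist_lt => e e0.
have [r r0 hr] := within_itv_unif cF e0.
have /cvgrPdist_lt/(_ _ r0) := xs; apply: filterS => m h; exact: hr.
Qed.

Lemma grid_area_cvg (idx : nat -> nat) s : s \in `[0, t] ->
  (forall m, (idx m <= N m)%N) -> node t (N m) (idx m) @[m --> \oo] --> s ->
  (grid_state t f (N m) (idx m)).2 @[m --> \oo] --> A_ f s.
Proof.
move=> st iN ns; apply/cvgrPdist_le => e e0.
have e2 : 0 < e / 2 by rewrite divr_gt0.
have [r r0 hr] := riemann_A t_gt0 cf e2.
have cA := A_continuous (ltW t_gt0) cf.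
have nt m : node t (N m) (idx m) \in `[0, t] by exact: node_itv.
have /cvgrPdist_le/(_ _ e2) := within_itv_cvg cA st nt ns.
have := mesh_near r0; apply: filterS2 => m mr hA.
rewrite -(subrKA (A_ f (node t (N m) (idx m)))) (le_trans (ler_normD _ _))//.
by rewrite [leRHS]splitr lerD// distrC hr.
Qed.

Lemma grid_state_cvg (idx : nat -> nat) s : s \in `[0, t] ->
  (forall m, (idx m <= N m)%N) -> node t (N m) (idx m) @[m --> \oo] --> s ->
  grid_state t f (N m) (idx m) @[m --> \oo] --> (f s, A_ f s).
Proof.
move=> st iN ns; have nt m : node t (N m) (idx m) \in `[0, t] by exact: node_itv.
have h1 := within_itv_cvg cf st nt ns; have h2 := grid_area_cvg st iN ns.
exact: (cvg_pair h1 h2).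
Qed.

Lemma grid_weight_cvg c : 0 < 1 + c * A_ f t ->
  \sum_(k < N m) `|grid_incr t f (N m) k| ^+ 3 @[m --> \oo] --> 0 ->
  grid_weight f c (N m) @[m --> \oo] --> girsanov c (f t, A_ f t).
Proof.
move=> D0 S0; pose z m k := grid_state t f (N m) k.
have tt : t \in `[0, t] by rewrite in_itv/= lexx ltW.
have aN : (z m (N m)).2 @[m --> \oo] --> A_ f t.
  apply: grid_area_cvg => //.
  by under eq_fun do rewrite (node_last t (N_gt0 _)); exact: cvg_cst.
have sN : slope c (z m (N m)) @[m --> \oo] --> 1 + c * A_ f t.
  by apply: cvgD; [exact: cvg_cst|apply: cvgM => //; exact: cvg_cst].
pose d0 := Num.min 1 (1 + c * A_ f t) / 2.
have min0 : 0 < Num.min 1 (1 + c * A_ f t) by rewrite lt_min ltr01 D0.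
have d00 : 0 < d0 by rewrite divr_gt0.
have cE : {within `[0, t], continuous (expR \o f)}.
  by apply: within_continuous_comp => // x _; exact: continuous_expR.
have [E E0 hE] := within_itv_bounded t_gt0 cE.
pose K := `|c| * E ^+ 2 / d0.
pose rem m := \sum_(k < N m) (cosh_rem (bend (curvature (mesh t (N m)) c (z m k))
    (grid_incr t f (N m) k)) - cosh_rem (grid_incr t f (N m) k)) / mesh t (N m).
pose S m := \sum_(k < N m) `|grid_incr t f (N m) k| ^+ 3.
have slope_near : \forall m \near \oo, forall k, (k <= N m)%N -> d0 <= slope c (z m k).
  have d1 : 0 < (1 + c * A_ f t) / 2 by rewrite divr_gt0.
  have /cvgrPdist_lt/(_ _ d1) := sN; apply: filterS => m hm k kN.
  apply: le_trans (slope_grid_ge c (N_gt0 m) f0 kN).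
  rewrite /d0 le_min; apply/andP; split.
    by rewrite ler_pdivrMr// mul1r ge_min; apply/orP; left; lra.
  have h2 : Num.min 1 (1 + c * A_ f t) <= 1 + c * A_ f t by rewrite ge_min lexx orbT.
  by move: hm; rewrite ltr_norml => /andP[_]; rewrite -/(z _ _); lra.
have rem0 : rem m @[m --> \oo] --> 0.
  apply/norm_cvg0P.
  apply: (@squeeze_cvgr _ _ _ _ (fun=> 0) (fun m => 16 * K * (S m + K ^+ 3 * mesh t (N m) ^+ 2 * t))).
  - have K1 : 0 <= K by rewrite /K divr_ge0 ?mulr_ge0 ?exprn_ge0// ltW.
    have h8 : 0 < 1 / 8 :> R by lra.
    have /cvgrPdist_lt/(_ _ h8) := S0.
    have hk : 0 < 1 / (2 * (K + 1)) by rewrite divr_gt0// mulr_gt0// ltr_wpDl.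
    have := mesh_near hk; move: slope_near.
    apply: filterS3 => m hs hm hS; rewrite normr_ge0 /=.
    have m0 := mesh_gt0 t_gt0 (N_gt0 m).
    apply: grid_rem_le => //.
    + by move=> k kN; exact: lt_le_trans (hs k kN).
    + by move=> k kN; apply: hE; exact: node_itv.
    + move: hm; rewrite ltr_pdivlMr ?mulr_gt0 ?ltr_wpDl// -/K => hm.
      by have := mulr_ge0 K1 (ltW m0); nra.
    + move=> k kN; have h3 : `|grid_incr t f (N m) k| ^+ 3 <= (1 / 2) ^+ 3.
        apply: (@le_trans _ _ (S m)).
          rewrite /S (bigD1 (Ordinal kN))//= lerDl.
          by apply: sumr_ge0 => i _; rewrite exprn_ge0.
        by move: hS; rewrite sub0r normrN => /(le_lt_trans (ler_norm _)); rewrite -/(S m); lra.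
      by rewrite -(ler_pXn2r (ltn0Sn 2)) ?nnegrE//; lra.
  - exact: cvg_cst.
  - rewrite -[X in _ --> X](_ : 16 * K * (0 + K ^+ 3 * 0 ^+ 2 * t) = 0); last by ring.
    apply: cvgM; first exact: cvg_cst.
    apply: cvgD; first exact: S0.
    apply: cvgM; last exact: cvg_cst.
    by apply: cvgM; [exact: cvg_cst|apply: cvgM].
have W : (girsanov c (f t, (z m (N m)).2) * expR (rem m)) @[m --> \oo] -->
    girsanov c (f t, A_ f t).
  rewrite -[X in _ --> X]mulr1 -expR0; apply: cvgM; last first.
    exact: (continuous_cvg _ (@continuous_expR R 0) rem0).
  rewrite /girsanov.
  have iv : (slope c (z m (N m)))^-1 @[m --> \oo] --> (slope c (f t, A_ f t))^-1.
    by apply: cvgV => //; rewrite gt_eqF.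
  apply: cvgM => //.
  apply: (continuous_cvg _ (@continuous_expR R _)).
  apply: cvgM; first exact: cvg_cst.
  apply: cvgB; last exact: cvg_cst.
  by apply: cvgM; [exact: (cvg_cst (expR (2 * f t)))|exact: iv].
apply: cvg_trans W; apply: near_eq_cvg.
move: slope_near; apply: filterS => m hs.
rewrite grid_weight_formula// => k kN.
exact: lt_le_trans d00 (hs k kN).
Qed.

End limit.

End grid_weight.

(** * Passage to the limit along a fine mesh *)

Lemma fatou_ae d (T : measurableType d) (R : realType)
    (P : {measure set T -> \bar R}) (f : nat -> T -> \bar R) (g : T -> \bar R)
    (r : nat -> \bar R) (l : \bar R) :
  (forall m, measurable_fun setT (f m)) -> measurable_fun setT g ->
  (forall m x, 0 <= f m x)%E -> (forall x, 0 <= g x)%E ->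
  {ae P, forall x, f m x @[m --> \oo] --> g x} ->
  (forall m, \int[P]_x f m x <= r m)%E -> r m @[m --> \oo] --> l ->
  (\int[P]_x g x <= l)%E.
Proof.
move=> mf mg f0 g0 fg fr rl.
have e0 x : (0 <= limn_einf (f^~ x))%E.
  rewrite limn_einf_lim; apply: lime_ge; first exact: is_cvg_einfs.
  by apply: nearW => m; apply: le_ereal_inf_tmp => _ [k _ <-].
have -> : (\int[P]_x g x = \int[P]_x limn_einf (f^~ x))%E.
  apply: ge0_ae_eq_integral => //.
    rewrite (_ : (fun _ => _) = fun x => - limn_esup (fun m => - f m x))%E.
      by apply: measurableT_comp => //; apply: measurable_fun_limn_esup => m;
         apply: measurableT_comp.
    apply/funext => x; rewrite -limn_einfN; congr limn_einf.
    by apply/funext => m /=; rewrite oppeK.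
  by apply: filterS fg => x h _; rewrite (cvg_limn_einf_sup h).1.
apply: le_trans (fatou P measurableT mf (fun m x _ => f0 m x)) _.
rewrite limn_einf_lim -(cvg_lim _ (cvg_einfs rl))//.
apply: lee_lim; [exact: is_cvg_einfs|exact: is_cvg_einfs|].
apply: nearW => m; apply: le_ereal_inf_tmp => _ [k /= mk <-].
by apply: le_trans (fr k); apply: ereal_inf_lbound; exists k.
Qed.

Section fine_mesh.
Context d (Omega : measurableType d) (R : realType) (P : probability Omega R)
  (B : R -> {RV P >-> R}) (bm : brownian_motion B) (t : R).
Hypothesis t_gt0 : 0 < t.
Local Notation path w := (fun s => B s w).

(** Along these numbers of steps the expected sum of the cubes of the increments
    is of the order of 2^(-m), hence summable. *)
Definition level (m : nat) := (4 ^ m)%N.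

Lemma level_gt0 m : (0 < level m)%N. Proof. by rewrite expn_gt0. Qed.

Lemma mesh_levelE m : mesh t (level m) = t * (4^-1) ^+ m.
Proof. by rewrite /mesh /level natrX exprVn. Qed.

Lemma mesh_level0 : mesh t (level m) @[m --> \oo] --> 0.
Proof.
under eq_fun do rewrite mesh_levelE.
apply: (@cvg_geometric R t 4^-1).
by rewrite ger0_norm ?invr_ge0// invf_lt1 ?ltr1n.
Qed.

Definition cube_sum m w := \sum_(k < level m) `|grid_incr t (path w) (level m) k| ^+ 3.

Lemma measurable_cube_sum m : measurable_fun setT (cube_sum m).
Proof.
apply: measurable_sum => k; apply: measurable_funX.
by apply: (measurableT_comp (@normr_measurable R setT)); exact: measurable_grid_incr.
Qed.

Lemma cube_sum_ge0 m w : 0 <= cube_sum m w.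
Proof. by apply: sumr_ge0 => k _; rewrite exprn_ge0. Qed.

Lemma integral_cube_sum m : (\int[P]_w (cube_sum m w)%:E <=
  (12 * expR 2^-1 * Num.sqrt t ^+ 3 / (2 ^ m)%:R)%:E)%E.
Proof.
have m0 := mesh_gt0 t_gt0 (level_gt0 m).
have mc k : measurable_fun setT (fun w => (`|grid_incr t (path w) (level m) k| ^+ 3)%:E).
  apply/measurable_EFinP; apply: measurable_funX.
  by apply: (measurableT_comp (@normr_measurable R setT)); exact: measurable_grid_incr.
under eq_integral do rewrite /cube_sum -sumEFin.
rewrite ge0_integral_sum//.
apply: (@le_trans _ _ (\sum_(k < level m)
   (12 * expR 2^-1 * Num.sqrt (mesh t (level m)) ^+ 3)%:E)%E).
  apply: lee_sum => k _; apply: le_trans (integral_gauss_cube m0).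
  have [nu [nuE nuI]] := pushforward_measure (T' := measurableTypeR R) P (@measurable_grid_incr R t _ _ P B (level m) k).
  have mX : measurable_fun [set: R] (fun u : R => (`|u| ^+ 3)%:E).
    by apply/measurable_EFinP; apply: measurable_funX; exact: normr_measurable.
  rewrite -(nuI (fun u => (`|u| ^+ 3)%:E))//.
  rewrite le_eqVlt; apply/orP; left; apply/eqP.
  apply: eq_measure_integral => A mA _.
  by rewrite nuE; apply: (grid_incr_law bm) => //; exact: level_gt0.
rewrite sumEFin sumr_const card_ord lee_fin mesh_levelE.
rewrite (_ : (4^-1) ^+ m = (2^-1 ^+ m) ^+ 2); last first.
  by rewrite -exprM mulnC exprM; congr (_ ^+ m); rewrite expr2; lra.
rewrite sqrtrM ?(ltW t_gt0)// sqrtr_sqr ger0_norm ?exprn_ge0//.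
rewrite -[_ *+ level m]mulr_natr /level !natrX.
have -> : (4%:R : R) ^+ m = (2 ^+ m) ^+ 2.
  by rewrite -exprM mulnC exprM; congr (_ ^+ m); rewrite expr2; lra.
rewrite exprVn le_eqVlt; apply/orP; left; apply/eqP.
by field; rewrite expf_neq0 // pnatr_eq0.
Qed.

(** The sum over [m] of all the cube sums has finite expectation. *)
Lemma cube_sum_ae0 : {ae P, forall w, cube_sum m w @[m --> \oo] --> 0}.
Proof.
pose C := 12 * expR 2^-1 * Num.sqrt t ^+ 3.
have C0 : 0 <= C by rewrite !mulr_ge0 ?expR_ge0 ?exprn_ge0 ?sqrtr_ge0.
have mS m : measurable_fun setT (fun w => (cube_sum m w)%:E).
  by apply/measurable_EFinP; exact: measurable_cube_sum.
pose S w := (\sum_(0 <= m <oo) (cube_sum m w)%:E)%E.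
have S0 w : (0 <= S w)%E by apply: nneseries_ge0 => m _ _; rewrite lee_fin cube_sum_ge0.
have mSS : measurable_fun setT S.
  by apply: ge0_emeasurable_sum => // m w _ _; rewrite lee_fin cube_sum_ge0.
have iS : P.-integrable setT S.
  apply/integrableP; split => //.
  under eq_integral do rewrite gee0_abs//.
  rewrite /S integral_nneseries//; last by move=> m w _; rewrite lee_fin cube_sum_ge0.
  apply: (@le_lt_trans _ _ (\sum_(0 <= m <oo) ((C *+ 2) / (2 ^ (m + 1))%:R)%:E)%E).
    apply: lee_nneseries => [m _|m _].
      by move=> _; apply: integral_ge0 => w _; rewrite lee_fin cube_sum_ge0.
    apply: le_trans (integral_cube_sum m) _; rewrite lee_fin le_eqVlt -/C.
    apply/orP; left; apply/eqP; rewrite addn1 expnS natrM -mulr_natr.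
    by field; rewrite pnatr_eq0 -lt0n expn_gt0.
  have := @cvg_geometric_eseries_half R (C *+ 2) 0.
  by move=> /cvg_lim -> //; rewrite ltry.
have := integrable_ae measurableT iS; apply: filterS => w /(_ I) Sfin.
have Soo : (\sum_(0 <= m <oo) (cube_sum m w)%:E < +oo)%E by rewrite -ge0_fin_numE ?S0.
have cs0 m : (0 <= (cube_sum m w)%:E)%E by rewrite lee_fin cube_sum_ge0.
have T0 := @nneseries_tail_cvg R (fun m => (cube_sum m w)%:E) xpredT Soo (fun m _ => cs0 m).
suff : (cube_sum m w)%:E @[m --> \oo] --> 0%E by move/fine_cvgP => [].
apply: (@squeeze_cvge _ _ _ _ (fun=> 0%E) _ (fun N => \sum_(N <= k <oo) (cube_sum k w)%:E)%E).
- apply: nearW => m; rewrite cs0 /=.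
  have := @nneseries_lim_ge R (fun m => (cube_sum m w)%:E) xpredT m m.+1 (fun n _ _ => cs0 n).
  by rewrite big_nat1.
- exact: cvg_cst.
- exact: T0.
Qed.

End fine_mesh.

Section time_index.
Context (R : realType) (t : R).
Hypothesis t_gt0 : 0 < t.

(** The index of the grid node following [s], capped at the last one.  It is
    positive, because weights are attached to the ends of the steps. *)
Definition time_idx (s : R) m : nat :=
  minn (Num.truncn (s / mesh t (level m))).+1 (level m).

Lemma time_idx_le s m : (time_idx s m <= level m)%N.
Proof. exact: geq_minr. Qed.

Lemma time_idx_gt0 s m : (0 < time_idx s m)%N.
Proof. by rewrite /time_idx leq_min /= level_gt0. Qed.

Lemma node_time_idx s m : s \in `[0, t] ->
  `|node t (level m) (time_idx s m) - s| <= mesh t (level m).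
Proof.
rewrite in_itv/= => /andP[s0 st]; have m0 := mesh_gt0 t_gt0 (level_gt0 m).
have q0 : 0 <= s / mesh t (level m) by rewrite divr_ge0// ltW.
have /andP[h1 h2] := truncn_itv q0.
rewrite ler_pdivlMr// in h1; rewrite ltr_pdivrMr// in h2.
rewrite /time_idx; case: leqP => h; rewrite ler_norml; last first.
  rewrite node_last ?level_gt0//.
  have : t <= s.
    rewrite -(node_last t (level_gt0 m)); apply: le_trans h1.
    by rewrite /node ler_pM2r// ler_nat -ltnS.
  by move=> ts; apply/andP; split; move: m0 st ts; set q := mesh _ _; lra.
rewrite /node; move: h1 h2; rewrite -addn1 natrD mulrDl mul1r.
by set q := mesh _ _ in m0 *; set r := _ * q => h1 h2; apply/andP; split; lra.
Qed.

Lemma node_time_idx_cvg s : s \in `[0, t] ->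
  node t (level m) (time_idx s m) @[m --> \oo] --> s.
Proof.
move=> st; apply/cvgrPdist_le => e e0.
have /cvgrPdist_le/(_ _ e0) := mesh_level0 t.
apply: filterS => m; rewrite sub0r normrN distrC => h.
by apply: le_trans (node_time_idx m st) _; apply: le_trans h; exact: ler_norm.
Qed.

End time_index.

(** The area is a limit of the sums along the grid, which involve finitely many
    values of the path. *)
Lemma measurable_A_family (R : realType) (t : R) d (T : measurableType d)
    (f : T -> R -> R) s : 0 < t ->
  (forall x, {within `[0, t], continuous (f x)}) ->
  (forall r, r \in `[0, t] -> measurable_fun setT (f^~ r)) ->
  s \in `[0, t] -> measurable_fun setT (fun x => A_ (f x) s).
Proof.
move=> t_gt0 cf mf st; apply: (measurable_fun_cvg
  (h := fun m x => (grid_state t (f x) (level m) (time_idx t s m)).2)).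
  move=> m /=; apply: measurable_sum => j; apply: measurable_funM => //.
  have jN : (j < level m)%N by apply: leq_trans (ltn_ord j) (time_idx_le _ _ _).
  apply: measurableT_comp => //; apply: measurable_funD;
    by apply: mf; apply: node_itv; rewrite ?level_gt0 ?(ltnW jN).
move=> x _.
suff h : grid_state t (f x) (level m) (time_idx t s m) @[m --> \oo] --> (f x s, A_ (f x) s).
  by apply: (cvg_comp _ snd h); exact: cvg_snd.
apply: (grid_state_cvg t_gt0 (cf x) level_gt0 (mesh_level0 t)) => //.
- by move=> m; exact: time_idx_le.
- exact: node_time_idx_cvg.
Qed.

Section twist_inequality.
Context d (Omega : measurableType d) (R : realType) (P : probability Omega R)
  (B : R -> {RV P >-> R}) (bm : brownian_motion B) (t : R).
Hypothesis t_gt0 : 0 < t.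
Local Notation path w := (fun s => B s w).

Let cB w : {within `[0, t], continuous (path w)}. Proof. exact: bm_within. Qed.

Lemma measurable_grid_state m k : measurable_fun setT (fun w => grid_state t (path w) m k).
Proof.
apply: measurable_fun_pair => //.
apply: measurable_sum => j; apply: measurable_funM => //.
by apply: measurableT_comp => //; apply: measurable_funD.
Qed.

Lemma state_cvg w s : s \in `[0, t] ->
  grid_state t (path w) (level m) (time_idx t s m) @[m --> \oo] -->
  (B s w, A_ (path w) s).
Proof.
move=> st; apply: (grid_state_cvg t_gt0 (@cB w) level_gt0 (mesh_level0 t)) => //.
- by move=> m; exact: time_idx_le.
- exact: node_time_idx_cvg.
Qed.

Lemma measurable_A s : s \in `[0, t] -> measurable_fun setT (fun w => A_ (path w) s).
Proof. by apply: (measurable_A_family t_gt0) => // w; exact: cB. Qed.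

Let measurable_state s : s \in `[0, t] ->
  measurable_fun setT (fun w => (B s w, A_ (path w) s)).
Proof. by move=> st; apply: measurable_fun_pair => //; exact: measurable_A. Qed.

Variables (n : nat) (s : nat -> R) (h : nat -> R * R -> R) (M : R).
Hypothesis st : forall j, s j \in `[0, t].
Hypothesis ch : forall j, continuous (h j).
Hypothesis mh : forall j, measurable_fun setT (h j).
Hypothesis h0 : forall j z, 0 <= h j z.
Hypothesis hM : forall j z, h j z <= M.

(** The factors [h j] are distributed over the grid nodes that follow their
    times. *)
Let g m k z := \prod_(j < n | time_idx t (s j) m == k) h j z.

Let g_prod m (F : nat -> R * R) :
  \prod_(k < level m) g m k.+1 (F k.+1) = \prod_(j < n) h j (F (time_idx t (s j) m)).
Proof.
rewrite /g (exchange_big_dep predT)//=; apply: eq_bigr => j _.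
have i0 := time_idx_gt0 t (s j) m; have iN := time_idx_le t (s j) m.
have iN' : ((time_idx t (s j) m).-1 < level m)%N by rewrite prednK.
rewrite (big_pred1 (Ordinal iN')) /= ?prednK// => k.
apply/eqP/eqP => [e|->]; last by rewrite /= prednK.
by apply/val_inj => /=; rewrite e.
Qed.

Let twisted_prod c m w :
  \prod_(k < level m) twisted_weight (mesh t (level m)) c (g m) k
     (grid_state t (path w) (level m) k, grid_incr t (path w) (level m) k) =
  grid_weight t (path w) c (level m) *
  \prod_(j < n) h j (twist c (grid_state t (path w) (level m) (time_idx t (s j) m))).
Proof.
rewrite -(g_prod m (fun k => twist c (grid_state t (path w) (level m) k))).
rewrite /grid_weight -big_split /=; apply: eq_bigr => k _.
by rewrite /twisted_weight /= -grid_stateS.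
Qed.

Let mg m k : measurable_fun setT (g m k).
Proof.
rewrite (_ : g m k = fun z =>
    \prod_(j < n) (if time_idx t (s j) m == k then h j z else 1)).
  apply: measurable_prod => j _; case: (time_idx t (s j) m == k); [exact: mh|exact: measurable_cst].
by apply/funext => z; rewrite /g big_mkcond.
Qed.

Let g0 m k z : 0 <= g m k z. Proof. by apply: prodr_ge0. Qed.

Lemma slope_A_gt0 c w r : r \in `[0, t] -> 0 < 1 + c * A_ (path w) t ->
  0 < 1 + c * A_ (path w) r.
Proof.
rewrite in_itv/= => /andP[r0 rt] D0.
have Ar : 0 <= A_ (path w) r by exact: A_ge0.
have [c0|c0] := leP 0 c; first by rewrite ltr_pwDl// mulr_ge0.
apply: lt_le_trans D0 _; rewrite lerD2l ler_nM2l//.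
exact: (A_homo t_gt0 (@cB w)).
Qed.

Lemma twist_cvg c (z : nat -> R * R) (y : R * R) : 0 < slope c y ->
  z m @[m --> \oo] --> y -> twist c (z m) @[m --> \oo] --> twist c y.
Proof.
move=> sy zy.
have z1 : (z m).1 @[m --> \oo] --> y.1 by apply: (cvg_comp _ fst zy); exact: cvg_fst.
have z2 : (z m).2 @[m --> \oo] --> y.2 by apply: (cvg_comp _ snd zy); exact: cvg_snd.
have sl : slope c (z m) @[m --> \oo] --> slope c y.
  by apply: cvgD; [exact: cvg_cst|apply: cvgM => //; exact: cvg_cst].
have c1 : (z m).1 - ln (slope c (z m)) @[m --> \oo] --> y.1 - ln (slope c y).
  by apply: cvgB => //; exact: (continuous_cvg _ (@continuous_ln R _ sy) sl).
have c2 : (z m).2 / slope c (z m) @[m --> \oo] --> y.2 / slope c y.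
  by apply: cvgM => //; apply: cvgV => //; rewrite gt_eqF.
exact: (cvg_pair c1 c2).
Qed.

Lemma cvg_prod_fin (N : nat) (F : nat -> nat -> R) (l : nat -> R) :
  (forall j, F j m @[m --> \oo] --> l j) ->
  \prod_(j < N) F j m @[m --> \oo] --> \prod_(j < N) l j.
Proof.
move=> Fl; elim: N => [|N IH].
  by rewrite big_ord0; under eq_fun do rewrite big_ord0; exact: cvg_cst.
by rewrite big_ord_recr /=; under eq_fun do rewrite big_ord_recr /=; exact: cvgM.
Qed.

(** The discrete inequality, with Fatou's lemma on the left where the weights
    converge almost surely, and dominated convergence on the right where they
    are bounded. *)
Lemma twist_inequality c :
  (\int[P]_w ((((0 < 1 + c * A_ (path w) t)%R)%:R * girsanov c (B t w, A_ (path w) t) *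
      \prod_(j < n) h j (twist c (B (s j) w, A_ (path w) (s j))))%:E) <=
   \int[P]_w (\prod_(j < n) h j (B (s j) w, A_ (path w) (s j)))%:E)%E.
Proof.
have tt : t \in `[0, t] by rewrite in_itv/= lexx ltW.
have M0 : 0 <= M by apply: le_trans (hM 0 (0, 0)).
have mA j := measurable_state (st j); have mAt := measurable_state tt.
have mAt2 : measurable_fun setT (fun w => A_ (path w) t) by exact: measurable_A.
pose I w := ((0 < 1 + c * A_ (path w) t)%R)%:R : R.
have mI : measurable_fun setT I by rewrite /I; meas.
pose W m w := \prod_(k < level m) twisted_weight (mesh t (level m)) c (g m) k
     (grid_state t (path w) (level m) k, grid_incr t (path w) (level m) k).
have WE m w : W m w = grid_weight t (path w) c (level m) *
    \prod_(j < n) h j (twist c (grid_state t (path w) (level m) (time_idx t (s j) m))).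
  exact: twisted_prod.
have mW m : measurable_fun setT (W m).
  apply: measurable_prod => k _.
  apply: (measurableT_comp (measurable_twisted_weight _ _ (mg m) k)).
  by apply: measurable_fun_pair; [exact: measurable_grid_state|exact: measurable_grid_incr].
have W0 m w : 0 <= W m w by apply: prodr_ge0 => k _; exact: twisted_weight_ge0.
apply: (@fatou_ae _ _ _ P (fun m w => (I w * W m w)%:E) _
  (fun m => \int[P]_w (\prod_(j < n) h j
    (grid_state t (path w) (level m) (time_idx t (s j) m)))%:E)%E).
- by move=> m; apply/measurable_EFinP; exact: measurable_funM.
- apply/measurable_EFinP; apply: measurable_funM.
    apply: measurable_funM => //; rewrite /girsanov /slope /=.
    by have mBt : measurable_fun setT (B t) by []; meas.
  apply: measurable_prod => j _; apply: (measurableT_comp (mh j)).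
  rewrite /twist /slope /=; have mBs : measurable_fun setT (B (s j)) by [].
  by have mAs := measurable_A (st j); meas.
- by move=> m w; rewrite lee_fin mulr_ge0.
- move=> w; rewrite lee_fin mulr_ge0 ?prodr_ge0//.
  have [D|D] := ltP 0 (1 + c * A_ (path w) t); last by rewrite mul0r.
  by rewrite mul1r /girsanov divr_ge0 ?expR_ge0// ltW.
- apply: filterS (cube_sum_ae0 bm t_gt0) => w hw; apply: cvg_EFin; first exact: nearW.
  rewrite -[fine \o _]/(fun m => I w * W m w) /I; have [D|D] := ltP 0 (1 + c * A_ (path w) t); last first.
    by rewrite !mul0r; under eq_fun do rewrite mul0r; exact: cvg_cst.
  rewrite mul1r; rewrite (_ : (fun m => _ * W m w) = fun m =>
    grid_weight t (path w) c (level m) * \prod_(j < n) h j (twist c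
      (grid_state t (path w) (level m) (time_idx t (s j) m)))); last first.
    by apply/funext => m; rewrite mul1r WE.
  apply: cvgM.
    exact: (grid_weight_cvg t_gt0 (@cB w) (bm_start bm w) level_gt0 (mesh_level0 t) D hw).
  apply: (@cvg_prod_fin n (fun j m => h j (twist c (grid_state t (path w) (level m)
    (time_idx t (s j) m)))) (fun j => h j (twist c (B (s j) w, A_ (path w) (s j))))).
  move=> j; apply: (continuous_cvg _ (@ch j _)).
  apply: twist_cvg; last exact: state_cvg.
  exact: slope_A_gt0.
- move=> m; apply: (@le_trans _ _ (\int[P]_w (W m w)%:E)%E).
    apply: ge0_le_integral => //.
    + by move=> w _; rewrite lee_fin mulr_ge0.
    + by apply/measurable_EFinP; exact: measurable_funM.
    + exact/measurable_EFinP.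
    + by move=> w _; rewrite lee_fin ler_piMl// /I; case: ltP.
  apply: le_trans (discrete_twist_le bm t_gt0 c (level_gt0 m) (mg m) (g0 m)) _.
  by under eq_integral do rewrite (g_prod m (fun k => grid_state t (path _) (level m) k)).
- pose F m w := (\prod_(j < n) h j (grid_state t (path w) (level m) (time_idx t (s j) m)))%:E.
  have [|||||_ _] := @dominated_convergence _ _ _ P setT measurableT F
    (fun w => (\prod_(j < n) h j (B (s j) w, A_ (path w) (s j)))%:E) (cst (M ^+ n)%:E) => //.
  + move=> m; apply/measurable_EFinP; apply: measurable_prod => j _.
    by apply: (measurableT_comp (mh j)); exact: measurable_grid_state.
  + apply/measurable_EFinP; apply: measurable_prod => j _.
    exact: (measurableT_comp (mh j)).
  + apply: aeW => w _; apply: cvg_EFin; first exact: nearW.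
    rewrite -[fine \o _]/(fun m => \prod_(j < n) h j (grid_state t (path w) (level m)
      (time_idx t (s j) m))).
    apply: (@cvg_prod_fin n (fun j m => h j (grid_state t (path w) (level m)
      (time_idx t (s j) m))) (fun j => h j (B (s j) w, A_ (path w) (s j)))).
    move=> j; apply: (continuous_cvg _ (@ch j _)); exact: state_cvg.
  + exact: finite_measure_integrable_cst.
  + apply: aeW => w m _; rewrite /F abse_EFin lee_fin ger0_norm ?prodr_ge0//.
    rewrite -[X in _ ^+ X](card_ord n) -prodr_const.
    by apply: ler_prod => j _; rewrite h0 hM.
Qed.

End twist_inequality.

(** * Borel sets of the path space *)

Section cpath_measurable.
Context {R : realType} (t : R).
Hypothesis t_gt0 : 0 < t.
Local Notation I := (set_type (`[0, t] : set R)).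

Section topology.
Variable V : normedModType R.

Lemma cpath_open_ball (U : set (cpath t V)) (phi : cpath t V) : open U -> U phi ->
  exists2 e : R, 0 < e &
    forall psi : cpath t V, (forall s : I, `|phi s - psi s| < e) -> U psi.
Proof.
move=> [W oW <-] /= Wphi.
have : nbhs (cpath_uniform phi) W by exact: open_nbhs_nbhs.
move=> /uniform_nbhs[E [entE EW]].
move: entE; rewrite -entourage_ballE => -[e /= e0 eE].
exists e => // psi h; apply: EW => s _; apply: eE => /=.
by rewrite -ball_normE /=; exact: h.
Qed.

Lemma cpath_eval_open (s : I) (O : set V) : open O ->
  open [set phi : cpath t V | O (phi s)].
Proof.
move=> oO; exists [set f : {uniform I -> V} | O (f s)] => //.
rewrite openE => f /= Of; apply/uniform_nbhs.
have : nbhs (f s) O by exact: open_nbhs_nbhs.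
move=> /nbhs_ballP[e /= e0 eO].
exists [set xy | ball xy.1 e xy.2]; split.
  by rewrite -entourage_ballE; exists e.
by move=> g /= h; apply: eO; exact: h.
Qed.

(** Capping the index makes every pair (m, k) a time in [0, t], so that conditions
    at all nodes are plain countable intersections. *)
Definition clip_node m k : R := node t (level m) (minn k (level m)).

Lemma clip_node_itv m k : clip_node m k \in `[0, t].
Proof. by apply: node_itv => //; [exact: level_gt0|exact: geq_minr]. Qed.

Definition time_of (r : R) (h : r \in `[0, t]) : I := SigSub (mem_set h : r \in (`[0, t]%classic)).

Lemma val_time_of r (h : r \in `[0, t]) : set_val (time_of h) = r.
Proof. by []. Qed.

Lemma clip_node_time_idx s m :
  clip_node m (time_idx t s m) = node t (level m) (time_idx t s m).
Proof. by rewrite /clip_node (minn_idPl _)//; exact: time_idx_le. Qed.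

Lemma time_ofE (s : I) : set_val s \in `[0, t].
Proof. by have := set_valP s. Qed.

Lemma cpath_unif (phi : cpath t V) (e : R) : 0 < e ->
  exists2 r, 0 < r & forall s s' : I,
    `|set_val s - set_val s'| < r -> `|phi s - phi s'| < e.
Proof.
move=> e0; pose F := 'valL_(0 : V) phi.
have cF : {within `[0, t], continuous F}.
  by apply/subspace_valL_continuousP'; exact: cts_fun.
have FE (s : I) : F (set_val s) = phi s.
  by rewrite -[RHS](congr1 (@^~ s) (valLK (0 : V) phi)).
have [r r0 hr] := within_itv_unif cF e0; exists r => // s s' h.
by rewrite -!FE; apply: hr => //; exact: time_ofE.
Qed.

(** The nodes of the successive grids are dense. *)
Lemma cpath_dense_le (phi psi : cpath t V) (e : R) :
  (forall m k, `|phi (time_of (clip_node_itv m k)) - psi (time_of (clip_node_itv m k))| <= e) ->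
  forall s, `|phi s - psi s| <= e.
Proof.
move=> h s; apply/ler_addgt0Pr => e' e'0.
have e2 : 0 < e' / 2 by rewrite divr_gt0.
have [r1 r10 h1] := cpath_unif phi e2; have [r2 r20 h2] := cpath_unif psi e2.
have r0 : 0 < Num.min r1 r2 by rewrite lt_min r10.
have /cvgrPdist_lt/(_ _ r0)[m _ hm] := node_time_idx_cvg t_gt0 (time_ofE s).
have {}hm := hm m (leqnn m).
set k := time_idx t (set_val s) m in hm.
have ks : `|set_val s - set_val (time_of (clip_node_itv m k))| < Num.min r1 r2.
  by rewrite val_time_of clip_node_time_idx.
move: ks; rewrite lt_min => /andP[k1 k2].
have := h1 _ _ k1; have := h2 _ _ k2; have := h m k.
set a := phi (time_of _); set b := psi (time_of _) => hab hb ha.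
have -> : phi s - psi s = (phi s - a) + ((a - b) + (b - psi s)).
  by rewrite !addrA !subrK.
apply: le_trans (ler_normD _ _) _.
have : `|a - b + (b - psi s)| <= e + e' / 2.
  by rewrite (le_trans (ler_normD _ _))// lerD// distrC ltW.
move: ha; set x := `|phi s - a|; set y := `|_ + _|; lra.
Qed.

(** An open set is the countable union of the sets of paths that stay close, at
    all grid nodes, to a step function with values in the dense sequence [q], over
    those step functions for which all such paths lie in the open set.  Each of
    these sets is described by countably many values of the path. *)
Lemma measurable_cpath d (T : measurableType d) (f : T -> cpath t V) (q : nat -> V) :
  (forall v e, 0 < e -> exists k, `|v - q k| < e) ->
  (forall (s : I) k (e : R), measurable [set x | `|f x s - q k| <= e]) ->
  measurable_fun setT f.
Proof.
move=> dq mf; apply: (measurability _ (erefl : @measurable _ (cpath t V) = _)).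
move=> _ [U oU <-]; rewrite setTI.
pose cell m (s : I) := time_idx t (set_val s) m.
(* A code gives a grid, a precision and the indices in [q] of the values of a
   step function on the cells of the grid. *)
pose good (c : nat * nat * seq nat) (phi : cpath t V) := forall m k,
  let s := time_of (clip_node_itv m k) in
  `|phi s - q (nth 0%N c.2 (cell c.1.1 s))| <= c.1.2.+1%:R^-1.
pose ball_ c : set T := if `[< [set phi | good c phi] `<=` U >] then
  [set x | good c (f x)] else set0.
have -> : f @^-1` U = \bigcup_n (if unpickle n is Some c then ball_ c else set0).
  apply/seteqP; split=> [x /= Ux|x [n _]]; last first.
    case: (unpickle n) => [c|//]; rewrite /ball_; case: asboolP => // cU gx.
    exact: cU.
  have [e e0 he] := cpath_open_ball oU Ux.
  have e4 : 0 < e / 4 by rewrite divr_gt0.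
  have [j hj] : exists j : nat, j.+1%:R^-1 < e / 4.
    exists (Num.truncn (e / 4)^-1); rewrite -[ltRHS]invrK ltf_pV2 ?posrE ?invr_gt0//.
    exact: truncnS_gt.
  have j0 : 0 < (j.+1%:R^-1 : R) by rewrite invr_gt0.
  have j2 : 0 < (j.+1%:R^-1 : R) / 2 by rewrite divr_gt0.
  have [r r0 hr] := cpath_unif (f x) j2.
  have [m hm] : exists m, mesh t (level m) < r / 2.
    have r2 : 0 < r / 2 by rewrite divr_gt0.
    have /cvgrPdist_lt/(_ _ r2)[m _ /(_ m (leqnn m))] := mesh_level0 t.
    by rewrite sub0r normrN => h; exists m; apply: le_lt_trans h; exact: ler_norm.
  have [kap hkap] := choice (fun i => dq (f x (time_of (clip_node_itv m i))) _ j2).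
  pose c := (m, j, [seq kap i | i <- iota 0 (level m).+1]).
  have kapE (s : I) : nth 0%N c.2 (cell m s) = kap (cell m s).
    have iN : (cell m s < (level m).+1)%N by rewrite ltnS; exact: time_idx_le.
    by rewrite -[c.2]/([seq kap i | i <- iota 0 (level m).+1]) (nth_map 0%N) ?size_iota// nth_iota// add0n.
  exists (pickle c) => //; rewrite pickleK /ball_; case: asboolP => [cU|[]].
    move=> m' k /=; set s := time_of _.
    rewrite kapE.
    rewrite -(subrKA (f x (time_of (clip_node_itv m (cell m s))))).
    rewrite (le_trans (ler_normD _ _))// [leRHS]splitr lerD// ltW//.
    apply: hr; rewrite !val_time_of clip_node_time_idx.
    rewrite distrC (le_lt_trans (node_time_idx t_gt0 m (time_ofE s)))//.
    by apply: lt_trans hm _; rewrite ltr_pdivrMr// ltr_pMr// ltr1n.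
  move=> psi /= hpsi; apply: he => s.
  apply: (@le_lt_trans _ _ (2 * j.+1%:R^-1)); last by move: hj e0; set y := _^-1; lra.
  apply: cpath_dense_le => m' k; set s' := time_of _.
  have h1 := hpsi m' k; rewrite /= -/s' in h1.
  have h2 : `|f x s' - q (nth 0%N c.2 (cell m s'))| <= j.+1%:R^-1.
    rewrite kapE.
    rewrite -(subrKA (f x (time_of (clip_node_itv m (cell m s'))))).
    rewrite (le_trans (ler_normD _ _))// [leRHS]splitr lerD// ltW//.
    apply: hr; rewrite !val_time_of clip_node_time_idx.
    rewrite distrC (le_lt_trans (node_time_idx t_gt0 m (time_ofE s')))//.
    by apply: lt_trans hm _; rewrite ltr_pdivrMr// ltr_pMr// ltr1n.
  rewrite -(subrKA (q (nth 0%N c.2 (cell m s')))) (le_trans (ler_normD _ _))//.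
  by rewrite mulr2n mulrDl mul1r lerD// distrC.
apply: bigcupT_measurable => n; case: (unpickle n) => [c|//].
rewrite /ball_; case: asboolP => // _.
rewrite (_ : [set x | _] = \bigcap_m \bigcap_k
  [set x | `|f x (time_of (clip_node_itv m k)) -
    q (nth 0%N c.2 (cell c.1.1 (time_of (clip_node_itv m k))))| <= c.1.2.+1%:R^-1]).
  by apply: bigcapT_measurable => m; apply: bigcapT_measurable => k; exact: mf.
apply/seteqP; split=> [x gx m _ k _|x gx m k]; first exact: gx.
exact: gx.
Qed.

End topology.

Lemma measurable_eval (s : I) : measurable_fun setT (fun phi : cpath t R => phi s).
Proof.
apply: (measurability _ (RGenOpens.measurableE R)) => _ [_ [a [b ->]] <-].
rewrite setTI; apply: sub_sigma_algebra; apply: cpath_eval_open.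
exact: interval_open.
Qed.

Definition rat_seq (k : nat) : R := if unpickle k is Some r then ratr r else 0.

Lemma rat_seq_dense (v e : R) : 0 < e -> exists k : nat, `|v - rat_seq k| < e.
Proof.
move=> e0; have ve : v - e < v + e by lra.
have [r] := rat_in_itvoo ve; rewrite in_itv/= => /andP[h1 h2].
exists (pickle r); rewrite /rat_seq pickleK ltr_norml; apply/andP; split; lra.
Qed.

Lemma measurable_norm_le d (T : measurableType d) (g : T -> R) (a e : R) :
  measurable_fun setT g -> measurable [set x | `|g x - a| <= e].
Proof.
move=> mg; have mn : measurable_fun setT (fun x => `|g x - a|).
  by apply: (measurableT_comp (@normr_measurable R setT)); meas.
rewrite (_ : [set x | _] = [set: T] `&` (fun x => `|g x - a| <= e) @^-1` [set true]).
  exact: (measurable_fun_ler mn (measurable_cst e) measurableT (Y := [set true])).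
by rewrite setTI; apply/seteqP; split.
Qed.

Lemma measurable_to_cpath d (T : measurableType d) (f : T -> cpath t R) :
  (forall s : I, measurable_fun setT (fun x => f x s)) -> measurable_fun setT f.
Proof.
move=> mf; apply: (measurable_cpath (q := rat_seq)); first exact: rat_seq_dense.
by move=> s k e; exact: measurable_norm_le.
Qed.

Lemma measurable_cpath_pair d (T : measurableType d) (f g : T -> cpath t R) :
  measurable_fun setT f -> measurable_fun setT g ->
  measurable_fun setT (fun x => cpath_pair (f x) (g x)).
Proof.
move=> mf mg.
pose q (k : nat) : R * R := if unpickle k is Some (i, j) then (rat_seq i, rat_seq j) else 0.
apply: (measurable_cpath (q := q)).
  move=> [a b] e e0; have [i hi] := rat_seq_dense a e0; have [j hj] := rat_seq_dense b e0.
  exists (pickle (i, j)); rewrite /q pickleK.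
  by rewrite prod_normE /= gt_max hi hj.
move=> s k e.
rewrite (_ : [set x | _] = [set x | `|f x s - (q k).1| <= e] `&`
    [set x | `|g x s - (q k).2| <= e]).
  by apply: measurableI; apply: measurable_norm_le;
    [exact: (measurableT_comp (measurable_eval s) mf)|
     exact: (measurableT_comp (measurable_eval s) mg)].
by apply/seteqP; split=> x /=; rewrite prod_normE /= ge_max => /andP.
Qed.

End cpath_measurable.

Section cylinders.
Context {R : realType} (t : R).
Hypothesis t_gt0 : 0 < t.
Local Notation I := (set_type (`[0, t] : set R)).
Local Notation C := (cpath t R).

(** Continuous functions increasing to the indicator of the interval ]a, b[. *)
Definition tent (a b : R) (k : nat) (x : R) : R :=
  Num.min 1 (k%:R * Num.max 0 (Num.min (x - a) (b - x))).

Lemma tent_itv a b k x : 0 <= tent a b k x <= 1.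
Proof.
rewrite /tent le_min ler01 /= ge_min lexx andbT mulr_ge0// le_max lexx//.
Qed.

Lemma continuous_minr (T : topologicalType) (f g : T -> R) :
  continuous f -> continuous g -> continuous (fun x => Num.min (f x) (g x)).
Proof. by move=> cf cg x; exact: (@continuous_min _ _ f g x (cf x) (cg x)). Qed.

Lemma continuous_maxr (T : topologicalType) (f g : T -> R) :
  continuous f -> continuous g -> continuous (fun x => Num.max (f x) (g x)).
Proof. by move=> cf cg x; exact: (@continuous_max _ _ f g x (cf x) (cg x)). Qed.

Lemma tent_continuous a b k : continuous (tent a b k).
Proof.
apply: continuous_minr; first by move=> x; exact: cvg_cst.
move=> x; apply: cvgM; first exact: cvg_cst.
move: x; apply: continuous_maxr; first by move=> x; exact: cvg_cst.
apply: continuous_minr => x.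
- by apply: cvgB; [exact: cvg_id|exact: cvg_cst].
- by apply: cvgB; [exact: cvg_cst|exact: cvg_id].
Qed.

Lemma tent_cvg a b x : tent a b k x @[k --> \oo] --> (\1_(`]a, b[%classic) x : R).
Proof.
rewrite indicE; have [xab|xab] := boolP (x \in `]a, b[%classic).
  move: xab; rewrite inE/= in_itv/= => /andP[ax xb].
  have m0 : 0 < Num.min (x - a) (b - x) by rewrite lt_min !subr_gt0 ax.
  apply: cvg_near_cst; near=> k.
  rewrite /tent (max_idPr (ltW m0)); apply/min_idPl.
  rewrite -ler_pdivrMr// mul1r; near: k.
  exact: nbhs_infty_ger.
apply: cvg_near_cst; apply: nearW => k.
have m0 : Num.min (x - a) (b - x) <= 0.
  rewrite leNgt; apply: contra xab; rewrite lt_min !subr_gt0 => h.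
  by rewrite inE/= in_itv.
rewrite /tent (max_idPl m0) mulr0; apply/min_idPr; exact: ler01.
Unshelve. all: by end_near. Qed.

Definition cylinder (n : nat) (s : nat -> I) (a b : nat -> R) : set C :=
  [set phi | forall j, (j < n)%N -> phi (s j) \in `]a j, b j[].

Definition cylinders : set (set C) :=
  [set A | exists n s a b, A = cylinder n s a b].

Lemma cylinders_setI : setI_closed cylinders.
Proof.
move=> _ _ [n [s [a [b ->]]]] [n' [s' [a' [b' ->]]]].
pose glue (T : Type) (u v : nat -> T) j := if (j < n)%N then u j else v (j - n)%N.
exists (n + n')%N, (glue _ s s'), (glue _ a a'), (glue _ b b').
apply/seteqP; split=> [phi [h h'] j jn|phi h].
  rewrite /glue; case: ltnP => [//|nj]; first exact: h.
  by apply: h'; rewrite ltn_subLR.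
split=> j jn.
  by have := h j (ltn_addr _ jn); rewrite /glue jn.
have := h (n + j)%N; rewrite ltn_add2l => /(_ jn).
by rewrite /glue ltnNge leq_addr /= addKn.
Qed.

Lemma eval_cylinder (s : I) (a b : R) :
  cylinders [set phi : C | phi s \in `]a, b[].
Proof.
exists 1%N, (fun=> s), (fun=> a), (fun=> b).
by apply/seteqP; split=> phi /= h; [move=> j _|exact: (h 0%N)].
Qed.

(** The identity, from the path space with the cylinder sigma-algebra, is
    measurable because its evaluations are. *)
Lemma measurable_cylinders : @measurable _ C = <<s cylinders >>.
Proof.
apply/seteqP; split; last first.
  apply: smallest_sub; first exact: sigma_algebra_measurable.
  move=> _ [n [s [a [b ->]]]].
  rewrite (_ : cylinder _ _ _ _ = \bigcap_(j in [set j | (j < n)%N])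
    (fun phi : C => phi (s j)) @^-1` `]a j, b j[%classic).
    rewrite bigcap_mkcond; apply: bigcap_measurable => // j _.
    case: ifP => // _; rewrite -[X in measurable X]setTI.
    exact: measurable_eval.
  by apply/seteqP; split=> phi h j /= jn; exact: h.
pose idC : g_sigma_algebraType cylinders -> C := id.
have mid : measurable_fun setT idC.
  apply: (measurable_to_cpath t_gt0) => s.
  apply: (measurability _ (RGenOpens.measurableE R)) => _ [_ [a [b ->]] <-].
  rewrite setTI; apply: sub_sigma_algebra.
  exact: eval_cylinder.
by move=> A mA; have := mid measurableT A mA; rewrite setTI.
Qed.

(** Cylinders over open intervals are stable by intersection, and their indicators
    are bounded limits of products of [tent] functions. *)
Lemma cylinder_unique (nu1 nu2 : {measure set C -> \bar R}) :
  (nu1 setT < +oo)%E -> (nu2 setT < +oo)%E ->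
  (forall n (s : nat -> I) (f : nat -> R -> R),
    (forall j, continuous (f j)) -> (forall j x, 0 <= f j x <= 1) ->
    (\int[nu1]_phi (\prod_(j < n) f j (phi (s j)))%R%:E =
    \int[nu2]_phi (\prod_(j < n) f j (phi (s j)))%R%:E)%E) ->
  forall A, measurable A -> nu1 A = nu2 A.
Proof.
move=> fin1 fin2 e12.
apply: (measure_unique cylinders (fun=> setT)).
- exact: measurable_cylinders.
- exact: cylinders_setI.
- move=> _; exists 0%N, (fun=> time_of (clip_node_itv t_gt0 0 0)), (fun=> 0), (fun=> 0).
  by apply/seteqP; split.
- by rewrite -subTset => x _; exists 0%N.
- move=> _ [n [s [a [b ->]]]].
  have mcyl : measurable (cylinder n s a b).
    by rewrite measurable_cylinders; apply: sub_sigma_algebra; exists n, s, a, b.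
  pose F k (phi : C) := (\prod_(j < n) tent (a j) (b j) k (phi (s j)))%:E.
  have lim (nu : {measure set C -> \bar R}) : (nu setT < +oo)%E ->
      (\int[nu]_phi F k phi)%E @[k --> \oo] --> nu (cylinder n s a b).
    move=> fin.
    have [|||||_ _] := @dominated_convergence _ _ _ nu setT measurableT F
      (fun phi => (\1_(cylinder n s a b) phi)%:E) (cst 1%E) => //.
    + move=> k; apply/measurable_EFinP; apply: measurable_prod => j _.
      apply: measurableT_comp; last exact: measurable_eval.
      by apply: continuous_measurable_fun; exact: tent_continuous.
    + by apply/measurable_EFinP; exact: measurable_indic.
    + apply: aeW => phi _; apply: cvg_EFin; first exact: nearW.
      rewrite (_ : \1_(cylinder n s a b) phi =
          \prod_(j < n) \1_(`]a j, b j[%classic) (phi (s j)) :> R).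
        apply: (@cvg_prod_fin R n (fun j k => tent (a j) (b j) k (phi (s j)))
          (fun j => \1_(`]a j, b j[%classic) (phi (s j)))) => j.
        exact: tent_cvg.
      rewrite indicE; case: (boolP (phi \in _)) => [|].
        rewrite inE => h; rewrite big1// => j _; rewrite indicE mem_set//.
        by have := h j (ltn_ord j).
      rewrite notin_setE => h.
      have [j nj] : exists j : 'I_n, ~ (phi (s j) \in `]a j, b j[).
        apply: contrapT => hn; apply: h => j jn.
        by apply: contrapT => hh; apply: hn; exists (Ordinal jn).
      by rewrite (bigD1 j)//= indicE memNset// mul0r.
    + by apply/integrableP; split; [exact: measurable_cst|];
        under eq_integral do rewrite /= normr1; rewrite integral_cst// mul1e.
    + apply: aeW => phi k _; rewrite /F abse_EFin lee_fin ger0_norm.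
        rewrite -[leRHS](big1_eq (op := *%R) (idx := 1) (index_enum 'I_n) predT).
        by apply: ler_prod => j _; exact: tent_itv.
      by apply: prodr_ge0 => j _; have /andP[] := tent_itv (a j) (b j) k (phi (s j)).
    by rewrite integral_indic// setIT.
  have l1 := lim nu1 fin1; have l2 := lim nu2 fin2.
  have e : (fun k => \int[nu1]_phi F k phi)%E = (fun k => \int[nu2]_phi F k phi)%E.
    apply/funext => k; apply: (e12 n s (fun j => tent (a j) (b j) k)).
    + by move=> j; exact: tent_continuous.
    + by move=> j x; exact: tent_itv.
  rewrite e in l1; exact: (cvg_unique _ l1 l2).
- by [].
Qed.

End cylinders.

(** * Equality at finitely many times *)

Section ramp.
Context {R : realType}.

(** Continuous functions increasing to the indicator of the positive half-line,
    that vanish below 1 / (k + 1). *)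
Definition ramp (k : nat) (x : R) : R := Num.min 1 (Num.max 0 (k.+1%:R * x - 1)).

Lemma ramp_itv k x : 0 <= ramp k x <= 1.
Proof. by rewrite /ramp le_min ler01 ge_min lexx le_max lexx. Qed.

Lemma ramp_continuous k : continuous (ramp k).
Proof.
apply: continuous_minr; first by move=> x; exact: cvg_cst.
apply: continuous_maxr; first by move=> x; exact: cvg_cst.
move=> x; apply: cvgB; last exact: cvg_cst.
by apply: cvgM; [exact: cvg_cst|exact: cvg_id].
Qed.

Lemma ramp_neq0 k x : ramp k x != 0 -> k.+1%:R^-1 <= x.
Proof.
apply: contraR; rewrite -ltNge => h.
have h' : k.+1%:R * x - 1 <= 0.
  by rewrite subr_le0 -ler_pdivlMl// mulr1 ltW.
by rewrite /ramp (max_idPl h') (min_idPr ler01).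
Qed.

Lemma ramp_le_pos k x : ramp k x <= (0 < x)%R%:R.
Proof.
have [x0|x0] := ltP 0 x; first by have /andP[] := ramp_itv k x.
have [->//|/ramp_neq0 h] := eqVneq (ramp k x) 0.
by have := le_trans h x0; rewrite leNgt invr_gt0 ltr0n.
Qed.

Lemma invn_near_le (x : R) : 0 < x -> \forall k \near \oo, k.+1%:R^-1 <= x.
Proof.
move=> x0; near=> k.
rewrite -[leRHS]invrK lef_pV2 ?posrE ?invr_gt0// -natr1 ler_wpDr//.
near: k; exact: nbhs_infty_ger.
Unshelve. all: by end_near. Qed.

Lemma ramp_near1 (x : R) : 0 < x -> \forall k \near \oo, ramp k x = 1.
Proof.
move=> x0; near=> k.
have h : 1 <= k.+1%:R * x - 1.
  rewrite lerBrDr -ler_pdivrMr//; apply: (@le_trans _ _ k%:R); last by rewrite ler_nat.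
  near: k; exact: nbhs_infty_ger.
by rewrite /ramp; apply/min_idPl; rewrite le_max h orbT.
Unshelve. all: by end_near. Qed.

End ramp.

Section twist_equality.
Context d (Omega : measurableType d) (R : realType) (P : probability Omega R)
  (B : R -> {RV P >-> R}) (bm : brownian_motion B) (t : R).
Hypothesis t_gt0 : 0 < t.
Local Notation path w := (fun s => B s w).
Local Notation A w s := (A_ (fun r => B r w) s).
Variables (c : R) (n : nat) (s : nat -> R) (f : nat -> R -> R).
Hypothesis st : forall j, s j \in `[0, t].
Hypothesis cf : forall j, continuous (f j).
Hypothesis f01 : forall j x, 0 <= f j x <= 1.

(** The final time is added to the list, at index [n], to carry the cut-offs that
    depend on [A_t]. *)
Let s' j := if (j < n)%N then s j else t.
Let pos c w : R := ((0 < 1 + c * A w t)%R)%:R.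

Let s't j : s' j \in `[0, t].
Proof. by rewrite /s'; case: ifP => // _; rewrite in_itv/= lexx ltW. Qed.

Let mA r : r \in `[0, t] -> measurable_fun setT (fun w => A w r).
Proof. exact: measurable_A. Qed.

Let tt : t \in `[0, t]. Proof. by rewrite in_itv/= lexx ltW. Qed.

Let mpos c' : measurable_fun setT (pos c').
Proof. by rewrite /pos; have := mA tt => h; meas. Qed.

Let mgir c' : measurable_fun setT (fun w => girsanov c' (B t w, A w t)).
Proof.
rewrite /girsanov /slope /=; have := mA tt => h.
by have mBt : measurable_fun setT (B t) by []; meas.
Qed.

Let mf j : measurable_fun setT (f j).
Proof. exact: continuous_measurable_fun. Qed.

Let mleft : measurable_fun setT (fun w => pos c w * girsanov c (B t w, A w t) *
  \prod_(j < n) f j (B (s j) w - ln (1 + c * A w (s j)))).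
Proof.
apply: measurable_funM; first exact: measurable_funM.
apply: measurable_prod => j _; apply: (measurableT_comp (mf j)).
have mBs : measurable_fun setT (B (s j)) by [].
by have mAs := mA (st j); meas.
Qed.

Let mright : measurable_fun setT (fun w => pos (- c) w * \prod_(j < n) f j (B (s j) w)).
Proof.
apply: measurable_funM => //; apply: measurable_prod => j _.
exact: (measurableT_comp (mf j)).
Qed.

Let gir0 c' w : 0 <= pos c' w * girsanov c' (B t w, A w t).
Proof.
rewrite /pos; have [D|D] := ltP 0 (1 + c' * A w t); last by rewrite mul0r.
by rewrite mul1r /girsanov divr_ge0 ?expR_ge0// ltW.
Qed.

Let prod0 (F : 'I_n -> R) : 0 <= \prod_(j < n) f j (F j).
Proof. by apply: prodr_ge0 => j _; have /andP[] := f01 j (F j). Qed.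

(** After S_c the factor 1 - c A_t becomes 1 / (1 + c A_t) > 0, so the cut-off
    [ramp k (1 - c A_t)] restricts the right-hand side without changing the
    limit of the left-hand side. *)
Let twist_le :
  (\int[P]_w (pos c w * girsanov c (B t w, A w t) *
     \prod_(j < n) f j (B (s j) w - ln (1 + c * A w (s j))))%:E <=
   \int[P]_w (pos (- c) w * \prod_(j < n) f j (B (s j) w))%:E)%E.
Proof.
pose h k j (z : R * R) := if (j < n)%N then f j z.1 else ramp k (1 - c * z.2).
have h01 k j z : 0 <= h k j z <= 1 by rewrite /h; case: ifP => _; [exact: f01|exact: ramp_itv].
have ch k j : continuous (h k j).
  rewrite /h; case: (j < n)%N => z.
    by apply: (continuous_cvg _ (@cf j _)); exact: cvg_fst.
  apply: (continuous_cvg _ (@ramp_continuous R k _)).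
  by apply: cvgB; [exact: cvg_cst|apply: cvgM; [exact: cvg_cst|exact: cvg_snd]].
have mh k j : measurable_fun setT (h k j).
  rewrite /h; case: (j < n)%N; first exact: (measurableT_comp (mf j)).
  apply: (@measurableT_comp _ _ _ _ _ _ (ramp k)).
    by apply: continuous_measurable_fun; exact: ramp_continuous.
  have m2 : measurable_fun setT (@snd R R) by []; by meas.
have prodE k (F : nat -> R * R) :
    \prod_(j < n.+1) h k j (F j) = \prod_(j < n) f j (F j).1 * ramp k (1 - c * (F n).2).
  rewrite big_ord_recr /=; congr (_ * _); last by rewrite /h ltnn.
  by apply: eq_bigr => j _; rewrite /h ltn_ord.
have s'j (j : 'I_n) : s' j = s j by rewrite /s' ltn_ord.
have s'n : s' n = t by rewrite /s' ltnn.
pose L k w := pos c w * girsanov c (B t w, A w t) *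
  \prod_(j < n.+1) h k j (twist c (B (s' j) w, A w (s' j))).
have LE k w : L k w = pos c w * girsanov c (B t w, A w t) *
    \prod_(j < n) f j (B (s j) w - ln (1 + c * A w (s j))) *
    ramp k (1 - c * (A w t / (1 + c * A w t))).
  rewrite /L (prodE k (fun j => twist c (B (s' j) w, A w (s' j)))) mulrA s'n.
  rewrite (eq_bigr (fun j : 'I_n => f j (B (s j) w - ln (1 + c * A w (s j)))))//.
  by move=> j _; rewrite s'j.
have mL k : measurable_fun setT (L k).
  have -> := funext (LE k).
  apply: (measurable_funM mleft).
  apply: (@measurableT_comp _ _ _ _ _ _ (ramp k)).
    by apply: continuous_measurable_fun; exact: ramp_continuous.
  have hA := mA tt; by meas.
apply: (@fatou_ae _ _ _ P (fun k w => (L k w)%:E) _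
  (fun=> \int[P]_w (pos (- c) w * \prod_(j < n) f j (B (s j) w))%:E)%E).
- by move=> k; exact/measurable_EFinP.
- exact/measurable_EFinP.
- move=> k w; rewrite lee_fin LE; apply: mulr_ge0.
    by apply: mulr_ge0 (gir0 _ _) (prod0 _).
  by have /andP[] := ramp_itv k (1 - c * (A w t / (1 + c * A w t))).
- by move=> w; rewrite lee_fin; apply: mulr_ge0 (gir0 _ _) (prod0 _).
- apply: aeW => w; apply: cvg_EFin; first exact: nearW.
  rewrite -[fine \o _]/(fun k => L k w).
  apply: cvg_near_cst.
  have [D|D] := ltP 0 (1 + c * A w t); last first.
    by apply: nearW => k; rewrite LE /pos ltNge D /= !mul0r.
  have : 0 < 1 - c * (A w t / (1 + c * A w t)).
    rewrite (_ : _ - _ = (1 + c * A w t)^-1) ?invr_gt0//.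
    by field; rewrite gt_eqF.
  by move=> /ramp_near1; apply: filterS => k e; rewrite LE e mulr1.
- move=> k; apply: le_trans (twist_inequality bm t_gt0 n.+1 s't (ch k) (mh k) _ _ c) _.
  + by move=> j z; have /andP[] := h01 k j z.
  + by move=> j z; have /andP[_ hM] := h01 k j z; exact: hM.
  apply: ge0_le_integral => //.
  + by move=> w _; rewrite lee_fin; apply: prodr_ge0 => j _; have /andP[] := h01 k j (B (s' j) w, A w (s' j)).
  + apply/measurable_EFinP; apply: measurable_prod => j _.
    apply: (measurableT_comp (mh k j)); apply: measurable_fun_pair => //; exact: mA.
  + exact/measurable_EFinP.
  + move=> w _; rewrite lee_fin (prodE k (fun j => (B (s' j) w, A w (s' j)))) /= s'n mulrC.
    under eq_bigr do rewrite s'j.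
    apply: ler_wpM2r; first by apply: (prod0 (fun j => B (s j) w)).
    by rewrite /pos mulNr; exact: ramp_le_pos.
- exact: cvg_cst.
Qed.

Let slope_A_ge e w r : r \in `[0, t] -> e <= 1 -> e <= 1 + c * A w t -> e <= 1 + c * A w r.
Proof.
rewrite in_itv/= => /andP[r0 rt] e1 D.
have [c0|c0] := leP 0 c; first by apply: (le_trans e1); rewrite lerDl mulr_ge0// A_ge0.
apply: le_trans D _; rewrite lerD2l ler_nM2l//.
by apply: (A_homo t_gt0 (bm_within bm (w := w))).
Qed.

(** S_(- c) is the inverse of S_c, and the densities are inverse to each other. *)
Let girsanov_inv z : 0 < slope (- c) z ->
  girsanov (- c) z * girsanov c (twist (- c) z) = 1.
Proof.
move=> s0; have sN : slope (- c) z != 0 by rewrite gt_eqF.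
have se : slope c (twist (- c) z) = (slope (- c) z)^-1.
  by move: sN; rewrite /twist /slope /= => sN; field.
rewrite /girsanov se /= [2 * (_ - _)]mulrBr expRB [expR (2 * ln _)]expRM_natl lnK ?posrE//.
set D := slope (- c) z in sN *; set E := expR (2 * z.1).
have -> : E / D ^+ 2 / D^-1 = E / D by field.
have -> : - c / 2 * (E / D - 1) = - (c / 2 * (E / D - 1)) by ring.
rewrite expRN invrK; set X := expR (_ * _).
have X0 : X != 0 by rewrite gt_eqF// expR_gt0.
by field; rewrite sN.
Qed.

(** The inequality for - c, applied to continuous bounded truncations of the
    integrand on the right-hand side; the densities cancel by [girsanov_inv].
    The truncation [m k] keeps the argument of the logarithm away from 0. *)
Let twist_ge :
  (\int[P]_w (pos (- c) w * \prod_(j < n) f j (B (s j) w))%:E <=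
   \int[P]_w (pos c w * girsanov c (B t w, A w t) *
     \prod_(j < n) f j (B (s j) w - ln (1 + c * A w (s j))))%:E)%E.
Proof.
pose m k (z : R * R) : R := Num.max (slope c z) k.+1%:R^-1.
have m0 k z : 0 < m k z by rewrite lt_max invr_gt0 ltr0n orbT.
pose gir k (z : R * R) := Num.min k.+1%:R (expR (c / 2 * (expR (2 * z.1) / m k z - 1)) / m k z).
have gir0' k z : 0 <= gir k z <= k.+1%:R.
  by rewrite /gir le_min ler0n ge_min lexx /= andbT divr_ge0 ?expR_ge0// ltW.
pose h k j (z : R * R) := if (j < n)%N then f j (z.1 - ln (m k z)) else
  ramp k (slope c z) * gir k z.
have h0 k j z : 0 <= h k j z <= k.+1%:R.
  rewrite /h; case: ifP => _.
    by have /andP[-> /le_trans ->] := f01 j (z.1 - ln (m k z)); rewrite ?ler1n.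
  have /andP[r0 r1] := ramp_itv k (slope c z); have /andP[g0 g1] := gir0' k z.
  by rewrite mulr_ge0//= -[leRHS]mul1r ler_pM.
have csl : continuous (slope c).
  move=> z; apply: cvgD; first exact: cvg_cst.
  by apply: cvgM; [exact: cvg_cst|exact: cvg_snd].
have cm k : continuous (m k).
  by apply: continuous_maxr => // z; exact: cvg_cst.
have ch k j : continuous (h k j).
  rewrite /h; case: (j < n)%N.
    move=> z; apply: (continuous_cvg _ (@cf j _)).
    apply: cvgB; first exact: cvg_fst.
    exact: (continuous_cvg _ (@continuous_ln R _ (m0 k z)) (cm k z)).
  have cg : continuous (gir k).
    apply: continuous_minr; first by move=> z; exact: cvg_cst.
    have cV z : (m k y)^-1 @[y --> z] --> (m k z)^-1.
      by apply: cvgV; [rewrite gt_eqF|exact: cm].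
    move=> z; apply: cvgM; last exact: cV.
    apply: (continuous_cvg _ (@continuous_expR R _)).
    apply: cvgM; first exact: cvg_cst.
    apply: cvgB; last exact: cvg_cst.
    apply: cvgM; last exact: cV.
    apply: (continuous_cvg _ (@continuous_expR R _)).
    by apply: cvgM; [exact: cvg_cst|exact: cvg_fst].
  move=> z; apply: cvgM; last exact: cg.
  exact: (continuous_cvg _ (@ramp_continuous R k _) (csl z)).
have mr k : measurable_fun setT (ramp k : R -> R).
  by apply: continuous_measurable_fun; exact: ramp_continuous.
have msl : measurable_fun setT (slope c) by rewrite /slope; meas.
have mm k : measurable_fun setT (m k) by apply: measurable_maxr => //; exact: measurable_cst.
have mg k : measurable_fun setT (gir k).
  by apply: measurable_minr; first exact: measurable_cst; have := mm k => hm; meas.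
have mh k j : measurable_fun setT (h k j).
  rewrite /h; case: (j < n)%N.
    by apply: (measurableT_comp (mf j)); have := mm k => hm; meas.
  by apply: measurable_funM => //; exact: (measurableT_comp (mr k)).
have prodE k (F : nat -> R * R) :
    \prod_(j < n.+1) h k j (F j) =
    \prod_(j < n) f j ((F j).1 - ln (m k (F j))) * (ramp k (slope c (F n)) * gir k (F n)).
  rewrite big_ord_recr /=; congr (_ * _); last by rewrite /h ltnn.
  by apply: eq_bigr => j _; rewrite /h ltn_ord.
have s'j (j : 'I_n) : s' j = s j by rewrite /s' ltn_ord.
have s'n : s' n = t by rewrite /s' ltnn.
pose L k w := pos (- c) w * girsanov (- c) (B t w, A w t) *
  \prod_(j < n.+1) h k j (twist (- c) (B (s' j) w, A w (s' j))).
have mL k : measurable_fun setT (L k).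
  apply: measurable_funM; first exact: measurable_funM.
  apply: measurable_prod => j _; apply: (measurableT_comp (mh k j)).
  have mBs : measurable_fun setT (B (s' j)) by [].
  by have mAs := mA (s't j); rewrite /twist /slope /=; meas.
apply: (@fatou_ae _ _ _ P (fun k w => (L k w)%:E) _
  (fun=> \int[P]_w (pos c w * girsanov c (B t w, A w t) *
     \prod_(j < n) f j (B (s j) w - ln (1 + c * A w (s j))))%:E)%E).
- by move=> k; exact/measurable_EFinP.
- exact/measurable_EFinP.
- move=> k w; rewrite lee_fin; apply: mulr_ge0 (gir0 _ _) _.
  by apply: prodr_ge0 => j _; have /andP[] := h0 k j (twist (- c) (B (s' j) w, A w (s' j))).
- by move=> w; rewrite lee_fin; apply: mulr_ge0 (ler0n _ _) (prod0 _).
- apply: aeW => w; apply: cvg_EFin; first exact: nearW.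
  rewrite -[fine \o _]/(fun k => L k w).
  apply: cvg_near_cst.
  have [D|D] := ltP 0 (1 + (- c) * A w t); last first.
    by apply: nearW => k; rewrite /L /pos ltNge D /= !mul0r.
  have Ds r : r \in `[0, t] -> 0 < slope (- c) (B r w, A w r).
    by move=> rt; exact: (slope_A_gt0 bm t_gt0 rt D).
  have Dt r : r \in `[0, t] -> slope c (twist (- c) (B r w, A w r)) = (slope (- c) (B r w, A w r))^-1.
    move=> /Ds; rewrite /twist /slope /= => hs; field; rewrite gt_eqF//.
  near=> k.
  have mE (j : 'I_n.+1) : m k (twist (- c) (B (s' j) w, A w (s' j))) =
      (slope (- c) (B (s' j) w, A w (s' j)))^-1.
    rewrite /m Dt//; apply/max_idPl; move: j; near: k.
    apply: filter_forall => j; apply: invn_near_le; rewrite invr_gt0; exact: Ds.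
  rewrite /L (prodE k (fun j => twist (- c) (B (s' j) w, A w (s' j)))).
  rewrite /pos D !mul1r s'n.
  have rE : ramp k (slope c (twist (- c) (B t w, A w t))) = 1.
    by near: k; apply: ramp_near1; rewrite Dt// invr_gt0; apply: (Ds _ tt).
  have gE : gir k (twist (- c) (B t w, A w t)) = girsanov c (twist (- c) (B t w, A w t)).
    have := mE ord_max; rewrite [s' _]s'n => mE'.
    rewrite /gir mE' -Dt// -/(girsanov c (twist (- c) (B t w, A w t))).
    apply/min_idPr; apply: (@le_trans _ _ k%:R); last by rewrite ler_nat.
    by near: k; exact: nbhs_infty_ger.
  rewrite rE gE mul1r mulrCA girsanov_inv ?mulr1; last by apply: (Ds _ tt).
  apply: eq_bigr => j _; have := mE (widen_ord (leqnSn n) j); rewrite /= s'j => ->.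
  by rewrite /= lnV ?posrE ?opprK ?subrK//; apply: (Ds _ (st j)).
- move=> k; apply: le_trans (twist_inequality bm t_gt0 n.+1 s't (ch k) (mh k) _ _ (- c)) _.
  + by move=> j z; have /andP[] := h0 k j z.
  + by move=> j z; have /andP[_ hM] := h0 k j z; exact: hM.
  apply: ge0_le_integral => //.
  + by move=> w _; rewrite lee_fin; apply: prodr_ge0 => j _; have /andP[] := h0 k j (B (s' j) w, A w (s' j)).
  + apply/measurable_EFinP; apply: measurable_prod => j _.
    apply: (measurableT_comp (mh k j)); apply: measurable_fun_pair => //; exact: mA.
  + exact/measurable_EFinP.
  + move=> w _; rewrite lee_fin (prodE k (fun j => (B (s' j) w, A w (s' j)))) /= s'n.
    have [->|/ramp_neq0 r0] := eqVneq (ramp k (slope c (B t w, A w t))) 0.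
      by rewrite mul0r mulr0; apply: mulr_ge0 (gir0 _ _) (prod0 _).
    have D : 0 < 1 + c * A w t by apply: lt_le_trans r0; rewrite invr_gt0.
    have mE r : r \in `[0, t] -> m k (B r w, A w r) = 1 + c * A w r.
      move=> rt; apply/max_idPl; apply: slope_A_ge => //.
      by rewrite invf_le1// ler1n.
    rewrite /pos D mul1r mulrC (eq_bigr (fun j : 'I_n => f j (B (s j) w - ln (1 + c * A w (s j))))); last first.
      by move=> j _; rewrite s'j mE.
    apply: ler_wpM2r; first exact: prod0.
    have /andP[r0' r1'] := ramp_itv k (slope c (B t w, A w t)).
    have /andP[g0 _] := gir0' k (B t w, A w t).
    rewrite -[leRHS]mul1r ler_pM//.
    by rewrite /gir mE// ge_min lexx orbT.
- exact: cvg_cst.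
Unshelve. all: by end_near. Qed.

Lemma twist_equality :
  (\int[P]_w ((((0 < 1 + c * A w t)%R)%:R * girsanov c (B t w, A w t) *
     \prod_(j < n) f j (B (s j) w - ln (1 + c * A w (s j))))%R)%:E =
   \int[P]_w ((((0 < 1 - c * A w t)%R)%:R * \prod_(j < n) f j (B (s j) w))%R)%:E)%E.
Proof.
have := twist_le; have := twist_ge; rewrite /pos => h1 h2.
by under [RHS]eq_integral do rewrite -mulNr; apply/eqP; rewrite eq_le h1 h2.
Qed.

End twist_equality.

(** * The flow T on the path space *)

Section tilt.
Context {R : realType} (t : R).
Hypothesis t_gt0 : 0 < t.
Local Notation I := (set_type (`[0, t] : set R)).

Lemma A_eq (f g : R -> R) s : s <= t -> (forall u, u \in `[0, t] -> f u = g u) ->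
  A_ f s = A_ g s.
Proof.
move=> st fg; apply: eq_Rintegral => u; rewrite inE/= in_itv/= => /andP[u0 us].
by rewrite fg// in_itv/= u0 (le_trans us).
Qed.

(** Both sides vanish at 0 and have the derivative e^(2 f) / (1 + c A)^2. *)
Lemma A_shift (c : R) (f g : R -> R) s : {within `[0, t], continuous f} ->
  {within `[0, t], continuous g} ->
  (forall u, u \in `[0, t] -> 0 < 1 + c * A_ f u) ->
  (forall u, u \in `[0, t] -> g u = f u - ln (1 + c * A_ f u)) ->
  s \in `[0, t] -> A_ g s = A_ f s / (1 + c * A_ f s).
Proof.
move=> cf cg D0 gE /[dup] st; rewrite in_itv/= => /andP[s0 slt].
have sub : `[0, s] `<=` `[(0 : R), t] by apply: subset_itvScc.
have cAf : {within `[0, t], continuous (A_ f)} by exact: (A_continuous (ltW t_gt0) cf).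
have cAg : {within `[0, t], continuous (A_ g)} by exact: (A_continuous (ltW t_gt0) cg).
pose h (x : R) := x / (1 + c * x).
have [||r _] := @MVT_segment R (fun u => A_ g u - h (A_ f u)) (fun=> 0) 0 s s0.
- move=> r; rewrite in_itv/= => /andP[r0 rs].
  have rt : r \in `]0, t[ by rewrite in_itv/= r0 (lt_le_trans rs).
  have rt' : r \in `[0, t] by apply: subset_itv_oo_cc.
  have dAf := is_derive_A t_gt0 cf rt; have dAg := is_derive_A t_gt0 cg rt.
  have Dr := D0 _ rt'; have Dn : 1 + c * A_ f r != 0 by rewrite gt_eqF.
  have dh : is_derive (A_ f r) (1 : R) h ((1 + c * A_ f r) ^- 2).
    have d1 : is_derive (A_ f r) (1 : R) (fun x => 1 + c * x) c.
      by apply: is_derive_eq; rewrite add0r mul1r -[LHS]/(c * 1) mulr1.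
    have d2 := @is_deriveV R (fun x => 1 + c * x) (A_ f r) c 1 Dn d1.
    have d3 := @is_deriveM R R id (fun x => (1 + c * x)^-1) (A_ f r) 1 1 _ (is_derive_id _ _) d2.
    apply: (@is_derive_eq _ _ _ _ _ _ _ _ d3).
    by rewrite /GRing.scale /=; field.
  have dc := @is_derive1_comp R h (A_ f) r _ _ dh dAf.
  have db := @is_deriveB R R R (A_ g) (h \o A_ f) r 1 _ _ dAg dc.
  apply: (@is_derive_eq _ _ _ _ _ _ _ _ db).
  rewrite gE// mulrBr expRB [expR (2 * ln _)]expRM_natl lnK ?posrE//.
  by rewrite mulrC subrr.
- apply: (continuous_subspaceW sub).
  have ch : {within `[0, t], continuous (h \o A_ f)}.
    apply: within_continuous_comp; last exact: cAf.
    move=> x; rewrite inE/= => -[u ut <-].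
    apply: cvgM; first exact: cvg_id.
    apply: cvgV; first by rewrite gt_eqF// D0.
    by apply: cvgD; [exact: cvg_cst|apply: cvgM; [exact: cvg_cst|exact: cvg_id]].
  by move=> x; exact: (cvgB (cAg x) (ch x)).
by rewrite mul0r !A0 /h mul0r subrr subr0 => /subr0_eq.
Qed.

Implicit Types phi : cpath t R.

Local Notation path phi := (cpath_ext phi).
Definition area phi : R := A_ (path phi) t.
Definition endpoint phi : R := path phi t.

Lemma path_cont phi : {within `[0, t], continuous (path phi)}.
Proof. exact: cpath_ext_continuous. Qed.

Lemma area_gt0 phi : 0 < area phi.
Proof. by apply: (A_gt0 t_gt0) => //; exact: path_cont. Qed.

Lemma cpathP (phi psi : cpath t R) :
  (forall s, s \in `[0, t] -> path phi s = path psi s) -> phi = psi.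
Proof.
move=> e; apply/continuousEP => s.
by rewrite -!cpath_extE e//; exact: time_ofE.
Qed.

(** The [c] for which T_z is S_c at the path [phi]. *)
Definition tilt z phi : R := (expR z - 1) / area phi.

Lemma path_T z phi s : s \in `[0, t] ->
  path (T_ z phi) s = path phi s - ln (1 + tilt z phi * A_ (path phi) s).
Proof.
move=> st; rewrite -(val_time_of st) [LHS]cpath_extE /T_ /= cpath_extE.
by rewrite /tilt -mulrA [_^-1 * _]mulrC [(_ - 1) * _]mulrC.
Qed.

Lemma tilt_area z phi : 1 + tilt z phi * area phi = expR z.
Proof. by rewrite /tilt divfK ?gt_eqF ?area_gt0// addrC subrK. Qed.

Lemma tilt_gt0 z phi s : s \in `[0, t] -> 0 < 1 + tilt z phi * A_ (path phi) s.
Proof.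
rewrite in_itv/= => /andP[s0 st].
have As : 0 <= A_ (path phi) s by exact: A_ge0.
have [c0|c0] := leP 0 (tilt z phi); first by rewrite ltr_pwDl// mulr_ge0.
apply: lt_le_trans (expR_gt0 z) _; rewrite -(tilt_area z phi) lerD2l ler_nM2l//.
by apply: (A_homo t_gt0) => //; exact: path_cont.
Qed.

Lemma A_T z phi s : s \in `[0, t] ->
  A_ (path (T_ z phi)) s = A_ (path phi) s / (1 + tilt z phi * A_ (path phi) s).
Proof.
apply: A_shift; [exact: path_cont|exact: path_cont|exact: tilt_gt0|exact: path_T].
Qed.

Let tt : t \in `[0, t]. Proof. by rewrite in_itv/= lexx ltW. Qed.

Lemma area_T z phi : area (T_ z phi) = area phi * expR (- z).
Proof. by rewrite /area A_T// -/(area phi) tilt_area expRN. Qed.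

Lemma endpoint_T z phi : endpoint (T_ z phi) = endpoint phi - z.
Proof. by rewrite /endpoint path_T// -/(area phi) tilt_area expRK. Qed.

(** The slope factors 1 + c A of successive maps multiply. *)
Lemma T_T z z' phi : T_ z' (T_ z phi) = T_ (z + z') phi.
Proof.
apply: cpathP => s st.
rewrite (path_T z' (T_ z phi) st) (path_T z phi st) (path_T (z + z') phi st) (A_T z phi st).
have a0 := area_gt0 phi; have d0 := tilt_gt0 z phi st.
have d1 := tilt_gt0 z' (T_ z phi) st; rewrite (A_T z phi st) in d1.
rewrite -addrA -opprD -lnM ?posrE//; congr (_ - ln _).
have -> : tilt z' (T_ z phi) = expR z * (expR z' - 1) / area phi.
  rewrite /tilt area_T expRN; field; rewrite !gt_eqF ?expR_gt0//.
have -> : tilt (z + z') phi = tilt z phi + expR z * (expR z' - 1) / area phi.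
  by rewrite /tilt expRD -mulrDl; congr (_ / _); ring.
by field; rewrite !gt_eqF.
Qed.

Lemma T_0 phi : T_ 0 phi = phi.
Proof.
apply: cpathP => s st; rewrite path_T// /tilt expR0 subrr !mul0r addr0 ln1.
exact: subr0.
Qed.

Lemma Z_T z phi : Z_ (path (T_ z phi)) t = Z_ (path phi) t.
Proof.
rewrite /Z_ -/(endpoint _) -/(area _) endpoint_T area_T -/(endpoint _) -/(area _).
by rewrite opprB expRB !expRN; field; rewrite !gt_eqF ?expR_gt0.
Qed.

(** The point ending at [xi] of the orbit of [phi] under the flow T. *)
Definition steer phi xi : cpath t R := T_ (endpoint phi - xi) phi.

Lemma endpoint_steer phi xi : endpoint (steer phi xi) = xi.
Proof. by rewrite /steer endpoint_T subKr. Qed.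

Lemma steer_endpoint phi : steer phi (endpoint phi) = phi.
Proof. by rewrite /steer subrr T_0. Qed.

Lemma steer_steer phi xi eta : steer (steer phi xi) eta = steer phi eta.
Proof. by rewrite /steer T_T endpoint_T subKr addrA subrK. Qed.

Lemma profileE (h : cpath t R -> R) phi : profile h phi = h \o steer phi.
Proof. by []. Qed.

Lemma profile_steer (h : cpath t R -> R) phi xi :
  profile h (steer phi xi) = profile h phi.
Proof. by rewrite !profileE; apply/funext => eta /=; rewrite steer_steer. Qed.

End tilt.

(** * Quasi-invariance of the Brownian law *)

Section measurable_functionals.
Context {R : realType} (t : R).
Hypothesis t_gt0 : 0 < t.
Local Notation I := (set_type (`[0, t] : set R)).
Local Notation C := (cpath t R).
Implicit Types phi : C.

Lemma measurable_path s : s \in `[0, t] -> measurable_fun setT (fun phi : C => cpath_ext phi s).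
Proof.
move=> st; rewrite (_ : (fun phi : C => _) = fun phi => phi (time_of st)).
  exact: measurable_eval.
by apply/funext => phi; rewrite -cpath_extE.
Qed.

Lemma measurable_path_A s : s \in `[0, t] ->
  measurable_fun setT (fun phi : C => A_ (cpath_ext phi) s).
Proof.
move=> st; apply: (measurable_A_family t_gt0) => //; last exact: measurable_path.
by move=> phi; exact: path_cont.
Qed.

Let tt : t \in `[0, t]. Proof. by rewrite in_itv/= lexx ltW. Qed.

Lemma measurable_endpoint : measurable_fun setT (@endpoint R t).
Proof. exact: measurable_path. Qed.

Lemma measurable_area : measurable_fun setT (@area R t).
Proof. exact: measurable_path_A. Qed.

Lemma measurable_T d (T : measurableType d) (z : T -> R) (phi : T -> C) :
  measurable_fun setT z -> measurable_fun setT phi ->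
  measurable_fun setT (fun x => T_ (z x) (phi x)).
Proof.
move=> mz mphi; apply: (measurable_to_cpath t_gt0) => s.
rewrite (_ : (fun x => _) = fun x => cpath_ext (phi x) (set_val s) -
    ln (1 + tilt (z x) (phi x) * A_ (cpath_ext (phi x)) (set_val s))); last first.
  by apply/funext => x; rewrite -path_T ?cpath_extE//; exact: time_ofE.
have mp := measurableT_comp (measurable_path (time_ofE s)) mphi.
have mA := measurableT_comp (measurable_path_A (time_ofE s)) mphi.
have ma := measurableT_comp measurable_area mphi.
by rewrite /tilt; meas.
Qed.

Lemma measurable_steer d (T : measurableType d) (xi : T -> R) (phi : T -> C) :
  measurable_fun setT xi -> measurable_fun setT phi ->
  measurable_fun setT (fun x => steer (phi x) (xi x)).
Proof.
move=> mxi mphi; apply: measurable_T => //.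
have me := measurableT_comp measurable_endpoint mphi.
exact: measurable_funB.
Qed.

(** The map S_c. *)
Definition area_shift (c : R) (phi : C) : C := T_ (ln (1 + c * area phi)) phi.

Lemma tilt_area_shift c phi : 0 < 1 + c * area phi -> tilt (ln (1 + c * area phi)) phi = c.
Proof.
move=> D0; rewrite /tilt lnK ?posrE// addrC addKr mulfK// gt_eqF//.
exact: area_gt0.
Qed.

Lemma path_area_shift c phi s : 0 < 1 + c * area phi -> s \in `[0, t] ->
  cpath_ext (area_shift c phi) s = cpath_ext phi s - ln (1 + c * A_ (cpath_ext phi) s).
Proof. by move=> D0 st; rewrite path_T// tilt_area_shift. Qed.

Lemma measurable_area_shift d (T : measurableType d) (c : T -> R) (phi : T -> C) :
  measurable_fun setT c -> measurable_fun setT phi ->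
  measurable_fun setT (fun x => area_shift (c x) (phi x)).
Proof.
move=> mc mphi; apply: measurable_T => //.
by have ma := measurableT_comp measurable_area mphi; meas.
Qed.

Definition shift_density (c : R) (phi : C) : R :=
  ((0 < 1 + c * area phi)%R)%:R * girsanov c (endpoint phi, area phi).

Lemma shift_density_ge0 c phi : 0 <= shift_density c phi.
Proof.
rewrite /shift_density; have [D|_] := ltP 0 (1 + c * area phi); last by rewrite mul0r.
by rewrite mul1r /girsanov divr_ge0 ?expR_ge0// ltW.
Qed.

Lemma measurable_shift_density d (T : measurableType d) (c : T -> R) (phi : T -> C) :
  measurable_fun setT c -> measurable_fun setT phi ->
  measurable_fun setT (fun x => shift_density (c x) (phi x)).
Proof.
move=> mc mphi; have ma := measurableT_comp measurable_area mphi.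
have me := measurableT_comp measurable_endpoint mphi.
by rewrite /shift_density /girsanov /slope /=; meas.
Qed.

End measurable_functionals.

Section invariance.
Context d (Omega : measurableType d) (R : realType) (P : probability Omega R)
  (B : R -> {RV P >-> R}) (bm : brownian_motion B) (t : R).
Hypothesis t_gt0 : 0 < t.
Local Notation I := (set_type (`[0, t] : set R)).
Local Notation C := (cpath t R).
Local Notation X := (bm_path bm t).

Lemma path_bm w s : s \in `[0, t] -> cpath_ext (X w) s = B s w.
Proof. by move=> st; rewrite -(val_time_of st) cpath_extE. Qed.

Lemma A_bm w s : s <= t -> A_ (cpath_ext (X w)) s = A_ (fun r => B r w) s.
Proof. by move=> st; apply: (A_eq st) => u; exact: path_bm. Qed.

Lemma measurable_bm_path : measurable_fun setT X.
Proof. by apply: (measurable_to_cpath t_gt0) => s. Qed.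

Let tt : t \in `[0, t]. Proof. by rewrite in_itv/= lexx ltW. Qed.

(** Both sides define finite measures on the path space.  They agree on products
    of functions of the values at finitely many times, by [twist_equality]; the
    empty product compares the total masses. *)
Lemma shift_invariance c (H : C -> \bar R) : measurable_fun setT H ->
  (forall phi, 0 <= H phi)%E ->
  (\int[P]_w (H (area_shift c (X w)) * (shift_density c (X w))%:E) =
   \int[P]_w (H (X w) * (((0 < 1 - c * area (X w))%R)%:R : R)%:E))%E.
Proof.
move=> mH H0; have mX := measurable_bm_path.
have mS : measurable_fun setT (fun w => area_shift c (X w)).
  by apply: measurable_area_shift => //; exact: measurable_cst.
have mD : measurable_fun setT (fun w => shift_density c (X w)).
  by apply: measurable_shift_density => //; exact: measurable_cst.
pose pos w : R := ((0 < 1 - c * area (X w))%R)%:R.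
have mpos : measurable_fun setT pos.
  by rewrite /pos; have ma := measurableT_comp (measurable_area t_gt0) mX; meas.
have pos0 w : 0 <= pos w by rewrite /pos.
have [m1 [_ i1]] := density_measure P (fun w => shift_density_ge0 c (X w)) mD.
have [m2 [_ i2]] := density_measure P pos0 mpos.
have [n1 [e1 j1]] := pushforward_measure m1 mS.
have [n2 [e2 j2]] := pushforward_measure m2 mX.
have k1 G : measurable_fun setT G -> (forall phi : C, 0 <= G phi)%E ->
    (\int[n1]_phi G phi = \int[P]_w (G (area_shift c (X w)) * (shift_density c (X w))%:E))%E.
  move=> mG G0; rewrite j1// i1//; exact: (measurableT_comp mG mS).
have k2 G : measurable_fun setT G -> (forall phi : C, 0 <= G phi)%E ->
    (\int[n2]_phi G phi = \int[P]_w (G (X w) * (pos w)%:E))%E.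
  move=> mG G0; rewrite j2// i2//; exact: (measurableT_comp mG mX).
have cyl n (s : nat -> I) (f : nat -> R -> R) :
    (forall j, continuous (f j)) -> (forall j x, 0 <= f j x <= 1) ->
    (\int[n1]_phi (\prod_(j < n) f j (phi (s j)))%R%:E =
     \int[n2]_phi (\prod_(j < n) f j (phi (s j)))%R%:E)%E.
  move=> cf f01.
  have mP : measurable_fun setT (fun phi : C => (\prod_(j < n) f j (phi (s j)))%:E).
    apply/measurable_EFinP; apply: measurable_prod => j _.
    apply: (@measurableT_comp _ _ _ _ _ _ (f j)); last exact: measurable_eval.
    by apply: continuous_measurable_fun.
  have P0 (phi : C) : (0 <= (\prod_(j < n) f j (phi (s j)))%:E)%E.
    by rewrite lee_fin; apply: prodr_ge0 => j _; have /andP[] := f01 j (phi (s j)).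
  rewrite k1// k2//.
  have sI j : set_val (s j) \in `[0, t] by exact: time_ofE.
  pose u j : R := set_val (s j).
  transitivity (\int[P]_w ((((0 < 1 + c * A_ (fun r => B r w) t)%R)%:R *
     girsanov c (B t w, A_ (fun r => B r w) t) * \prod_(j < n) f j (B (u j) w
       - ln (1 + c * A_ (fun r => B r w) (u j))))%R)%:E)%E.
    apply: eq_integral => w _; rewrite -EFinM; congr EFin; rewrite mulrC.
    rewrite /shift_density /endpoint path_bm// /area A_bm//.
    have [D|_] := ltP; last by rewrite !mul0r.
    congr (_ * _); apply: eq_bigr => j _; congr (f j _).
    have D' : 0 < 1 + c * area (X w) by rewrite /area A_bm.
    rewrite -[LHS]cpath_extE (path_area_shift t_gt0 D' (sI j)).
    have := time_ofE (s j); rewrite in_itv/= => /andP[_ sj].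
    by rewrite (path_bm w (sI j)) (A_bm w sj).
  rewrite (@twist_equality _ _ _ _ _ bm t t_gt0 c n u f sI cf f01).
  apply: eq_integral => w _; rewrite -EFinM; congr EFin; rewrite mulrC /pos /area A_bm//.
have tot (m : {measure set C -> \bar R}) : m setT = (\int[m]_phi (cst 1 phi))%E.
  by rewrite integral_cst// mul1e.
have n2T : (n2 setT < +oo)%E.
  rewrite tot (k2 (cst 1%E)) ?lee01//.
  apply: (@le_lt_trans _ _ (\int[P]_w 1)%E); last first.
    by rewrite integral_cst// mul1e (le_lt_trans (probability_le1 P measurableT)) ?ltry.
  apply: ge0_le_integral => //.
  - by move=> w _; rewrite mul1e lee_fin.
  - by apply/measurable_EFinP; under eq_fun do rewrite mul1r.
  - by move=> w _; rewrite mul1e lee_fin /pos; case: ltP; rewrite ?ler01.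
have n12T : n1 setT = n2 setT.
  rewrite !tot.
  transitivity (\int[n1]_phi (\prod_(j < 0) cst (0 : R) (phi (time_of tt)))%R%:E)%E.
    by apply: eq_integral => phi _; rewrite big_ord0.
  rewrite (cyl 0%N (fun=> time_of tt) (fun=> cst 0)).
  - by apply: eq_integral => phi _; rewrite big_ord0.
  - by move=> _ x; exact: cvg_cst.
  - by move=> _ x; rewrite /= lexx ler01.
have n12 A : measurable A -> n1 A = n2 A.
  by apply: (cylinder_unique t_gt0) => //; rewrite n12T.
rewrite -k1// -[RHS]k2//; apply: eq_measure_integral => A mA _; exact: n12.
Qed.

End invariance.

(** * Disintegration of the Brownian law along the orbits of T *)

Section disintegration.
Context {R : realType}.
Local Notation mu := (@lebesgue_measure R).

Lemma is_derive_class_C1 (f df : R -> R) :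
  (forall x, is_derive x (1 : R) f (df x)) -> continuous df ->
  class_C1 f /\ derive1 f = df.
Proof.
move=> h cdf; have e : derive1 f = df.
  by apply/funext => x; rewrite derive1E; exact: derive_val.
by split=> //; split; [move=> x; exact: ex_derive|rewrite e].
Qed.

(** The exponential density of [b - c]. *)
Lemma integral_expR_below (b : R) :
  (\int[mu]_c ((((0 < b - c)%R)%:R * expR (c - b))%R)%:E = 1)%E.
Proof.
pose g (y : R) : \bar R := (((0 < y)%R%:R * expR (- y))%R)%:E.
have mg : measurable_fun setT g by apply/measurable_EFinP; meas.
have g0 y : (0 <= g y)%E by rewrite lee_fin mulr_ge0 ?expR_ge0.
pose f (c : R) := b - c.
have [C1f f'] : class_C1 f /\ derive1 f = cst (-1).
  apply: is_derive_class_C1; last by move=> x; exact: cvg_cst.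
  by move=> x; apply: is_derive_eq; rewrite add0r mul1r.
have mono : strictly_monotone f by right => x y xy; rewrite /f ltrD2l ltrN2.
transitivity (\int[mu]_c (g (f c) * `|derive1 f c|%:E))%E.
  by apply: eq_integral => c _; rewrite f' /= normrN1 mule1 /g /f opprB.
rewrite substitution// (_ : range f = setT); last first.
  by rewrite -subTset => y _; exists (b - y) => //; rewrite /f subKr.
pose pos : set R := `]0, +oo[%classic.
transitivity (\int[mu]_(y in pos) (exponential_pdf 1 y)%:E)%E.
  rewrite [RHS]integral_mkcond; apply: eq_integral => y _; rewrite patchE /g.
  rewrite mem_setE in_itv/= andbT; case: ltP => y0; last by rewrite mul0r.
  by rewrite exponential_pdfE ?ltW// !mul1r mulN1r.
rewrite /pos integral_itv_obnd_cbnd; last first.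
  by apply/measurable_EFinP; apply: measurable_funTS; exact: measurable_exponential_pdf.
rewrite -[RHS](integral_exponential_pdf (@ltr01 R)) integral_mkcond.
apply: eq_integral => y _; rewrite patchE; case: ifPn => // h.
by rewrite lt0_exponential_pdf// ltNge; apply: contra h => h; rewrite inE/= in_itv/= h.
Qed.

Variable t : R.
Hypothesis t_gt0 : 0 < t.
Local Notation C := (cpath t R).
Implicit Types phi : C.
Local Notation Z phi := (Z_ (cpath_ext phi) t).

(** The factor of the disintegration that does not involve the end point [xi].
    The first term comes from the auxiliary exponential density. *)
Definition end_density phi : R :=
  expR (- (area phi)^-1) / area phi * expR (cosh (endpoint phi) / Z phi).

(** Substitution c = (e^(phi_t - xi) - 1) / A_t, for which
    1 + c A_t = e^(phi_t - xi).  Its range is the domain 1 + c A_t > 0.  The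
    exponent of the density becomes (cosh phi_t - cosh xi) / Z_t because
    1 / Z_t = e^(phi_t) / A_t. *)
Lemma area_shift_integral phi (K : C -> \bar R) : measurable_fun setT K ->
  (forall psi, 0 <= K psi)%E ->
  (\int[mu]_c (K (area_shift c phi) *
     (expR (c - (area (area_shift c phi))^-1) * shift_density c phi)%:E) =
   (end_density phi)%:E *
     \int[mu]_xi (K (steer phi xi) * (expR (- (cosh xi / Z phi)))%:E))%E.
Proof.
move=> mK K0; set a := area phi; set e := endpoint phi.
have a0 : 0 < a := area_gt0 t_gt0 phi.
have an : a != 0 by rewrite gt_eqF.
have mphi d (T : measurableType d) : measurable_fun setT (fun _ : T => phi).
  exact: measurable_cst.
pose g c : \bar R := (K (area_shift c phi) *
  (expR (c - (area (area_shift c phi))^-1) * shift_density c phi)%:E)%E.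
have mg : measurable_fun (setT : set R) g.
  have mS : measurable_fun (setT : set R) (fun c => area_shift c phi).
    by apply: measurable_area_shift => //; exact: measurable_id.
  apply: emeasurable_funM; first exact: (measurableT_comp mK mS).
  apply/measurable_EFinP; apply: measurable_funM.
    by have ma := measurableT_comp (measurable_area t_gt0) mS; meas.
  by apply: measurable_shift_density => //; exact: measurable_id.
have g0 c : (0 <= g c)%E.
  by rewrite mule_ge0// lee_fin mulr_ge0 ?expR_ge0// shift_density_ge0.
pose f xi := (expR (e - xi) - 1) / a.
have f1 xi : 1 + f xi * a = expR (e - xi) by rewrite /f divfK// addrC subrK.
have [C1f f'] : class_C1 f /\ derive1 f = fun xi => - (expR (e - xi) / a).
  apply: is_derive_class_C1.
    move=> x; apply: is_derive_eq.
    by rewrite /GRing.scale /=; field.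
  move=> x; apply: cvgN; apply: cvgM; last exact: cvg_cst.
  apply: (continuous_cvg _ (@continuous_expR R _)).
  by apply: cvgB; [exact: cvg_cst|exact: cvg_id].
have mono : strictly_monotone f.
  by right => x y xy; rewrite /f ltr_pM2r ?invr_gt0// ltrD2r ltr_expR ltrD2l ltrN2.
have -> : (\int[mu]_c g c = \int[mu]_(c in range f) g c)%E.
  rewrite [RHS]integral_mkcond; apply: eq_integral => c _; rewrite patchE.
  case: ifPn => // cf; rewrite /g /shift_density.
  have [D|_] := ltP 0 (1 + c * area phi); last by rewrite mul0r mulr0 mule0.
  move: cf; rewrite notin_setE => -[]; exists (e - ln (1 + c * area phi)) => //.
  by rewrite /f subKr lnK ?posrE// addrC addKr mulfK.
rewrite -substitution// -ge0_integralZl//; last 3 first.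
- apply: emeasurable_funM.
    apply: (measurableT_comp mK); apply: measurable_steer => //; exact: measurable_id.
  by apply/measurable_EFinP; rewrite /cosh; meas.
- by move=> xi _; rewrite mule_ge0// lee_fin expR_ge0.
- by rewrite lee_fin /end_density mulr_ge0 ?divr_ge0 ?expR_ge0// ltW.
apply: eq_integral => xi _.
have SE : area_shift (f xi) phi = steer phi xi by rewrite /area_shift f1 expRK.
rewrite /g SE -muleA [RHS]muleCA; congr (_ * _)%E.
rewrite -!EFinM; congr EFin.
rewrite /shift_density f1 expR_gt0 mul1r /girsanov /slope /= f1.
rewrite f' normrN gtr0_norm; last by rewrite divr_gt0// expR_gt0.
have Ef := expR_gt0 (e - xi); have En : expR (e - xi) != 0 by rewrite gt_eqF.
have -> : f xi - (area (steer phi xi))^-1 = - a^-1.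
  rewrite /steer area_T// -/a expRN invfM invrK /f -/e; by field.
rewrite -/e -/a /end_density -/a -/e.
rewrite -[X in _ = X]mulrA -expRD.
have -> : expR (2 * e) / expR (e - xi) = expR (e + xi) by rewrite -expRB; congr expR; ring.
have -> : cosh e / Z phi + - (cosh xi / Z phi) = f xi / 2 * (expR (e + xi) - 1).
  rewrite /Z_ -/(area phi) -/(endpoint phi) -/a -/e /f /cosh.
  rewrite expRB !expRD !expRN; field; rewrite !gt_eqF ?expR_gt0//.
by field; rewrite an En.
Qed.

End disintegration.

Section brownian_disintegration.
Context d (Omega : measurableType d) (R : realType) (P : probability Omega R)
  (B : R -> {RV P >-> R}) (bm : brownian_motion B) (t : R).
Hypothesis t_gt0 : 0 < t.
Local Notation C := (cpath t R).
Local Notation X := (bm_path bm t).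
Local Notation mu := (@lebesgue_measure R).

(** [K] is multiplied by the density e^(c - 1 / A_t) of a parameter [c], which is
    then moved by [shift_invariance] for each fixed [c]. *)
Lemma brownian_disintegration (K : C -> \bar R) : measurable_fun setT K ->
  (forall phi, 0 <= K phi)%E ->
  (\int[P]_w K (X w) = \int[P]_w ((end_density (X w))%:E *
     \int[mu]_xi (K (steer (X w) xi) *
       (expR (- (cosh xi / Z_ (cpath_ext (X w)) t)))%:E)))%E.
Proof.
move=> mK K0; have mX := measurable_bm_path bm t_gt0.
have mX1 : measurable_fun setT (fun x : Omega * R => X x.1).
  exact: (measurableT_comp mX (@measurable_fst _ _ _ _)).
pose F (x : Omega * R) : \bar R := (K (X x.1) *
  ((((0 < 1 - x.2 * area (X x.1))%R)%:R * expR (x.2 - (area (X x.1))^-1))%R)%:E)%E.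
pose G (x : Omega * R) : \bar R := (K (area_shift x.2 (X x.1)) *
   (expR (x.2 - (area (area_shift x.2 (X x.1)))^-1) * shift_density x.2 (X x.1))%:E)%E.
have mF : measurable_fun setT F.
  apply: emeasurable_funM; first exact: (measurableT_comp mK mX1).
  by apply/measurable_EFinP; have ma := measurableT_comp (measurable_area t_gt0) mX1; meas.
have mG : measurable_fun setT G.
  have mS : measurable_fun setT (fun x : Omega * R => area_shift x.2 (X x.1)).
    by apply: measurable_area_shift.
  apply: emeasurable_funM; first exact: (measurableT_comp mK mS).
  apply/measurable_EFinP; apply: measurable_funM.
    by have ma := measurableT_comp (measurable_area t_gt0) mS; meas.
  exact: (measurable_shift_density t_gt0 (@measurable_snd _ _ _ _) mX1).
have F0 x : (0 <= F x)%E by rewrite mule_ge0// lee_fin mulr_ge0 ?expR_ge0.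
have G0 x : (0 <= G x)%E.
  by rewrite mule_ge0// lee_fin mulr_ge0 ?expR_ge0// shift_density_ge0.
transitivity (\int[P]_w \int[mu]_c F (w, c))%E.
  apply: eq_integral => w _; rewrite /F /=.
  rewrite ge0_integralZl//; last first.
  - by apply/measurable_EFinP; meas.
  rewrite -[LHS]mule1 -(integral_expR_below (area (X w))^-1); congr (_ * _)%E.
  apply: eq_integral => c _; congr (((_ : bool)%:R * _)%:E).
  have a0 := area_gt0 t_gt0 (X w).
  by rewrite !subr_gt0 -ltr_pdivlMr// mul1r.
transitivity (\int[mu]_c \int[P]_w F (w, c))%E.
  exact: (@fubini_tonelli _ _ Omega (measurableTypeR R) R P mu F mF F0).
transitivity (\int[mu]_c \int[P]_w G (w, c))%E.
  apply: eq_integral => c _.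
  pose H phi : \bar R := (K phi * (expR (c - (area phi)^-1))%:E)%E.
  have mH : measurable_fun setT H.
    apply: emeasurable_funM => //; apply/measurable_EFinP.
    by have ma := measurable_area t_gt0; meas.
  have H0 phi : (0 <= H phi)%E by rewrite mule_ge0// lee_fin expR_ge0.
  transitivity (\int[P]_w (H (X w) * (((0 < 1 - c * area (X w))%R)%:R : R)%:E))%E.
    by apply: eq_integral => w _; rewrite /F /H /= -muleA -EFinM mulrC.
  rewrite -shift_invariance//; apply: eq_integral => w _.
  by rewrite /G /H /= -muleA -EFinM.
transitivity (\int[P]_w \int[mu]_c G (w, c))%E.
  exact/esym/(@fubini_tonelli _ _ Omega (measurableTypeR R) R P mu G mG G0).
apply: eq_integral => w _.
rewrite /G /=; exact: (area_shift_integral t_gt0 (X w) mK K0).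
Qed.

End brownian_disintegration.

(** * Measurability of inverses and derivatives of families of monotone functions *)

Section inverse.
Context {R : realType}.

Lemma strictly_monotone_inj (f : R -> R) : strictly_monotone f -> injective f.
Proof.
by case=> hf x y e; case: (ltgtP x y) => // /hf; rewrite e ltxx.
Qed.

Lemma inverseK (f : R -> R) : strictly_monotone f -> cancel f (inverse f).
Proof.
move=> hf x; apply: pinvKV; rewrite ?inE// => y z _ _.
exact: strictly_monotone_inj.
Qed.

(** By continuity, the range is the union of the intervals between its
    values at - n and n, which increase by monotonicity. *)
Lemma range_straddle (f : R -> R) y : continuous f -> strictly_monotone f ->
  range f y <-> exists n : nat, (f (- n%:R) <= y <= f n%:R) || (f n%:R <= y <= f (- n%:R)).
Proof.
move=> cf hf; split=> [[x _ <-]|[n /orP[]h]]; last 2 first.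
- by apply: (continuous_range_interval cf _ _ h); [exists (- n%:R)|exists n%:R].
- by apply: (continuous_range_interval cf _ _ h); [exists n%:R|exists (- n%:R)].
exists (Num.truncn `|x|).+1; set n := _.+1.
have : `|x| < n%:R by exact: truncnS_gt.
rewrite ltr_norml => /andP[h1 h2].
by case: hf => hf; rewrite (ltW (hf _ _ h1)) (ltW (hf _ _ h2)) ?orbT.
Qed.

Section family.
Context d (T : measurableType d) (f : T -> R -> R).
Hypothesis mf : forall u : T -> R, measurable_fun setT u ->
  measurable_fun setT (fun x => f x (u x)).

(** The derivative is the limit of the difference quotients of steps 1 / (n + 1). *)
Lemma measurable_derive1 (u : T -> R) :
  (forall x y, derivable (f x) y 1) -> measurable_fun setT u ->
  measurable_fun setT (fun x => derive1 (f x) (u x)).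
Proof.
move=> df mu; pose e (n : nat) : R := n.+1%:R^-1.
apply: (measurable_fun_cvg (h := fun n x => (e n)^-1 * (f x (e n + u x) - f x (u x)))).
  move=> n; apply: measurable_funM => //; apply: measurable_funB; last exact: mf.
  by apply: mf; apply: measurable_funD.
move=> x _.
have e0 : e n @[n --> \oo] --> 0^'.
  move=> A [r /= r0 rA]; rewrite /nbhs/=.
  have /cvgrPdist_lt/(_ _ r0) : e n @[n --> \oo] --> (0 : R) by exact: cvg_harmonic.
  apply: filterS => n hn; apply: rA => //.
  by rewrite /e invr_eq0 pnatr_eq0.
pose q h := h^-1 *: ((f x (h + u x) : R^o) - f x (u x)).
have dx : q h @[h --> 0^'] --> derive1 (f x) (u x).
  have := df x (u x); rewrite /derivable /derive1 (_ : (fun h : R => _) = q)//.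
  by apply/funext => h; rewrite /q /= [h *: _]mulr1.
exact: (cvg_comp _ q e0 dx).
Qed.

Hypothesis cf : forall x, continuous (f x).
Hypothesis hf : forall x, strictly_monotone (f x).

Lemma measurable_bool_set (b : T -> bool) : measurable_fun setT b -> measurable [set x | b x].
Proof.
move=> mb; rewrite (_ : [set x | b x] = setT `&` b @^-1` [set true]).
  exact: mb.
by rewrite setTI; apply/seteqP; split.
Qed.

Lemma measurable_in_range (u : T -> R) : measurable_fun setT u ->
  measurable [set x | range (f x) (u x)].
Proof.
move=> mu; rewrite (_ : [set x | _] = \bigcup_n [set x |
    (f x (- n%:R) <= u x <= f x n%:R) || (f x n%:R <= u x <= f x (- n%:R))]).
  apply: bigcupT_measurable => n; apply: measurable_bool_set.
  by apply: measurable_or; apply: measurable_and; apply: measurable_fun_ler => //; exact: mf.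
apply/seteqP; split=> x /=.
  by move=> /(range_straddle _ (@cf x) (@hf x))[n hn]; exists n.
by move=> [n _ hn]; apply/(range_straddle _ (@cf x) (@hf x)); exists n.
Qed.

(** For an increasing [f], the inverse exceeds [a] where [u] exceeds [f a]; the
    comparison of [f 0] and [f 1] tells the direction of monotonicity. *)
Lemma measurable_inverse (u : T -> R) : measurable_fun setT u ->
  measurable_fun setT (fun x => inverse (f x) (u x) * \1_(range (f x)) (u x)).
Proof.
move=> mu; apply: (measurability _ (RGenOInfty.measurableE R)) => _ [_ [a ->] <-].
rewrite setTI.
have mc (c : R) : measurable_fun setT (fun x => f x c) by apply: mf.
pose above := [set x | ((f x 0 < f x 1) && (f x a < u x)) || ((f x 1 < f x 0) && (u x < f x a))].
have mabove : measurable above.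
  by apply: measurable_bool_set; apply: measurable_or; apply: measurable_and;
    apply: measurable_fun_ltr.
have mr := measurable_in_range mu.
rewrite (_ : _ @^-1` _ = ([set x | range (f x) (u x)] `&` above) `|`
    (~` [set x | range (f x) (u x)] `&` (if a < 0 then setT else set0))).
  apply: measurableU; first exact: measurableI.
  by apply: measurableI; [exact: measurableC|case: ifP].
have key x y : (a < y) = ((f x 0 < f x 1) && (f x a < f x y)) || ((f x 1 < f x 0) && (f x y < f x a)).
  case: (hf x) => h.
    have m : {mono f x : y z / y < z} by apply: leW_mono; apply: le_mono.
    by rewrite !m ltr01 ltr10 orbF.
  have m : {mono f x : y z /~ y < z} by apply: leW_nmono; apply: le_nmono.
  by rewrite !m ltr01 ltr10.
apply/seteqP; split=> x /=; rewrite in_itv/= andbT.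
  have [[y _ yu]|nr] := pselect (range (f x) (u x)).
    rewrite -yu inverseK// indicE mem_set; last by exists y.
    by rewrite mulr1 => h; left; split; [exists y|rewrite /above /= -yu -key].
  by rewrite indicE memNset// mulr0 => h; right; split => //; rewrite h.
move=> [[[y _ yu]]|[nr]].
  rewrite /above /= -yu -key inverseK// indicE mem_set ?mulr1//; by exists y.
by rewrite indicE memNset// mulr0; case: ifP.
Qed.

End family.

End inverse.

(** * The two sides as integrals along an orbit *)

Section orbit_identity.
Context {R : realType} (t : R).
Hypothesis t_gt0 : 0 < t.
Local Notation C := (cpath t R).
Local Notation mu := (@lebesgue_measure R).
Local Notation Z phi := (Z_ (cpath_ext phi) t).
Variable h : C -> R.
Hypothesis mh : measurable_fun setT h.
Hypothesis hC1 : forall phi, class_C1 (profile h phi).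
Hypothesis hmono : forall phi, strictly_monotone (profile h phi).
Variable F : cpath t (R * R)%type -> R.
Hypothesis F0 : forall psi, 0 <= F psi.
Hypothesis mF : measurable_fun setT F.
Implicit Types phi : C.

Lemma measurable_profile d (T : measurableType d) (phi : T -> C) (xi : T -> R) :
  measurable_fun setT phi -> measurable_fun setT xi ->
  measurable_fun setT (fun x => profile h (phi x) (xi x)).
Proof.
by move=> mphi mxi; apply: (measurableT_comp mh); exact: measurable_steer.
Qed.

Lemma measurable_Z d (T : measurableType d) (phi : T -> C) :
  measurable_fun setT phi -> measurable_fun setT (fun x => Z (phi x)).
Proof.
move=> mphi; have ma := measurableT_comp (measurable_area t_gt0) mphi.
by have me := measurableT_comp (measurable_endpoint t_gt0) mphi; rewrite /Z_; meas.
Qed.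

(** The two integrands of the theorem as functionals of the path, and their common
    form after the change of variables, as a function of the end point [eta]. *)
Definition left_integrand phi : R :=
  F (cpath_pair (steer phi (h phi)) phi) *
  expR (- (cosh (h phi) / Z phi) + cosh (endpoint phi) / Z phi) *
  `|derive1 (profile h phi) (endpoint phi)|.

Definition right_integrand phi : R :=
  F (cpath_pair phi (steer phi (inverse (profile h phi) (endpoint phi)))) *
  \1_(range (profile h phi)) (endpoint phi).

Definition pair_integrand phi (eta : R) : R :=
  F (cpath_pair (steer phi eta) (steer phi (inverse (profile h phi) eta))) *
  \1_(range (profile h phi)) eta * expR (- (cosh eta / Z phi)).

(** Extended by 0 outside the range, the inverse is measurable in both arguments;
    the indicator of the range makes the extension harmless. *)
Let cap_inverse phi eta : R :=
  inverse (profile h phi) eta * \1_(range (profile h phi)) eta.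

Let steer_cap (G : C -> R) phi psi eta :
  G (steer psi (inverse (profile h phi) eta)) * \1_(range (profile h phi)) eta =
  G (steer psi (cap_inverse phi eta)) * \1_(range (profile h phi)) eta.
Proof.
rewrite /cap_inverse indicE; case: (_ \in _); last by rewrite !mulr0.
by rewrite !mulr1.
Qed.

Let cprofile phi : continuous (profile h phi).
Proof. exact: class_C1_continuous. Qed.

Lemma measurable_pair_integrand d (T : measurableType d) (phi : T -> C) (eta : T -> R) :
  measurable_fun setT phi -> measurable_fun setT eta ->
  measurable_fun setT (fun x => pair_integrand (phi x) (eta x)).
Proof.
move=> mphi meta; rewrite /pair_integrand; apply: measurable_funM; last first.
  by have mZ := measurable_Z mphi; rewrite /cosh; meas.
pose f x := profile h (phi x).
have mf u : measurable_fun setT u -> measurable_fun setT (fun x => f x (u x)).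
  exact: measurable_profile.
have hf x : strictly_monotone (f x) by exact: hmono.
have cf x : continuous (f x) by exact: cprofile.
rewrite (_ : (fun x => _) = fun x =>
    F (cpath_pair (steer (phi x) (eta x)) (steer (phi x) (cap_inverse (phi x) (eta x)))) *
    \1_[set x | range (f x) (eta x)] x); last first.
  apply/funext => x; rewrite (steer_cap (fun psi => F (cpath_pair _ psi))).
  by congr (_ * _); rewrite !indicE; congr (_%:R); apply/asbool_equiv_eq.
apply: measurable_funM; last first.
  by apply: measurable_indic; exact: measurable_in_range.
apply: (measurableT_comp mF); apply: measurable_cpath_pair => //.
  exact: measurable_steer.
by apply: measurable_steer => //; exact: (measurable_inverse mf cf hf meta).
Qed.

Lemma measurable_left : measurable_fun setT left_integrand.
Proof.
have mid : measurable_fun setT (fun phi : C => phi) by [].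
have me := measurable_endpoint t_gt0.
rewrite /left_integrand; apply: measurable_funM.
  apply: measurable_funM.
    apply: (measurableT_comp mF); apply: measurable_cpath_pair => //.
    exact: measurable_steer.
  by have mZ := measurable_Z mid; rewrite /cosh; meas.
apply: (measurableT_comp (@normr_measurable R setT)).
apply: measurable_derive1 => //; first by move=> u; exact: measurable_profile.
by move=> phi y; exact: (hC1 phi).1.
Qed.

Lemma measurable_right : measurable_fun setT right_integrand.
Proof.
have mid : measurable_fun setT (fun phi : C => phi) by [].
have me := measurable_endpoint t_gt0.
have mp := measurable_pair_integrand mid me.
rewrite (_ : right_integrand = fun phi => pair_integrand phi (endpoint phi) *
    expR (cosh (endpoint phi) / Z phi)).
  by apply: measurable_funM => //; have mZ := measurable_Z mid; rewrite /cosh; meas.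
apply/funext => phi; rewrite /pair_integrand -mulrA -expRD addNr expR0 mulr1.
by rewrite steer_endpoint.
Qed.

(** On the orbit of [phi] the profile is a fixed function f, and the left integrand
    is [pair_integrand phi] at f xi times |f' xi|. *)
Lemma integral_steer phi :
  (\int[mu]_xi ((left_integrand (steer phi xi))%:E * (expR (- (cosh xi / Z phi)))%:E) =
   \int[mu]_xi ((right_integrand (steer phi xi))%:E * (expR (- (cosh xi / Z phi)))%:E))%E.
Proof.
pose f := profile h phi; pose g eta := (pair_integrand phi eta)%:E.
have mg : measurable_fun setT g.
  by apply/measurable_EFinP; apply: measurable_pair_integrand; [exact: measurable_cst|exact: measurable_id].
have g0 eta : (0 <= g eta)%E.
  by rewrite lee_fin mulr_ge0 ?expR_ge0// mulr_ge0// indicE.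
transitivity (\int[mu]_xi (g (f xi) * `|derive1 f xi|%:E))%E.
  apply: eq_integral => xi _; rewrite /g -!EFinM; congr EFin.
  rewrite /left_integrand profile_steer// endpoint_steer// steer_steer// Z_T//.
  rewrite -[h (steer phi xi)]/(f xi) /pair_integrand inverseK// indicE mem_set; last by exists xi.
  by rewrite mulr1 expRD !expRN; field; rewrite !gt_eqF ?expR_gt0.
rewrite (substitution (hC1 phi) (hmono phi) mg g0) integral_mkcond; apply: eq_integral => eta _.
rewrite patchE /right_integrand profile_steer// endpoint_steer// steer_steer// /g /pair_integrand.
rewrite -EFinM indicE -/f; case: (eta \in range f) => //=.
by rewrite mulr0 mul0r.
Qed.

End orbit_identity.

Theorem theorem1p1 (d : measure_display) (Omega : measurableType d)
  (R : realType) (P : probability Omega R)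
  (B : R -> {RV P >-> R}) (bm : brownian_motion B)
  (t : R) (ht : 0 < t)
  (h : cpath t R -> R) (mh : measurable_fun [set: cpath t R] h)
  (hC1 : forall phi : cpath t R, class_C1 (profile h phi))
  (hmono : forall phi : cpath t R, strictly_monotone (profile h phi))
  (F : cpath t (R * R)%type -> R)
  (F0 : forall psi, 0 <= F psi)
  (mF : measurable_fun [set: cpath t (R * R)%type] F) :
  let Bt := bm_path bm t in
  ('E_P[(fun w =>
          F (cpath_pair (T_ (B t w - h (Bt w)) (Bt w)) (Bt w))
          * expR (- (cosh (h (Bt w)) / Z_ (B ^~ w) t)
                  + cosh (B t w) / Z_ (B ^~ w) t)
          * `| derive1 (profile h (Bt w)) (B t w) |)%R]
   = 'E_P[(fun w =>
          F (cpath_pair (Bt w)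
              (T_ (B t w - inverse (profile h (Bt w)) (B t w)) (Bt w)))
          * \1_[set w' | B t w' \in range (profile h (Bt w'))] w)%R])%E.
Proof.
move=> Bt.
have tt : t \in `[0, t] by rewrite in_itv/= lexx ltW.
have eB w : endpoint (Bt w) = B t w by exact: path_bm.
have ZB w : Z_ (cpath_ext (Bt w)) t = Z_ (B ^~ w) t.
  by rewrite /Z_ A_bm// -/(endpoint _) eB.
rewrite unlock.
transitivity (\int[P]_w (left_integrand h F (Bt w))%:E)%E.
  by apply: eq_integral => w _; rewrite /left_integrand /steer eB ZB.
transitivity (\int[P]_w (right_integrand h F (Bt w))%:E)%E; last first.
  apply: eq_integral => w _; rewrite /right_integrand /steer eB; congr (EFin (_ * _)).
  by rewrite !indicE; congr (_%:R); rewrite mem_setE.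
have mL : measurable_fun setT (fun phi => (left_integrand h F phi)%:E).
  by apply/measurable_EFinP; exact: measurable_left.
have mR : measurable_fun setT (fun phi => (right_integrand h F phi)%:E).
  by apply/measurable_EFinP; exact: measurable_right.
have L0 phi : (0 <= (left_integrand h F phi)%:E)%E.
  by rewrite lee_fin mulr_ge0// mulr_ge0 ?expR_ge0.
have R0 phi : (0 <= (right_integrand h F phi)%:E)%E.
  by rewrite lee_fin mulr_ge0// indicE.
transitivity (\int[P]_w ((end_density (Bt w))%:E * \int[lebesgue_measure]_xi
    ((left_integrand h F (steer (Bt w) xi))%:E *
     (expR (- (cosh xi / Z_ (cpath_ext (Bt w)) t)))%:E))%E)%E.
  exact: (brownian_disintegration bm ht mL L0).
transitivity (\int[P]_w ((end_density (Bt w))%:E * \int[lebesgue_measure]_xi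
    ((right_integrand h F (steer (Bt w) xi))%:E *
     (expR (- (cosh xi / Z_ (cpath_ext (Bt w)) t)))%:E))%E)%E.
  by apply: eq_integral => w _; congr (_ * _)%E; exact: integral_steer.
exact/esym/(brownian_disintegration bm ht mR R0).
Qed.
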